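(* Let $A$ be a pointed quasi-category which admits all pushouts and all pullbacks. Then $A$ has a loops–suspension adjunction $\Sigma\dashv\Omega\colon A\to A$; that is, the suspension functor $\Sigma\colon A\to A$ is left adjoint to the loop space functor $\Omega\colon A\to A$ in $\mathrm{qCat}_2$.
   Context: A quasi-category is a simplicial set with fillers for all inner horns; functors are simplicial maps between quasi-categories. $\mathrm{qCat}_2$ is the strict 2-category of quasi-categories with hom-categories $\hom'(A,B)=h(B^A)$, where $B^A$ is the internal hom and $h\colon\mathrm{sSet}\to\mathrm{Cat}$ is left adjoint to the nerve. Adjunctions of quasi-categories are adjunctions in $\mathrm{qCat}_2$. For $f\colon B\to A$, $g\colon C\to A$, $\ell\colon C\to B$: a 2-cell $\lambda\colon f\ell\Rightarrow g$ displays $\ell$ as an absolute right lifting of $g$ through $f$ if for all $b\colon Y\to B$, $y\colon Y\to C$ and every $\chi\colon fb\Rightarrow gy$ there is a unique $\zeta\colon b\Rightarrow\ell y$ with $\chi=\lambda y\cdot f\zeta$; dually $\lambda\colon g\Rightarrow f\ell$ displays $\ell$ as an absolute left lifting if for every $\chi\colon gy\Rightarrow fb$ there is a unique $\zeta\colon\ell y\Rightarrow b$ with $\chi=f\zeta\cdot\lambda y$. $A$ admits limits (colimits) of a family $k\colon K\to A^X$ if $k$ has an absolute right (left) lifting through the constant diagram functor $c\colon A\to A^X$, and all limits (colimits) of shape $X$ if this holds for $k=\mathrm{id}_{A^X}$. Let $P\subset\Delta^1\times\Delta^1$ be the simplicial subset $(\Delta^1\times\{1\})\cup(\{1\}\times\Delta^1)$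 (cospan shape) and $S=(\Delta^1\times\{0\})\cup(\{0\}\times\Delta^1)$ (span shape). Pullbacks are limits of shape $P$ and pushouts are colimits of shape $S$. An object $t$ of $A$ is terminal (initial) if $t\colon\Delta^0\to A$ is right (left) adjoint to $!\colon A\to\Delta^0$; a zero object is one that is both. $A$ is pointed if it has a zero object $*$. The family of points is the counit $\rho\colon *!\Rightarrow\mathrm{id}_A$ of $*\dashv{!}$, and the family of co-points is the unit $\xi\colon\mathrm{id}_A\Rightarrow *!$ of ${!}\dashv *$; choose representatives $\rho,\xi\colon A\to A^{\Delta^1}$. Since $A^P$ is the pullback of two copies of the codomain evaluation $A^{\Delta^1}\to A$, two copies of $\rho$ give a functor $\bar\rho\colon A\to A^P$ (sending $a$ to $*\to a\leftarrow *$); dually two copies of $\xi$ give $\bar\xi\colon A\to A^S$ (sending $a$ to $*\leftarrow a\to *$). The loop space functor $\Omega\colon A\to A$ is the absolute right lifting of $\bar\rho$ through $c\colon A\to A^P$, and the suspension functor $\Sigma\colon A\to A$ is the absolute left lifting of $\bar\xi$ through $c\colon A\to A^S$; they exist in particular when $A$ admits all pullbacks, respectively all pushouts. *)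

(* Defs.v *)
From mathcomp Require Import all_boot.
From mathcomp Require Import boolp.

Set Implicit Arguments.
Unset Strict Implicit.
Unset Printing Implicit Defensive.
Set Primitive Projections.

#[local] Obligation Tactic := idtac.

Local Open Scope quotient_scope.

(* Monotone maps [m] -> [n].  All records of maps below are primitive and their
   axioms are phrased so that composition is associative and unital up to
   conversion; hence the two sides of a whiskering or a triangle identity have
   the same type without any transport. *)
Record dmap (m n : nat) := DMap {
  dfun :> 'I_m.+1 -> 'I_n.+1;
  dmono : forall i j : 'I_m.+1, i <= j -> dfun i <= dfun j }.

Definition did n : dmap n n := @DMap n n (fun i => i) (fun _ _ le_ij => le_ij).

Definition dcomp l m n (b : dmap m n) (a : dmap l m) : dmap l n :=
  @DMap l n (fun i => b (a i)) (fun _ _ le_ij => dmono b (dmono a le_ij)).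

Definition dconst m n (v : 'I_n.+1) : dmap m n :=
  @DMap m n (fun _ => v) (fun _ _ _ => leqnn v).

Lemma dmapP m n (a b : dmap m n) : (forall i, a i = b i) -> a = b.
Proof.
case: a b => [a ma] [b mb] /= /funext eq_ab; subst b.
by rewrite (Prop_irrelevance ma mb).
Qed.

(* [act a x] is the right action x.a of the simplicial operator a. *)
Record sset := SSet {
  sob :> nat -> Type;
  act : forall m n, dmap m n -> sob n -> sob m;
  act1 : forall n (x : sob n), act (did n) x = x;
  actM : forall l m n (b : dmap m n) (a : dmap l m) (x : sob n),
    act (dcomp b a) x = act a (act b x) }.
Arguments act {s m n} a x.

Record smap (X Y : sset) := SMap {
  sfun :> forall n, X n -> Y n;
  snat : forall m n (a : dmap m n) x y, act a x = y ->
    act a (@sfun n x) = @sfun m y }.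
Arguments sfun {X Y} s {n} x.
Arguments snat {X Y} s {m n a x y} e.

Definition sid X : smap X X := @SMap X X (fun _ x => x) (fun _ _ _ _ _ e => e).

Definition scomp X Y Z (g : smap Y Z) (f : smap X Y) : smap X Z :=
  @SMap X Z (fun _ x => g _ (f _ x)) (fun _ _ _ _ _ e => snat g (snat f e)).

Lemma smapP X Y (f g : smap X Y) : (forall n (x : X n), f n x = g n x) -> f = g.
Proof.
case: f g => [f nf] [g ng] /= eq_fg.
have {}eq_fg : f = g.
  by apply: functional_extensionality_dep => n; apply: funext.
by subst g; rewrite (Prop_irrelevance nf ng).
Qed.

Definition simplex (n : nat) : sset :=
  @SSet (fun m => dmap m n) (fun _ _ a s => dcomp s a)
    (fun _ _ => erefl) (fun _ _ _ _ _ _ => erefl).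

Definition bang X : smap X (simplex 0) :=
  @SMap X (simplex 0) (fun m _ => dconst m ord0) (fun _ _ _ _ _ _ => erefl).

Program Definition sprod (X Y : sset) : sset :=
  @SSet (fun n => (X n * Y n)%type) (fun _ _ a p => (act a p.1, act a p.2)) _ _.
Next Obligation. by move=> X Y n [x y]; rewrite /= !act1. Qed.
Next Obligation. by move=> X Y l m n b a [x y]; rewrite /= !actM. Qed.

Program Definition subsset (X : sset) (P : forall n, X n -> Prop)
    (closedP : forall m n (a : dmap m n) x, P n x -> P m (act a x)) : sset :=
  @SSet (fun n => {x : X n | P n x})
    (fun _ _ a x => exist _ (act a (sval x)) (closedP _ _ a _ (svalP x))) _ _.
Next Obligation. by move=> X P cP n [x Px]; apply: eq_exist; rewrite act1. Qed.
Next Obligation.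
by move=> X P cP l m n b a [x Px]; apply: eq_exist; rewrite actM.
Qed.

Definition sincl (X : sset) P cP : smap (@subsset X P cP) X :=
  @SMap (@subsset X P cP) X (fun _ x => sval x) (fun _ _ _ _ _ e => f_equal sval e).

(* The union of the faces of Delta^n opposite to the vertices j <> k. *)
Definition in_horn n (k : 'I_n.+1) m (s : simplex n m) : Prop :=
  exists2 j : 'I_n.+1, j <> k & forall i, s i <> j.

Lemma in_horn_act n (k : 'I_n.+1) l m (a : dmap l m) (s : simplex n m) :
  in_horn k s -> in_horn k (act a s).
Proof. by case=> j jk sj; exists j => // i; apply: sj. Qed.

Definition horn n k : sset := subsset (@in_horn_act n k).
Definition horn_incl n k : smap (@horn n k) (simplex n) := sincl (@in_horn_act n k).

Definition quasi_category (X : sset) : Prop :=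
  forall (n : nat) (k : 'I_n.+1), 0 < k < n ->
  forall h : smap (horn k) X,
  exists s : smap (simplex n) X, scomp s (horn_incl k) = h.

(* The n-simplices of A^X, i.e. the simplicial maps Delta^n * X -> A, in curried
   form. *)
Record hsimplex (X A : sset) (n : nat) := HSimplex {
  hfun :> forall m, dmap m n -> X m -> A m;
  hnat : forall l m (a : dmap l m) (s : dmap m n) x y, act a x = y ->
    act a (@hfun m s x) = @hfun l (dcomp s a) y }.
Arguments hfun {X A n} h {m} s x.
Arguments hnat {X A n} h {l m a} s {x y} e.

Lemma hsimplexP X A n (u v : hsimplex X A n) :
  (forall m (s : dmap m n) x, u m s x = v m s x) -> u = v.
Proof.
case: u v => [u nu] [v nv] /= eq_uv.
have {}eq_uv : u = v.
  apply: functional_extensionality_dep => m.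
  by apply: funext => s; apply: funext.
by subst v; rewrite (Prop_irrelevance nu nv).
Qed.

Definition ihom_act X A m n (b : dmap m n) (u : hsimplex X A n) : hsimplex X A m :=
  @HSimplex X A m (fun _ s x => u _ (dcomp b s) x)
    (fun _ _ _ s _ _ e => hnat u (dcomp b s) e).

Definition ihom (X A : sset) : sset :=
  @SSet (hsimplex X A) (@ihom_act X A) (fun _ _ => erefl) (fun _ _ _ _ _ _ => erefl).

Definition uncurry X A n (u : ihom X A n) : smap (sprod (simplex n) X) A.
Proof.
refine (@SMap (sprod (simplex n) X) A (fun _ p => u _ p.1 p.2) _).
by move=> l m a [s x] _ <- /=; apply: hnat.
Defined.

Lemma uncurry_bij X A n : bijective (@uncurry X A n).
Proof.
pose curry (f : smap (sprod (simplex n) X) A) : hsimplex X A n :=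
  @HSimplex X A n (fun _ s x => f _ (s, x))
    (fun _ _ a s x y e => @snat _ _ f _ _ a (s, x) (dcomp s a, y)
       (f_equal (pair (dcomp s a)) e)).
by exists curry => [u|f]; [apply: hsimplexP | apply: smapP => m []].
Qed.

Definition postc X A B (f : smap A B) : smap (ihom X A) (ihom X B).
Proof.
refine (@SMap (ihom X A) (ihom X B)
  (fun n u => @HSimplex X B n (fun _ s x => f _ (u _ s x))
     (fun _ _ _ s _ _ e => snat f (hnat u s e))) _).
by move=> m n a u _ <-; apply: hsimplexP.
Defined.

Definition prec X Y A (g : smap X Y) : smap (ihom Y A) (ihom X A).
Proof.
refine (@SMap (ihom Y A) (ihom X A)
  (fun n u => @HSimplex X A n (fun _ s x => u _ s (g _ x))
     (fun _ _ _ s _ _ e => hnat u s (snat g e))) _).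
by move=> m n a u _ <-; apply: hsimplexP.
Defined.

Definition const_diag X A : smap A (ihom X A).
Proof.
refine (@SMap A (ihom X A)
  (fun n a => @HSimplex X A n (fun _ s _ => act s a)
     (fun _ _ b s _ _ _ => esym (actM s b a))) _).
by move=> m n b a _ <-; apply: hsimplexP => l s x /=; rewrite actM.
Defined.

Definition eval_at (X A : sset) (v : X 0) : smap (ihom X A) A.
Proof.
refine (@SMap (ihom X A) A (fun n u => u _ (did n) (act (dconst n ord0) v)) _).
move=> m n a u _ <- /=; apply: hnat.
by rewrite -actM; congr (act _ v); apply: dmapP.
Defined.

Record category := Category {
  cob :> Type;
  hom : cob -> cob -> Type;
  idm : forall x, hom x x;
  cmp : forall x y z, hom y z -> hom x y -> hom x z;
  cmp1m : forall x y (f : hom x y), cmp (idm y) f = f;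
  cmpm1 : forall x y (f : hom x y), cmp f (idm x) = f;
  cmpA : forall x y z t (h : hom z t) (g : hom y z) (f : hom x y),
    cmp h (cmp g f) = cmp (cmp h g) f }.
Arguments hom {c} x y.
Arguments idm {c} x.
Arguments cmp {c x y z} g f.

Record functor (C D : category) := Functor {
  fob :> C -> D;
  fmap : forall x y, hom x y -> hom (fob x) (fob y);
  fmap1 : forall x, fmap (idm x) = idm (fob x);
  fmapM : forall x y z (g : @hom C y z) (f : hom x y),
    fmap (cmp g f) = cmp (fmap g) (fmap f) }.
Arguments fmap {C D} _ {x y} _.

Definition fcomp C D E (G : functor D E) (F : functor C D) : functor C E.
Proof.
refine (@Functor C E (fun x => G (F x)) (fun _ _ f => fmap G (fmap F f)) _ _).
- by move=> x; rewrite !fmap1.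
- by move=> x y z g f; rewrite !fmapM.
Defined.

(* Arrows packed with their endpoints, to compare arrows of different hom-sets. *)
Definition arr (C : category) (x y : C) (f : hom x y) :
    {xy : C * C & hom xy.1 xy.2} :=
  existT (fun xy : C * C => hom xy.1 xy.2) (x, y) f.

Lemma arr_inj (C : category) (x y : C) (f g : hom x y) : arr f = arr g -> f = g.
Proof.
move=> e; have /= := projT2_eq e.
by rewrite (Prop_irrelevance (projT1_eq e) erefl).
Qed.

Lemma functorP (C D : category) (F G : functor C D) :
  (forall x y (f : hom x y), arr (fmap F f) = arr (fmap G f)) -> F = G.
Proof.
case: F G => [F F2 F1 FM] [G G2 G1 GM] /= eqFG.
have e : F = G.
  by apply: funext => x; case: (projT1_eq (eqFG _ _ (idm x))).
subst G; have e : F2 = G2.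
  apply: functional_extensionality_dep => x.
  apply: functional_extensionality_dep => y.
  by apply: funext => f; apply: arr_inj.
by subst G2; rewrite (Prop_irrelevance F1 G1) (Prop_irrelevance FM GM).
Qed.

Definition ordcat (n : nat) : category :=
  @Category 'I_n.+1 (fun i j => is_true (i <= j)) (fun i => leqnn i)
    (fun _ _ _ jk ij => leq_trans ij jk)
    (fun _ _ _ => Prop_irrelevance _ _) (fun _ _ _ => Prop_irrelevance _ _)
    (fun _ _ _ _ _ _ _ => Prop_irrelevance _ _).

Lemma ordcat_irr n (i j : ordcat n) (f g : hom i j) : f = g.
Proof. exact: (@Prop_irrelevance (i <= j)). Qed.

Definition ordfun m n (a : dmap m n) : functor (ordcat m) (ordcat n) :=
  @Functor (ordcat m) (ordcat n) a (fun i j ij => dmono a ij)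
    (fun _ => ordcat_irr _ _) (fun _ _ _ _ _ => ordcat_irr _ _).

Program Definition nerve (C : category) : sset :=
  @SSet (fun n => functor (ordcat n) C) (fun _ _ a F => fcomp F (ordfun a)) _ _.
Next Obligation. by move=> C n F; apply: functorP. Qed.
Next Obligation. by move=> C l m n b a F; apply: functorP. Qed.

Definition nerve_map C D (G : functor C D) : smap (nerve C) (nerve D).
Proof.
refine (@SMap (nerve C) (nerve D) (fun _ F => fcomp G F) _).
by move=> m n a F _ <-; apply: functorP.
Defined.

Definition dface n (j : 'I_n.+2) : dmap n n.+1.
Proof.
refine (@DMap n n.+1 (lift j) _).
by move=> i i' le_i; rewrite /= leq_bump2.
Defined.

(* [d_ j x] is the face of x opposite to the vertex j. *)
Definition d_ (X : sset) n (j : 'I_n.+2) (x : X n.+1) : X n := act (dface j) x.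

Definition degen (X : sset) (x : X 0) : X 1 := act (dconst 1 ord0) x.

Record edge (X : sset) (x y : X 0) := Edge {
  edge_val :> X 1;
  edge_src : d_ ord_max edge_val = x;
  edge_tgt : d_ ord0 edge_val = y }.

Inductive path (X : sset) : X 0 -> X 0 -> Type :=
| pnil x : path x x
| pcons x y z : edge x y -> path y z -> path x z.
Arguments pnil {X} x.

Definition path1 (X : sset) (x y : X 0) (e : edge x y) : path x y :=
  pcons e (pnil y).

Fixpoint pcat (X : sset) (x y z : X 0) (p : path x y) : path y z -> path x z :=
  match p in path x y return path y z -> path x z with
  | pnil _ => fun q => q
  | pcons _ _ _ e p' => fun q => pcons e (pcat p' q)
  end.

(* The congruence, on the free category on the graph of 0- and 1-simplices,
   generated by the degenerate edges and the 2-simplices. *)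
Inductive peq (X : sset) : forall x y : X 0, path x y -> path x y -> Prop :=
| peq_refl x y (p : path x y) : peq p p
| peq_sym x y (p q : path x y) : peq p q -> peq q p
| peq_trans x y (p q r : path x y) : peq p q -> peq q r -> peq p r
| peq_cat x y z (p p' : path x y) (q q' : path y z) :
    peq p p' -> peq q q' -> peq (pcat p q) (pcat p' q')
| peq_degen x (e : edge x x) : edge_val e = degen x -> peq (path1 e) (pnil x)
| peq_triangle x y z (f : edge x y) (g : edge y z) (h : edge x z) (t : X 2) :
    d_ ord_max t = f -> d_ ord0 t = g -> d_ (@Ordinal 3 1 isT) t = h ->
    peq (pcat (path1 f) (path1 g)) (path1 h).

Section HomotopyCategory.
Variable X : sset.
Implicit Types x y z : X 0.

Definition peqb x y : rel {classic path x y} := fun p q => `[< peq p q >].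

Lemma peqb_refl x y : reflexive (@peqb x y).
Proof. by move=> p; apply/asboolP; apply: peq_refl. Qed.
Lemma peqb_sym x y : symmetric (@peqb x y).
Proof. by move=> p q; apply/asboolP/asboolP; apply: peq_sym. Qed.
Lemma peqb_trans x y : transitive (@peqb x y).
Proof. by move=> q p r /asboolP pq /asboolP qr; apply/asboolP/(peq_trans pq qr). Qed.

Canonical peq_equiv x y :=
  EquivRel (@peqb x y) (@peqb_refl x y) (@peqb_sym x y) (@peqb_trans x y).

Definition hhom x y : Type := {eq_quot @peqb x y}.

Definition pclass x y (p : path x y) : hhom x y := \pi_({eq_quot @peqb x y}) p.
Definition prepr x y (f : hhom x y) : path x y := repr f.

Lemma preprK x y (f : hhom x y) : pclass (prepr f) = f.
Proof. exact: reprK. Qed.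

Lemma pclassP x y (p q : path x y) : pclass p = pclass q <-> peq p q.
Proof.
split=> [/eqmodP/asboolP //|pq].
by apply/eqmodP/asboolP.
Qed.

Lemma prepr_class x y (p : path x y) : peq (prepr (pclass p)) p.
Proof. by apply/pclassP; apply: preprK. Qed.

Definition hcmp x y z (g : hhom y z) (f : hhom x y) : hhom x z :=
  pclass (pcat (prepr f) (prepr g)).

Lemma hcmpE x y z (q : path y z) (p : path x y) :
  hcmp (pclass q) (pclass p) = pclass (pcat p q).
Proof. by apply/pclassP/peq_cat; apply: prepr_class. Qed.

Lemma pcat_nil x y (p : path x y) : pcat p (pnil y) = p.
Proof. by elim: p => //= {}x z {}y e p ->. Qed.

Lemma pcatA x y z t (p : path x y) (q : path y z) (r : path z t) :
  pcat p (pcat q r) = pcat (pcat p q) r.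
Proof. by elim: p q => //= {}x w {}y e p IH q; rewrite IH. Qed.

Program Definition hcat : category :=
  @Category (X 0) hhom (fun x => pclass (pnil x)) hcmp _ _ _.
Next Obligation.
by move=> x y f; rewrite -[f]preprK hcmpE pcat_nil.
Qed.
Next Obligation. by move=> x y f; rewrite -[f]preprK hcmpE. Qed.
Next Obligation.
move=> x y z t h g f; rewrite -[f]preprK -[g]preprK -[h]preprK !hcmpE.
by rewrite pcatA.
Qed.

End HomotopyCategory.

Definition edge_map X Y (F : smap X Y) (x y : X 0) (e : edge x y) :
    edge (F 0 x) (F 0 y) :=
  Edge (snat F (edge_src e)) (snat F (edge_tgt e)).

Fixpoint pmap X Y (F : smap X Y) (x y : X 0) (p : path x y) :
    path (F 0 x) (F 0 y) :=
  match p in path x y return path (F 0 x) (F 0 y) with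
  | pnil x => pnil (F 0 x)
  | pcons _ _ _ e p' => pcons (edge_map F e) (pmap F p')
  end.

Lemma pmap_cat X Y (F : smap X Y) (x y z : X 0) (p : path x y) (q : path y z) :
  pmap F (pcat p q) = pcat (pmap F p) (pmap F q).
Proof. by elim: p q => //= {}x w {}y e p IH q; rewrite IH. Qed.

Lemma peq_map X Y (F : smap X Y) (x y : X 0) (p q : path x y) :
  peq p q -> peq (pmap F p) (pmap F q).
Proof.
elim=> {x y p q}.
- by move=> *; apply: peq_refl.
- by move=> x y p q _; apply: peq_sym.
- by move=> x y p q r _ pq _; apply: peq_trans.
- by move=> x y z p p' q q' _ pp' _ qq'; rewrite !pmap_cat; apply: peq_cat.
- by move=> x e ee; apply: peq_degen; rewrite /= ee; apply/esym/snat.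
- move=> x y z f g h t tf tg th.
  by apply: (@peq_triangle _ _ _ _ _ _ _ (F 2 t)); apply: snat.
Qed.

Definition hmap X Y (F : smap X Y) : functor (hcat X) (hcat Y).
Proof.
refine (@Functor (hcat X) (hcat Y) (fun x : X 0 => F 0 x)
  (fun x y f => pclass (pmap F (prepr f))) _ _).
- by move=> x; apply/pclassP; apply: (peq_map F (prepr_class _)).
- move=> x y z g f /=; rewrite -[in LHS](preprK f) -[in LHS](preprK g) hcmpE.
  rewrite hcmpE -pmap_cat; apply/pclassP/peq_map; exact: prepr_class.
Defined.

Lemma hmapE X Y (F : smap X Y) (x y : X 0) (p : path x y) :
  fmap (hmap F) (pclass p : @hom (hcat X) x y) = pclass (pmap F p).
Proof. by apply/pclassP/peq_map; apply: prepr_class. Qed.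

Definition dedge n (i j : 'I_n.+1) (ij : i <= j) : dmap 1 n.
Proof.
refine (@DMap 1 n (fun b => if b == 0 :> nat then i else j) _).
by move=> [[|[|b]] ltb] [[|[|c]] ltc].
Defined.

Definition sedge (X : sset) n (x : X n) (i j : 'I_n.+1) (ij : i <= j) :
  edge (act (dconst 0 i) x) (act (dconst 0 j) x).
Proof.
exists (act (dedge ij) x); rewrite /d_ -actM; congr (act _ x);
  by apply: dmapP => -[[|b] ltb].
Defined.

Definition hunit_simplex (X : sset) n (x : X n) : nerve (hcat X) n.
Proof.
refine (@Functor (ordcat n) (hcat X) (fun i : 'I_n.+1 => act (dconst 0 i) x)
  (fun i j ij => pclass (path1 (sedge x ij))) _ _).
- move=> i; apply/pclassP/peq_degen => /=.
  by rewrite /degen -actM; congr (act _ x); apply: dmapP => b /=; case: ifP.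
- move=> i j k jk ij; rewrite /= hcmpE; apply/pclassP/peq_sym.
  have dtri : {a : dmap 2 n | forall b : 'I_3,
      a b = if b == 0 :> nat then i else if b == 1 :> nat then j else k}.
    unshelve eexists (@DMap 2 n (fun b : 'I_3 =>
      if b == 0 :> nat then i else if b == 1 :> nat then j else k) _) => //.
    by move=> [[|[|[|b]]] ltb] [[|[|[|c]]] ltc] //= _; apply: leq_trans ij jk.
  case: dtri => a aE.
  by apply: (@peq_triangle _ _ _ _ _ _ _ (act a x));
    rewrite /d_ -actM; congr (act _ x); apply: dmapP => -[[|[|b]] ltb];
    rewrite /= aE.
Defined.

Lemma arr_edge (X : sset) (x y x' y' : X 0) (e : edge x y) (e' : edge x' y') :
  edge_val e = edge_val e' ->
  @arr (hcat X) x y (pclass (path1 e)) = @arr (hcat X) x' y' (pclass (path1 e')).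
Proof.
case: e e' => [e ex ey] [e' ex' ey'] /= ee'.
subst e'; subst x; subst y; subst x'; subst y'.
by [].
Qed.

Definition hunit X : smap X (nerve (hcat X)).
Proof.
refine (@SMap X (nerve (hcat X)) (@hunit_simplex X) _).
move=> m n a x _ <-; apply: functorP => i j ij; apply: arr_edge => /=.
by rewrite -actM; congr (act _ x); apply: dmapP => b /=; case: ifP.
Defined.

Lemma hunit_natural X Y (F : smap X Y) :
  scomp (nerve_map (hmap F)) (hunit X) = scomp (hunit Y) F.
Proof.
apply: smapP => n x; apply: functorP => i j ij.
rewrite [LHS](f_equal (@arr (hcat Y) _ _) (hmapE F (path1 (sedge x ij)))).
by apply: arr_edge; apply/esym/snat.
Qed.

Lemma arr_cmp (C : category) (x y z x' y' z' : C) (f : hom x y) (g : hom y z)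
    (f' : hom x' y') (g' : hom y' z') :
  arr f = arr f' -> arr g = arr g' -> arr (cmp g f) = arr (cmp g' f').
Proof.
move=> ef eg.
have [ex ey] : x = x' /\ y = y' by case: (projT1_eq ef).
have ez : z = z' by case: (projT1_eq eg).
by subst x' y' z'; rewrite (arr_inj ef) (arr_inj eg).
Qed.

Lemma arr_fmap (C D : category) (G : functor C D) (x y x' y' : C)
    (f : hom x y) (f' : hom x' y') :
  arr f = arr f' -> arr (fmap G f) = arr (fmap G f').
Proof.
move=> ef; have [ex ey] : x = x' /\ y = y' by case: (projT1_eq ef).
by subst x' y'; rewrite (arr_inj ef).
Qed.

Lemma arr_cast (C : category) (x y x' y' : C) (f : hom x y) :
  x = x' -> y = y' -> {g : hom x' y' | arr g = arr f}.
Proof. by move=> ex ey; subst x' y'; exists f. Qed.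

Lemma sedge1 (X : sset) (e : X 1) (le01 : @ord0 1 <= @ord_max 1) :
  edge_val (sedge e le01) = e.
Proof.
rewrite /= -[RHS]act1; congr (act _ e); apply: dmapP => -[[|[|b]] ltb] //=;
  exact: val_inj.
Qed.

(* With [hunit_natural]: [hcat], acting on maps by [hmap], is left adjoint to
   the nerve, with unit [hunit]. *)
Theorem hcat_left_adjoint (X : sset) (C : category) (F : smap X (nerve C)) :
  exists! G : functor (hcat X) C, scomp (nerve_map G) (hunit X) = F.
Proof.
have le01 : @ord0 1 <= @ord_max 1 by [].
pose Go (x : X 0) : C := F 0 x ord0.
have Fob n (x : X n) i : F n x i = Go (act (dconst 0 i) x).
  by rewrite /Go -(snat F (erefl (act (dconst 0 i) x))).
have Farr n (x : X n) (i j : 'I_n.+1) (ij : i <= j) :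
    arr (fmap (F n x) (ij : @hom (ordcat n) i j)) =
    arr (fmap (F 1 (act (dedge ij) x)) (le01 : @hom (ordcat 1) ord0 ord_max)).
  rewrite -(snat F (erefl (act (dedge ij) x))) /=.
  by congr (arr (fmap _ _)); apply: Prop_irrelevance.
have Gedge (x y : X 0) (e : edge x y) : {g : hom (Go x) (Go y) |
    arr g = arr (fmap (F 1 e) (le01 : @hom (ordcat 1) ord0 ord_max))}.
  apply: arr_cast; rewrite Fob; congr Go.
    by rewrite -(edge_src e); congr (act _ _); apply: dmapP => -[[|b] ltb] //; apply: val_inj.
  by rewrite -(edge_tgt e); congr (act _ _); apply: dmapP => -[[|b] ltb] //; apply: val_inj.
pose fix Gp (x y : X 0) (p : path x y) : hom (Go x) (Go y) :=
  match p in path x y return hom (Go x) (Go y) with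
  | pnil x => idm (Go x)
  | pcons _ _ _ e p' => cmp (Gp _ _ p') (sval (Gedge _ _ e))
  end.
have Gp1 (x y : X 0) (e : edge x y) : Gp _ _ (path1 e) = sval (Gedge _ _ e).
  by rewrite /= cmp1m.
have Gcat (x y z : X 0) (p : path x y) (q : path y z) :
    Gp _ _ (pcat p q) = cmp (Gp _ _ q) (Gp _ _ p).
  elim: p q => [{}x|{}x w {}y e p IH] q /=; first by rewrite cmpm1.
  by rewrite IH cmpA.
have Gpeq (x y : X 0) (p q : path x y) : peq p q -> Gp _ _ p = Gp _ _ q.
  elim=> {x y p q} //.
  - by move=> x y p q r _ -> _ ->.
  - by move=> x y z p p' q q' _ pp' _ qq'; rewrite !Gcat pp' qq'.
  - move=> x e ee; rewrite Gp1; apply: arr_inj; rewrite (svalP (Gedge _ _ e)).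
    rewrite ee -(snat F (erefl (degen x))) /=.
    transitivity (arr (fmap (F 0 x) (@idm (ordcat 0) ord0))).
      by congr (arr (fmap (F 0 x) _)); apply: ordcat_irr.
    by rewrite fmap1.
  - move=> x y z f g h t tf tg th; rewrite Gcat !Gp1; apply: arr_inj.
    rewrite (svalP (Gedge _ _ h)).
    pose o1 := @Ordinal 3 1 isT.
    have l01 : (ord0 : 'I_3) <= o1 by [].
    have l12 : o1 <= (ord_max : 'I_3) by [].
    have l02 : (ord0 : 'I_3) <= (ord_max : 'I_3) by [].
    have dE (i j : 'I_3) (ij : i <= j) k : (forall b, dedge ij b = dface k b) ->
        act (dedge ij) t = d_ k t by move=> /dmapP ->.
    have e01 : act (dedge l01) t = f.
      by rewrite -tf; apply: dE => -[[|[|b]] ltb] //; apply: val_inj.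
    have e12 : act (dedge l12) t = g.
      by rewrite -tg; apply: dE => -[[|[|b]] ltb] //; apply: val_inj.
    have e02 : act (dedge l02) t = h.
      by rewrite -th; apply: dE => -[[|[|b]] ltb] //; apply: val_inj.
    transitivity (arr (cmp (fmap (F 2 t) (l12 : @hom (ordcat 2) _ _))
                           (fmap (F 2 t) (l01 : @hom (ordcat 2) _ _)))).
      by apply: arr_cmp; rewrite (svalP (Gedge _ _ _)) (Farr _ t) ?e01 ?e12.
    have := Farr _ t _ _ l02; rewrite e02 => <-; rewrite -fmapM.
    by congr (arr (fmap _ _)); apply: ordcat_irr.
have GM (x y : X 0) (p : path x y) : Gp _ _ (prepr (pclass p)) = Gp _ _ p.
  exact/Gpeq/prepr_class.
unshelve eexists (@Functor (hcat X) C Go (fun x y f => Gp x y (prepr f)) _ _).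
- by move=> x; rewrite /= GM.
- by move=> x y z g f; rewrite /= GM Gcat.
split.
  apply: smapP => n x; apply: functorP => i j ij /=.
  by rewrite GM Gp1 (svalP (Gedge _ _ _)) /= -Farr.
move=> G GF.
have Gob (x : X 0) : G x = Go x.
  by rewrite /Go -GF /= -[in LHS](act1 x); congr (G (act _ x)); apply: dmapP => i; rewrite [i]ord1.
apply: functorP => x y f /=; rewrite -[f]preprK GM.
elim: (prepr f) => {x y f} [x|x w y e p IH] /=.
  by rewrite -Gob [fmap G _](fmap1 G x).
rewrite -[pcons e p]/(pcat (path1 e) p) -hcmpE [fmap G _](fmapM G).
apply: arr_cmp => //.
rewrite (svalP (Gedge _ _ e)) -GF /=.
by apply/arr_fmap/arr_edge/sedge1.
Qed.

(* The vertex of B^A corresponding to a functor A -> B. *)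
Definition vert A B (f : smap A B) : ihom A B 0 :=
  @HSimplex A B 0 (fun _ _ x => f _ x) (fun _ _ _ _ _ _ e => snat f e).

Lemma vert_bij A B : bijective (@vert A B).
Proof.
pose devert (u : ihom A B 0) : smap A B :=
  @SMap A B (fun n x => u n (dconst n ord0) x) (fun _ _ _ _ _ e => hnat u _ e).
exists devert => [f|u]; first exact: smapP.
apply: hsimplexP => m s x /=; congr (u m _ x).
by apply: dmapP => i; rewrite [s i]ord1.
Qed.

Definition hom' (A B : sset) : category := hcat (ihom A B).

(* 2-cells, defined between maps of arbitrary simplicial sets: the 2-category of
   quasi-categories is the full sub-2-category on the quasi-categories. *)
Definition cell A B (f g : smap A B) : Type := @hom (hom' A B) (vert f) (vert g).

Definition idcell A B (f : smap A B) : cell f f := @idm (hom' A B) (vert f).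

Definition vcomp A B (f g h : smap A B) (b : cell g h) (a : cell f g) : cell f h :=
  @cmp (hom' A B) _ _ _ b a.

Definition postw A B C (f : smap B C) (g h : smap A B) (a : cell g h) :
    cell (scomp f g) (scomp f h) :=
  fmap (hmap (postc A f)) a.

Definition prew A B C (g h : smap B C) (a : cell g h) (f : smap A B) :
    cell (scomp g f) (scomp h f) :=
  fmap (hmap (prec C f)) a.

Definition is_adjunction A B (f : smap B A) (u : smap A B)
    (eta : cell (sid B) (scomp u f)) (eps : cell (scomp f u) (sid A)) : Prop :=
  vcomp (prew eps f) (postw f eta) = idcell f /\
  vcomp (postw u eps) (prew eta u) = idcell u.

Definition left_adjoint A B (f : smap B A) (u : smap A B) : Prop :=
  exists eta eps, @is_adjunction A B f u eta eps.

Definition absolute_right_lifting A B C (f : smap B A) (g : smap C A)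
    (l : smap C B) (lam : cell (scomp f l) g) : Prop :=
  forall Y : sset, quasi_category Y ->
  forall (b : smap Y B) (y : smap Y C) (chi : cell (scomp f b) (scomp g y)),
  exists! zeta : cell b (scomp l y), chi = vcomp (prew lam y) (postw f zeta).

Definition absolute_left_lifting A B C (f : smap B A) (g : smap C A)
    (l : smap C B) (lam : cell g (scomp f l)) : Prop :=
  forall Y : sset, quasi_category Y ->
  forall (b : smap Y B) (y : smap Y C) (chi : cell (scomp g y) (scomp f b)),
  exists! zeta : cell (scomp l y) b, chi = vcomp (postw f zeta) (prew lam y).

Definition admits_limits_of A X K (k : smap K (ihom X A)) : Prop :=
  exists (l : smap K A) (lam : cell (scomp (const_diag X A) l) k),
    absolute_right_lifting lam.

Definition admits_colimits_of A X K (k : smap K (ihom X A)) : Prop :=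
  exists (l : smap K A) (lam : cell k (scomp (const_diag X A) l)),
    absolute_left_lifting lam.

Definition admits_all_limits (X A : sset) : Prop := admits_limits_of (sid (ihom X A)).
Definition admits_all_colimits (X A : sset) : Prop :=
  admits_colimits_of (sid (ihom X A)).

(* The subset (Delta^1 * {v}) \/ ({v} * Delta^1) of Delta^1 * Delta^1: the cospan
   (0,1) -> (1,1) <- (1,0) for v = 1, the span (0,1) <- (0,0) -> (1,0) for v = 0. *)
Definition in_wedge (v : 'I_2) m (s : sprod (simplex 1) (simplex 1) m) : Prop :=
  (forall i, s.2 i = v) \/ (forall i, s.1 i = v).

Lemma in_wedge_act v l m (a : dmap l m) s : in_wedge v s -> in_wedge v (act a s).
Proof. by case=> sv; [left|right] => i; apply: sv. Qed.

Definition wedge v : sset := subsset (@in_wedge_act v).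

Definition cospan_shape : sset := wedge ord_max.
Definition span_shape : sset := wedge ord0.

Definition admits_pullbacks A : Prop := admits_all_limits cospan_shape A.
Definition admits_pushouts A : Prop := admits_all_colimits span_shape A.

Program Definition leg1 v : smap (simplex 1) (wedge v) :=
  @SMap (simplex 1) (wedge v) (fun m s => exist _ (s, dconst m v) _) _.
Next Obligation. by move=> v m s; left. Qed.
Next Obligation. by move=> v m n a s _ <-; apply: eq_exist. Qed.

Program Definition leg2 v : smap (simplex 1) (wedge v) :=
  @SMap (simplex 1) (wedge v) (fun m s => exist _ (dconst m v, s) _) _.
Next Obligation. by move=> v m s; right. Qed.
Next Obligation. by move=> v m n a s _ <-; apply: eq_exist. Qed.

Definition has_legs v Y A (w : smap Y (ihom (wedge v) A))
    (r1 r2 : smap Y (ihom (simplex 1) A)) : Prop :=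
  scomp (prec A (leg1 v)) w = r1 /\ scomp (prec A (leg2 v)) w = r2.

(* A^(wedge v) is the pullback of two copies of evaluation at v; this yields the
   diagrams * -> a <- * and * <- a -> * below. *)
Lemma wedge_pullback v Y A (r1 r2 : smap Y (ihom (simplex 1) A)) :
  let ev := @eval_at (simplex 1) A (dconst 0 v) in
  scomp ev r1 = scomp ev r2 ->
  exists! w : smap Y (ihom (wedge v) A), has_legs w r1 r2.
Proof.
move=> ev ev12.
have agree n (y : Y n) m (s : dmap m n) :
    r1 n y m s (dconst m v) = r2 n y m s (dconst m v).
  have := f_equal (fun g : smap Y A => g m (act s y)) ev12.
  rewrite /= -(snat r1 (erefl (act s y))) -(snat r2 (erefl (act s y))) /=.
  by [].
pose wf n (y : Y n) m (s : dmap m n) (p : wedge v m) : A m :=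
  if pselect (forall i, (sval p).2 i = v) then r1 n y m s (sval p).1
  else r2 n y m s (sval p).2.
have wnat n (y : Y n) l m (a : dmap l m) (s : dmap m n) (p : wedge v m) q :
    act a p = q -> act a (wf n y m s p) = wf n y l (dcomp s a) q.
  move=> <-; rewrite /wf; case: p => -[p1 p2] pv /=.
  case: pselect => p2v; case: pselect => q2v.
  - exact: hnat.
  - by case: q2v => i; apply: p2v.
  - have p1v : forall i, p1 i = v by case: pv.
    rewrite (_ : dcomp p1 a = dconst l v); last by apply: dmapP => i; apply: p1v.
    rewrite agree; apply: hnat; by apply: dmapP => i; apply: q2v.
  - exact: hnat.
have wsnat m n (a : dmap m n) (y : Y n) (y' : Y m) : act a y = y' ->
    act a (HSimplex (wnat n y) : ihom (wedge v) A n) = HSimplex (wnat m y').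
  move=> <-; apply: hsimplexP => l s p /=; rewrite /wf.
  by rewrite -(snat r1 (erefl (act a y))) -(snat r2 (erefl (act a y))).
exists (@SMap Y (ihom (wedge v) A) _ wsnat); split.
  split; apply: smapP => n y; apply: hsimplexP => m s x; rewrite /= /wf /=;
    case: pselect => //= xv.
  by rewrite agree; congr (r2 n y m s _); apply: dmapP => i; rewrite xv.
move=> w [w1 w2]; subst r1 r2; apply: smapP => n y; apply: hsimplexP => m s p.
rewrite /= /wf; case: p => -[p1 p2] pv /=.
case: pselect => /= p2v; congr (w n y m s _); apply: eq_exist.
  by congr (_, _); apply: dmapP => i; rewrite p2v.
by congr (_, _); apply: dmapP => i; case: pv => /= pv; [case: p2v | rewrite pv].
Qed.

Definition terminal_object A (t : smap (simplex 0) A) : Prop :=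
  left_adjoint (bang A) t.
Definition initial_object A (t : smap (simplex 0) A) : Prop :=
  left_adjoint t (bang A).
Definition zero_object A (z : smap (simplex 0) A) : Prop :=
  terminal_object z /\ initial_object z.

Definition is_family_of_points A (z : smap (simplex 0) A)
    (rho : cell (scomp z (bang A)) (sid A)) : Prop :=
  exists eta, @is_adjunction A (simplex 0) z (bang A) eta rho.

Definition is_family_of_copoints A (z : smap (simplex 0) A)
    (xi : cell (sid A) (scomp z (bang A))) : Prop :=
  exists eps, @is_adjunction (simplex 0) A (bang A) z xi eps.

(* The edge of A^Y transpose to a functor from Y to the arrows of A. *)
Definition transpose_edge Y A (r : smap Y (ihom (simplex 1) A)) : ihom Y A 1 :=
  @HSimplex Y A 1 (fun m s y => r m y m (did m) s)
    (fun l m a s y y' e =>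
       etrans (hnat (r m y) (did m) (erefl (dcomp s a)))
         (f_equal (fun u : ihom (simplex 1) A l => u l (did l) (dcomp s a))
            (snat r e))).

Definition represents Y A (f g : smap Y A) (r : smap Y (ihom (simplex 1) A))
    (phi : cell f g) : Prop :=
  exists2 e : edge (vert f) (vert g),
    edge_val e = transpose_edge r & phi = pclass (path1 e).

Definition is_loop_functor A (z : smap (simplex 0) A) (Omega : smap A A) : Prop :=
  exists (rho : cell (scomp z (bang A)) (sid A))
         (r : smap A (ihom (simplex 1) A))
         (rbar : smap A (ihom cospan_shape A))
         (lam : cell (scomp (const_diag cospan_shape A) Omega) rbar),
    [/\ is_family_of_points rho, represents r rho, has_legs rbar r r
      & absolute_right_lifting lam].

Definition is_suspension_functor A (z : smap (simplex 0) A) (Sigma : smap A A) : Prop :=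
  exists (xi : cell (sid A) (scomp z (bang A)))
         (x : smap A (ihom (simplex 1) A))
         (xbar : smap A (ihom span_shape A))
         (lam : cell xbar (scomp (const_diag span_shape A) Sigma)),
    [/\ is_family_of_copoints xi, represents x xi, has_legs xbar x x
      & absolute_left_lifting lam].

(* Main.v *)
(** Write [*] for the zero object. By the universal properties of [Sigma] and
    [Omega], it suffices to give for functors [a, b : Y -> A] a bijection, natural
    in [a], [b] and [Y], between the 2-cells from the span [* <- a -> *] to the
    constant span [b] and those from the constant cospan [a] to the cospan
    [* -> b <- *]. A 2-cell of the first kind is a pair of squares with a common
    edge [f : a -> b]. The diagonal [d] cuts each of them into a triangle
    [a -> * -> b] and a triangle with edges [f], [1], [d]; a cell of the second kind
    is cut likewise, with a triangle [1], [f], [d] instead. A 3-simplex with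
    vertices [a, a, b, b] exchanges these two triangles, and each is obtained from
    the other by filling an inner horn. The filling involves choices and only
    gives a cospan [* -> b <- *] with some legs; the correspondence is
    nevertheless well defined and natural, because restriction
    [(A^Y)^(Delta^1) -> A^Y * A^Y] is an inner fibration, so that commutative
    squares of cells can be exchanged relatively to their sides, and because a cell
    out of [* -> b <- *] is determined by its value at [b], as [*] is initial;
    dually for spans, as [*] is terminal. *)

From mathcomp Require Import all_boot zify.
From mathcomp Require Import boolp classical_sets.
Require Import Defs.

Set Implicit Arguments.
Unset Strict Implicit.
Unset Printing Implicit Defensive.

(** * Extension of maps along inner horns times a simplicial set *)

(** Everything rests on filling inner horns; no theory of equivalences is available, and the shape
    of the proof comes from avoiding it. A cell between diagrams is not determined by its values at
    the vertices, so uniqueness of cells out of a pointed cospan would naturally require that a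
    pointwise invertible cell be invertible. Here only the identity at the vertices occurs, and a
    one-sided inverse is enough, since an idempotent with a one-sided inverse is an identity. All
    fillers come from one extension theorem: restriction along a simplicial subset [K] of [X] is an
    inner fibration from [ihom X A]. With [K] empty it says that exponentials have inner fillers.
    With [K] the set of vertices it gives fillers with prescribed values at the vertices, hence both
    the inner fibration onto pairs of ends and the rectification of pointwise homotopies. Exchange
    acts on representing edges, not on classes. The parameter [Y] is removed beforehand by the
    symmetry of exponentials, which turns families of diagrams in [A] into diagrams in
    [ihom Y A]. *)

Lemma ltn_dmap m n (a : dmap m n) (i j : 'I_m.+1) : a i < a j -> i < j.
Proof. by rewrite !ltnNge; apply: contra => /(dmono a). Qed.

Lemma dmap_skip m n (a : dmap m n.+1) (i : 'I_n.+2) :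
  (forall x, a x <> i) -> exists b : dmap m n, a = dcomp (dface i) b.
Proof.
move=> ai; have bP x : unbump i (a x) < n.+1.
  by have := ltn_ord (a x); have := ltn_ord i; have : a x != i :> nat;
    [apply/eqP => /val_inj/ai | rewrite /unbump; lia].
have bM (x y : 'I_m.+1) : x <= y -> Ordinal (bP x) <= Ordinal (bP y).
  by move=> /(dmono a) /=; rewrite /unbump; lia.
exists (DMap bM); apply: dmapP => x; apply: val_inj => /=.
by rewrite unbumpKcond; have /eqP := ai x; rewrite -val_eqE /= => /negbTE ->.
Qed.

Lemma dface_neq n (i : 'I_n.+2) x : @dface n i x <> i.
Proof. by move/(f_equal val)/eqP; rewrite /= eq_sym (negbTE (neq_bump _ _)). Qed.

(** The section passes through a prescribed point: operators are compared below at one vertex [x0]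
    at a time, and the condition at [a x0] turns knowledge of a composite with [d] into the value at
    [x0]. *)
Lemma dmap_section l p (a : dmap l p) : (forall v, exists x, a x = v) ->
  forall x0, exists d : dmap p l, (forall v, a (d v) = v) /\ d (a x0) = x0.
Proof.
move=> /choice [g ag] x0; pose h v := if v == a x0 then x0 else g v.
have ah v : a (h v) = v by rewrite /h; case: eqP => [->|].
have hM (u v : 'I_p.+1) : u <= v -> h u <= h v.
  move=> uv; rewrite leqNgt; apply/negP => hvu.
  have := dmono a (ltnW hvu); rewrite !ah => vu.
  have /val_inj uv' : u = v :> nat by apply/anti_leq; rewrite uv.
  by subst u; rewrite ltnn in hvu.
exists (DMap hM); split=> //=; by rewrite /h eqxx.
Qed.

(** A section [d] of [a] is strictly increasing, so [v <= d v] by induction from the bottom and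
    [d v <= v] by induction from the top. *)
Lemma dmap_endo_surj p (a : dmap p p) : (forall v, exists x, a x = v) ->
  forall i, a i = i.
Proof.
move=> a_surj; have [d [ad _]] := dmap_section a_surj ord0.
have d_lt (u v : 'I_p.+1) : u < v -> d u < d v.
  by move=> uv; apply: (@ltn_dmap _ _ a); rewrite !ad.
have d_ge m (v : 'I_p.+1) : v = m :> nat -> v <= d v.
  elim: m v => [|m IH] v vE; first by rewrite vE.
  have lt_m : m < p.+1 by have := ltn_ord v; lia.
  have := IH (Ordinal lt_m) erefl; have := @d_lt (Ordinal lt_m) v.
  by rewrite /= vE; lia.
have d_le m (v : 'I_p.+1) : v + m = p :> nat -> d v <= v.
  elim: m v => [|m IH] v vE; first by have := ltn_ord (d v); lia.
  have lt_v : v.+1 < p.+1 by lia.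
  have := IH (Ordinal lt_v); have := @d_lt v (Ordinal lt_v).
  by rewrite /=; lia.
have dE v : d v = v.
  apply/val_inj/anti_leq/andP; split; last exact: d_ge.
  by apply: (@d_le (p - v)); have := ltn_ord v; lia.
by move=> i; rewrite -{1}[i]dE ad.
Qed.

Lemma dmap_not_surj p (a : dmap p p.+1) : ~ (forall v, exists x, a x = v).
Proof.
move=> /choice [g ag]; have g_inj : injective g by apply: (can_inj ag).
by have := leq_card g g_inj; rewrite !card_ord ltnn.
Qed.

(* Compatibility is asked for all operators that factor through two faces, rather
   than through the simplicial identities, so that [n = 0] is not special. *)
Definition compat (R : sset) n (k : 'I_n.+2) (y : 'I_n.+2 -> R n) : Prop :=
  forall i j, i <> k -> j <> k -> forall m (a b : dmap m n),
  dcomp (dface i) a = dcomp (dface j) b -> act a (y i) = act b (y j).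

Definition inner_fibration (R B : sset) (p : smap R B) : Prop :=
  forall n (k : 'I_n.+2), 0 < k < n.+1 ->
  forall (y : 'I_n.+2 -> R n) (z : B n.+1), compat k y ->
  (forall i, i <> k -> p n (y i) = d_ i z) ->
  exists2 u : R n.+1, forall i, i <> k -> d_ i u = y i & p n.+1 u = z.

Definition has_inner_fillers (R : sset) : Prop :=
  forall n (k : 'I_n.+2), 0 < k < n.+1 ->
  forall y : 'I_n.+2 -> R n, compat k y ->
  exists u : R n.+1, forall i, i <> k -> d_ i u = y i.

(** Each simplex of the horn factors through a face opposite to some vertex other than [k].
    Compatibility makes the value independent of that face, so the faces assemble into a map on the
    horn. *)
Lemma quasi_category_fillers (A : sset) :
  quasi_category A -> has_inner_fillers A.
Proof.
move=> qA n k k_in y y_compat.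
have hP m (s : horn k m) : exists x : A m, forall i, i <> k ->
    forall b : dmap m n, sval s = dcomp (dface i) b -> x = act b (y i).
  case: s => s [i ik si]; have [b sE] := dmap_skip si.
  exists (act b (y i)) => j jk b' sE'; apply: y_compat => //.
  by rewrite -sE'.
pose h m (s : horn k m) := sval (cid (hP m s)).
have hE m (s : horn k m) i : i <> k -> forall b : dmap m n,
    sval s = dcomp (dface i) b -> h m s = act b (y i).
  exact: (svalP (cid (hP m s))).
have h_nat l m (a : dmap l m) (s : horn k m) t : act a s = t ->
    act a (h m s) = h l t.
  move=> <-; case: s => s [i ik si]; have [b sE] := dmap_skip si.
  rewrite (hE _ _ i ik b) // -actM (hE _ _ i ik (dcomp b a)) //=.
  by rewrite sE.
have [s sh] := qA n.+1 k k_in (SMap h_nat).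
have h_face i (ik : i <> k) : in_horn k (dface i : simplex n.+1 n).
  by exists i => // x; apply: dface_neq.
exists (s n.+1 (did n.+1)) => i ik.
rewrite /d_ (snat s (erefl (act (dface i) (did n.+1 : simplex n.+1 n.+1)))).
have := f_equal (fun g : smap (horn k) A => g n (exist _ _ (h_face i ik))) sh.
move=> /= sE; rewrite -[RHS](act1) -(hE n (exist _ _ (h_face i ik)) i ik) //.
Qed.

Local Open Scope classical_set_scope.

(* Partial maps are relations, so that the union of a chain of them, needed for
   Zorn's lemma, is a mere union of sets. *)
Definition pgraph (V A : sset) := set {m & (V m * A m)%type}.

Definition pg (V A : sset) (G : pgraph V A) m (v : V m) (a : A m) : Prop :=
  G (existT (fun m => (V m * A m)%type) m (v, a)).

Definition pdom (V A : sset) (G : pgraph V A) m (v : V m) : Prop := exists a, pg G v a.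

Definition partial_map (V A : sset) (G : pgraph V A) : Prop :=
  (forall m (v : V m) a b, pg G v a -> pg G v b -> a = b) /\
  (forall l m (t : dmap l m) v a, pg G v a -> pg G (act t v) (act t a)).

(** [T] tells which simplices have to enter the domain along with others: every stage is closed
    under [T], an invariant that [step] may use and must restore. *)
Lemma extend_partial_map (V A : sset) (T : forall m l, V m -> V l -> Prop)
    (G0 : pgraph V A) :
  let good G := partial_map G /\
    forall m l (v : V m) (w : V l), T m l v w -> pdom G v -> pdom G w in
  good G0 ->
  (forall G, good G -> G0 `<=` G -> (exists m (v : V m), ~ pdom G v) ->
    exists2 G' : pgraph V A, good G' & G `<` G') ->
  exists F : smap V A, forall m (v : V m) a, pg G0 v a -> F m v = a.
Proof.
move=> good good0 step.
(* The property is imposed on the union of [G0] and [G], so that the empty chain, whose union is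
   empty, satisfies it. *)
have [G [goodG maxG]] : exists G, good (G0 `|` G) /\ forall H, G `<` H -> ~ good (G0 `|` H).
  apply: (@Zorn_bigcup _ (fun G => good (G0 `|` G))) => F goodF totF.
  have inF m (v : V m) a : pg (G0 `|` \bigcup_(X in F) X) v a ->
      pg G0 v a \/ exists2 X, F X & pg X v a.
    by case=> [|[X FX Xva]]; [left | right; exists X].
  have [FX|F0] := pselect (exists X, F X); last first.
    rewrite (_ : \bigcup_(X in F) X = set0) ?setU0 //.
    by rewrite -subset0 => x [X FX]; case: F0; exists X.
  have inF1 m (v : V m) a : pg (G0 `|` \bigcup_(X in F) X) v a ->
      exists2 X, F X & pg (G0 `|` X) v a.
    move=> /inF [|[X FX' Xva]]; last by exists X => //; right.
    by case: FX => X FX; exists X => //; left.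
  have outF m (v : V m) a X : F X -> pg (G0 `|` X) v a ->
      pg (G0 `|` \bigcup_(X in F) X) v a.
    by move=> FX' [|Xva]; [left | right; exists X].
  split; first split.
  - move=> m v a b /inF1 [X FX' Xva] /inF1 [Y FY Yvb].
    have [XY|YX] := totF X Y FX' FY.
      have [[fY _] _] := goodF _ FY; apply: fY Yvb; case: Xva => [|/XY]; [by left|by right].
    have [[fX _] _] := goodF _ FX'; apply: (fX _ v _ _ Xva).
    case: Yvb => [|/YX]; [by left|by right].
  - move=> l m t v a /inF1 [X FX' Xva]; apply: (outF _ _ _ _ FX').
    by have [[_ cX] _] := goodF _ FX'; apply: cX.
  - move=> m l v w Tvw [a /inF1 [X FX' Xva]].
    have [_ /(_ _ _ _ _ Tvw) TX] := goodF _ FX'.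
    by have [|b Xwb] := TX; [exists a | exists b; apply: outF Xwb].
have totG m (v : V m) : pdom (G0 `|` G) v.
  apply: contrapT => nv; have [||G' goodG' [sub nsub]] := step _ goodG.
  - by move=> x; left.
  - by exists m, v.
  have G'E : G0 `|` G' = G'.
    by apply/seteqP; split=> [x [G0x|//]|x]; [apply: sub; left | right].
  apply: (maxG G'); last by rewrite G'E.
  split=> [x Gx|sub']; first by apply: sub; right.
  by apply: nsub => x /sub'; right.
have [[fG cG] _] := goodG.
pose F m (v : V m) : A m := sval (cid (totG m v)).
have FE m (v : V m) : pg (G0 `|` G) v (F m v) by exact: (svalP (cid (totG m v))).
have F_nat m n (a : dmap m n) (x : V n) y : act a x = y -> act a (F n x) = F m y.
  by move=> <-; apply: fG (FE _ _); apply: cG.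
by exists (SMap F_nat) => m v a G0va; apply: fG (FE _ _) _; left.
Qed.

(** The new value at [act a C] is [act a f], for [f] a filler of the horn. It is well defined for
    two reasons: outside the old domain [act a C] determines [a], an argument in the style of
    Eilenberg and Zilber; inside it, [a] misses a vertex other than [j], and a face of the horn
    already gives the value. *)
Lemma attach_simplex (V A : sset) (G : pgraph V A) p (j : 'I_p.+2) (C : V p.+1) :
  has_inner_fillers A -> 0 < j < p.+1 -> partial_map G ->
  (forall i, i <> j -> pdom G (d_ i C)) -> ~ pdom G (d_ j C) ->
  exists2 G' : pgraph V A, partial_map G' /\ G `<` G' &
    forall m (v : V m), pdom G' v <-> pdom G v \/ exists a : dmap m p.+1, v = act a C.
Proof.
move=> A_fill j_in [fG cG] faceC njC.
have dom_act l m (t : dmap l m) v : pdom G v -> pdom G (act t v).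
  by move=> [a Gva]; exists (act t a); apply: cG.
have hits m (a : dmap m p.+1) : ~ pdom G (act a C) ->
    forall i, i <> j -> exists x, a x = i.
  move=> naC i ij; apply: contrapT => ai; apply: naC.
  have [x E|b ->] := @dmap_skip _ _ a i; first by apply: ai; exists x.
  by rewrite actM; apply/dom_act/faceC.
have nC : ~ pdom G C by move=> /(dom_act _ _ (dface j)).
have hits_all p' (a : dmap p' p.+1) (i : 'I_p.+2) : (exists x, a x = j) ->
    (forall i, i <> j -> exists x, a x = i) -> forall i, exists x, a x = i.
  by move=> aj ai k; have [->|/ai] := pselect (k = j).
(* A degeneracy of the missing face would give back [C] as one of its faces. *)
have nCdeg (e : dmap p.+1 p) : (forall v, exists x, e x = v) ->
    C <> act e (d_ j C).
  move=> e_surj eC; have [d [ed dej]] := dmap_section e_surj j.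
  have Cd : act d C = d_ j C.
    rewrite {1}eC -actM -[RHS]act1; congr (act _ _); exact: dmapP.
  apply: (@dmap_not_surj _ d); apply: hits_all => //; first by exists (e j).
  by apply: hits; rewrite Cd.
have surj_face p' (e : dmap p' p) : (forall i, i <> j -> exists x, dcomp (dface j) e x = i) ->
    forall v, exists x, e x = v.
  move=> he v; have [x /lift_inj ex] := he (lift j v) (@dface_neq _ j v).
  by exists x.
(* Let [d] be a section through [x0]. If [a] hits [j], then [dcomp b d] fixes [C] and is the
   identity, as [C] is not a degeneracy of its face at [j]. Otherwise [dcomp b d] takes [C] to that
   face and is [dface j]. Either way its value is read at [x0]. *)
have inj m (a b : dmap m p.+1) : act a C = act b C -> ~ pdom G (act a C) -> a = b.
  move=> ab naC; have nbC : ~ pdom G (act b C) by rewrite -ab.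
  apply: dmapP => x0; have [aj|aj] := pselect (exists x, a x = j).
    have a_surj := hits_all _ _ ord0 aj (hits _ _ naC).
    have [d [ad dax]] := dmap_section a_surj x0.
    have Cbd : act (dcomp b d) C = C.
      by rewrite actM -ab -actM -[RHS]act1; congr (act _ _); apply: dmapP.
    have bd_hits : forall i, i <> j -> exists x, dcomp b d x = i.
      by apply: hits; rewrite Cbd.
    have [bj|bj] := pselect (exists x, dcomp b d x = j).
      have := dmap_endo_surj (hits_all _ _ ord0 bj bd_hits) (a x0).
      by rewrite /= dax.
    have [x E|e bdE] := @dmap_skip _ _ (dcomp b d) j; first by apply: bj; exists x.
    case: (@nCdeg e); last by rewrite -actM -bdE Cbd.
    by apply: surj_face; rewrite -bdE.
  have [x E|a' aE] := @dmap_skip _ _ a j; first by apply: aj; exists x.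
  have a'_surj : forall v, exists x, a' x = v by apply: surj_face; rewrite -aE; apply: hits.
  have [d [ad dax]] := dmap_section a'_surj x0.
  have Cbd : act (dcomp b d) C = d_ j C.
    rewrite actM -ab -actM aE; congr (act _ _).
    by apply: dmapP => x /=; rewrite ad.
  have bd_hits : forall i, i <> j -> exists x, dcomp b d x = i.
    by apply: hits; rewrite Cbd.
  have [bj|bj] := pselect (exists x, dcomp b d x = j).
    by case: (@dmap_not_surj _ (dcomp b d)); apply: hits_all.
  have [x E|e bdE] := @dmap_skip _ _ (dcomp b d) j; first by apply: bj; exists x.
  have e_id : forall i, e i = i.
    by apply/dmap_endo_surj/surj_face; rewrite -bdE.
  have := f_equal (fun t : dmap p p.+1 => t (a' x0)) bdE.
  by rewrite /= dax e_id aE /= => ->.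
have /choice [y yP] : forall i, exists y, i <> j -> pg G (d_ i C) y.
  move=> i; have [->|/faceC [y Gy]] := pselect (i = j); last by exists y.
  (* The entry of [y] at [j] is arbitrary, but some simplex of [A] has to stand there; another face
     of [C] supplies it. *)
  (have : pdom G (d_ (inord (j == 0 :> nat)) C) by
    apply: faceC => /(f_equal val) /=; rewrite inordK //; lia).
  by move=> [y _]; exists y.
have y_compat : compat j y.
  move=> i i' ij i'j m a b ab; apply: fG (cG _ _ b _ _ (yP _ i'j)).
  by rewrite /d_ -actM -ab actM; apply/cG/yP.
have [f fE] := A_fill p j j_in y y_compat.
(* If [a] hit every vertex other than [j], a section would bring [d_ j C] into the domain. *)
have f_horn m (a : dmap m p.+1) : pdom G (act a C) -> pg G (act a C) (act a f).
  move=> aC; have [i ij ai] : exists2 i, i <> j & forall x, a x <> i.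
    apply: contrapT => na; apply: njC.
    have a_hits i : i <> j -> exists x, a x = i.
      move=> ij; apply: contrapT => nai; apply: na; exists i => // x E.
      by apply: nai; exists x.
    have [aj|aj] := pselect (exists x, a x = j).
      have [d [ad _]] := dmap_section (hits_all _ _ ord0 aj a_hits) ord0.
      rewrite (_ : d_ j C = act (dcomp d (dface j)) (act a C)); first exact: dom_act.
      by rewrite -actM; congr (act _ _); apply: dmapP => x /=; rewrite ad.
    have [x E|a' aE] := @dmap_skip _ _ a j; first by apply: aj; exists x.
    have [|d [ad _]] := @dmap_section _ _ a' _ ord0; first by apply: surj_face; rewrite -aE.
    rewrite (_ : d_ j C = act d (act a C)); first exact: dom_act.
    by rewrite -actM aE; congr (act _ _); apply: dmapP => x /=; rewrite ad.
  have [a' aE] := dmap_skip ai.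
  by rewrite aE !actM -!/(d_ _ _) (fE _ ij); apply/cG/yP.
pose G' : pgraph V A := G `|` [set u | exists a : dmap (tag u) p.+1,
   tagged u = (act a C, act a f)].
have G'P m (v : V m) x : pg G' v x <->
    pg G v x \/ exists2 a : dmap m p.+1, v = act a C & x = act a f.
  split=> [[Gvx|[a [-> ->]]]|[Gvx|[a -> ->]]].
  - by left.
  - by right; exists a.
  - by left.
  - by right; exists a.
exists G'; first split; first split.
- move=> m v x x' /G'P [Gvx|[a -> ->]] /G'P [Gvx'|[a' va' ->]].
  + exact: fG Gvx Gvx'.
  + by subst v; apply: fG Gvx (f_horn _ _ (ex_intro _ x Gvx)).
  + by apply: fG (f_horn _ _ (ex_intro _ x' Gvx')) Gvx'.
  + have [aC|aC] := pselect (pdom G (act a C)); last by rewrite (inj _ _ _ va' aC).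
    by apply: fG (f_horn _ _ aC) _; move: aC; rewrite va'; apply: f_horn.
- move=> l m t v x /G'P [Gvx|[a -> ->]]; apply/G'P; first by left; apply: cG.
  by right; exists (dcomp a t); rewrite actM.
- split=> [u|sub]; first by left.
  apply: njC; exists (d_ j f); apply: sub; right; by exists (dface j).
move=> m v; split=> [[x /G'P [Gvx|[a -> _]]]|[[x Gvx]|[a ->]]].
- by left; exists x.
- by right; exists a.
- by exists x; left.
- by exists (act a f); apply/G'P; right; exists a.
Qed.

Local Close Scope classical_set_scope.

(** * Insertion of a vertex, and the extension theorem *)

Lemma unbump_ord n (j : 'I_n.+1) (i : 'I_n.+2) : unbump j i < n.+1.
Proof. by have := ltn_ord i; have := ltn_ord j; rewrite /unbump; lia. Qed.

Definition sdeg n (j : 'I_n.+1) : dmap n.+1 n.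
Proof.
refine (@DMap n.+1 n (fun i => Ordinal (unbump_ord j i)) _).
by move=> i i' /=; rewrite /unbump; lia.
Defined.

Lemma sdegE n (j : 'I_n.+1) i : sdeg j i = unbump j i :> nat.
Proof. by []. Qed.

Lemma dfaceE n (j : 'I_n.+2) i : dface j i = bump j i :> nat.
Proof. by []. Qed.

(* [inserts k v w] : the simplex [w] arises from [v = (s, x)] by repeating the
   first vertex [j] with [s j > k] and sending the new copy to [k]. *)
Definition inserts (X : sset) N (k : 'I_N.+1) m l (v : sprod (simplex N) X m)
    (w : sprod (simplex N) X l) : Prop :=
  l = m.+1 /\ exists j : 'I_m.+1, exists t : dmap l m,
  [/\ k < v.1 j /\ (forall i : 'I_m.+1, i < j -> v.1 i <= k),
      forall i, t i = unbump j i :> nat, w.2 = act t v.2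
    & forall i : 'I_l.+1, w.1 i = if i == j :> nat then k else v.1 (t i)].

Lemma dmap_first m N (k : 'I_N.+1) (s : dmap m N) : (exists i, k < s i) ->
  exists j : 'I_m.+1, k < s j /\ (forall i : 'I_m.+1, i < j -> s i <= k).
Proof.
move=> [i0 ki0]; case: (@arg_minnP _ i0 (fun i => k < s i) (fun i => val i) ki0) => j kj jmin.
exists j; split=> // i ij; rewrite leqNgt; apply/negP => /jmin.
by rewrite leqNgt ij.
Qed.

Lemma inserts_ex X N (k : 'I_N.+1) m (v : sprod (simplex N) X m) (j : 'I_m.+1) :
  k < v.1 j -> (forall i : 'I_m.+1, i < j -> v.1 i <= k) ->
  exists2 w : sprod (simplex N) X m.+1, inserts k v w &
   w.2 = act (sdeg j) v.2 /\ forall i : 'I_m.+2, w.1 i = if i == j :> nat then k else v.1 (sdeg j i).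
Proof.
move=> kj jmin.
have insM (i i' : 'I_m.+2) : i <= i' ->
    (if i == j :> nat then k else v.1 (sdeg j i)) <=
    (if i' == j :> nat then k else v.1 (sdeg j i')).
  move=> ii'; case: eqP => ij; case: eqP => i'j //.
  - apply: leq_trans (ltnW kj) (dmono v.1 _) => /=.
    by rewrite /unbump; lia.
  - by apply: jmin; rewrite sdegE /unbump; lia.
  - by apply: dmono; rewrite !sdegE /unbump; lia.
exists (DMap insM, act (sdeg j) v.2) => //.
by split=> //; exists j, (sdeg j); split.
Qed.

(** A vertex other than the two copies can be deleted from [v] before the insertion; the place of
    insertion drops by one when the deleted vertex precedes [j]. *)
Lemma inserts_face X N (k : 'I_N.+1) m (v : sprod (simplex N) X m) (j : 'I_m.+1)
    (w : sprod (simplex N) X m.+1) (i : 'I_m.+2) :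
  k < v.1 j -> (forall i : 'I_m.+1, i < j -> v.1 i <= k) ->
  w.2 = act (sdeg j) v.2 ->
  (forall i : 'I_m.+2, w.1 i = if i == j :> nat then k else v.1 (sdeg j i)) ->
  i != j :> nat -> i != j.+1 :> nat ->
  exists l (u : sprod (simplex N) X l), l < m /\ inserts k u (d_ i w).
Proof.
case: m v j w i => [|m] v j w i kj jmin w2 w1 ij ij1.
  by move: ij ij1; have := ltn_ord i; have := ltn_ord j; lia.
exists m, (d_ (sdeg j i) v); split=> //; split=> //.
have lt_j' : (if i < j then j.-1 else j) < m.+1.
  by move: ij ij1; case: (ltnP i j) => ? ? ?; have := ltn_ord i; have := ltn_ord j; lia.
exists (Ordinal lt_j'), (sdeg (Ordinal lt_j')); split=> //=.
- split=> [|x xj]; [apply: leq_trans kj (dmono v.1 _) | apply: jmin]; move: ij ij1.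
    by rewrite /= /bump /unbump; case: (ltnP i j); lia.
  by move: xj; rewrite /= /bump /unbump; case: (ltnP i j); lia.
- rewrite /d_ /= w2 -!actM; congr (act _ _); apply: dmapP => x; apply: val_inj.
  by move: ij ij1; rewrite /= /bump /unbump; case: (ltnP i j); lia.
- move=> x; rewrite w1 /=.
  have -> : (bump i x == j) = (x == (if i < j then j.-1 else j) :> nat).
    by move: ij ij1; rewrite /bump; case: (ltnP i j); lia.
  case: ifP => // xj; congr (v.1 _); apply: val_inj.
  by move: ij ij1 xj; rewrite /= /bump /unbump; case: (ltnP i j); lia.
Qed.

(* The simplices of [Delta^n.+1 * X] are attached in pairs: [v] together with the
   simplex [w] it gives by insertion, along the inner horn of [w] that misses [v].
   Pairs are ordered by the dimension of [v], then by the number of vertices of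
   [v] lying above [k]: the face of [w] opposite to [j.+1] is [v] with the vertex
   [j] lowered to [k], and the other faces are insertions of faces of [v]. *)
Theorem inner_fibration_restrict (A X : sset) (K : forall n, X n -> Prop)
    (cK : forall m n (a : dmap m n) x, K n x -> K m (act a x)) :
  has_inner_fillers A -> inner_fibration (prec A (sincl cK)).
Proof.
move=> A_fill n k k_in y z y_compat yz.
pose V := sprod (simplex n.+1) X.
(* The given values: [y] where the first component lies in the horn, [z] where the second component
   lies in [K]. *)
pose G0 : pgraph V A := [set u | let s := (tagged u).1.1 in let x := (tagged u).1.2 in
  let a := (tagged u).2 in
  (exists2 i, i <> k & exists2 b, s = dcomp (dface i) b & a = y i _ b x) \/
  (exists Kx, a = z _ s (exist _ x Kx))]%classic.
have fG0 m (v : V m) a b : pg G0 v a -> pg G0 v b -> a = b.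
  case: v => s x [[i ik [c /= -> ->]]|[Kx /= ->]] [[i' i'k [c' /= E ->]]|[Kx' /= ->]].
  - have := f_equal (fun u : ihom X A m => u m (did m) x) (y_compat _ _ ik i'k _ _ _ E).
    by [].
  - have := f_equal (fun u : ihom (subsset cK) A n => u m c (exist _ x Kx')) (yz i ik).
    by [].
  - have := f_equal (fun u : ihom (subsset cK) A n => u m c' (exist _ x Kx)) (yz i' i'k).
    by rewrite E.
  - by congr (z m s _); apply: eq_exist.
have pG0 : partial_map G0.
  split=> [|l m t [s x] a]; first exact: fG0.
  case=> [[i ik [c /= -> ->]]|[Kx /= ->]].
    left; exists i => //; exists (dcomp c t) => //=.
    exact: (hnat (y i)).
  right; exists (cK _ _ t _ Kx) => /=; apply: (hnat z); exact: eq_exist.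
have G0_miss m (v : V m) i : i <> k -> (forall x, v.1 x <> i) -> pdom G0 v.
  move=> ik vi; have [b vE] := dmap_skip vi.
  by exists (y i m b v.2); left; exists i => //; exists b.
have [|G [pG insG] subG|F FG0] :=
    @extend_partial_map V A (fun m l v w => inserts k v w) G0.
- split=> // m l v w [_ [j [t [_ _ w2 w1]]]] [a].
  case=> [[i ik [c /= v1E _]]|[Kx _]].
    apply: (@G0_miss _ _ i ik) => x; rewrite w1; case: ifP => _; first by move=> E; apply: ik.
    by rewrite v1E; apply: dface_neq.
  have Kw : K _ w.2 by rewrite w2; exact: (cK _ _ t _ Kx).
  by exists (z _ w.1 (exist _ w.2 Kw)); right; exists Kw.
- move=> [m0 [v0 nv0]].
  have G_miss m (v : V m) i : i <> k -> (forall x, v.1 x <> i) -> pdom G v.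
    by move=> ik vi; have [a] := G0_miss _ _ _ ik vi; exists a; apply: subG.
  (* A missing simplex [v] is taken of least dimension and, among these, with the fewest vertices
     above [k]. *)
  have exm : exists m, `[< exists v : V m, ~ pdom G v >].
    by exists m0; apply/asboolP; exists v0.
  case: (ex_minnP exm) => m /asboolP [v1 nv1] m_min.
  pose cnt (v : V m) := #|[pred i | k < v.1 i]|.
  have exc : exists c, `[< exists2 v : V m, ~ pdom G v & cnt v = c >].
    by exists (cnt v1); apply/asboolP; exists v1.
  case: (ex_minnP exc) => c /asboolP [v nv vc] c_min {m0 v0 nv0 v1 nv1 exm exc}.
  have dom_small l (w : V l) : l < m -> pdom G w.
    move=> lm; apply: contrapT => nw; have := m_min l; rewrite leqNgt lm => H.
    by have := H (asboolT (ex_intro _ w nw)).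
  have dom_low (w : V m) : cnt w < cnt v -> pdom G w.
    rewrite vc => wc; apply: contrapT => nw; have := c_min (cnt w); rewrite leqNgt wc => H.
    by have := H (asboolT (ex_intro2 _ _ w nw erefl)).
  have v_hits i : i <> k -> exists x, v.1 x = i.
    by move=> ik; apply: contrapT => nx; apply: nv; apply: (@G_miss _ _ i) => // x E;
      apply: nx; exists x.
  have [x0 x0E] : exists x, v.1 x = ord0.
    by apply: v_hits => kE; move: k_in; rewrite -kE.
  have [xn xnE] : exists x, v.1 x = ord_max.
    by apply: v_hits => kE; move: k_in; rewrite -kE /= ltnn.
  have [|j [kj jmin]] := @dmap_first _ _ k v.1.
    by exists xn; rewrite xnE /=; lia.
  have [C vC [C2 C1]] := inserts_ex kj jmin.
  have j_gt0 : 0 < j.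
    have : x0 < j by apply: (@ltn_dmap _ _ v.1); rewrite x0E; apply: leq_ltn_trans kj.
    by lia.
  pose jC : 'I_m.+2 := widen_ord (leqnSn _) j.
  have jC_in : 0 < jC < m.+1 by rewrite /= j_gt0 ltn_ord.
  have dC (i : 'I_m.+2) : d_ i C = (dcomp C.1 (dface i), act (dcomp (sdeg j) (dface i)) v.2).
    by rewrite /d_ /= C2 actM.
  have dCj : d_ jC C = v.
    rewrite dC [RHS]surjective_pairing; congr (_, _).
      apply: dmapP => i; rewrite /= C1 /= eq_sym (negbTE (neq_bump _ _)).
      by congr (v.1 _); apply: val_inj => /=; rewrite bumpK.
    rewrite -[RHS]act1; congr (act _ _); apply: dmapP => i; apply: val_inj => /=.
    by rewrite bumpK.
  have faceC i : i <> jC -> pdom G (d_ i C).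
    move=> ij; have nij : i <> j :> nat by move=> E; apply: ij; apply: val_inj.
    have [iE|nij1] := eqVneq (i : nat) j.+1.
      have dC1 x : (d_ i C).1 x = if bump j.+1 x == j then k else v.1 (sdeg j (dface i x)).
        by rewrite -iE -(dfaceE i) -C1.
      apply: dom_low; apply: proper_card; apply/properP; split.
        apply/fintype.subsetP => x; rewrite !inE dC1.
        case: eqP => [|xj]; first by rewrite ltnn.
        move=> kx; apply: leq_trans kx (dmono v.1 _).
        by rewrite sdegE dfaceE iE /bump /unbump; lia.
      exists j; rewrite !inE // dC1.
      by rewrite (_ : bump j.+1 j == j) ?ltnn //; rewrite /bump; lia.
    have [|l [u [lm uC]]] := inserts_face kj jmin C2 C1 _ nij1; first exact/eqP.
    by apply: insG uC _; apply: dom_small.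
  have njC : ~ pdom G (d_ jC C) by rewrite dCj.
  have [G' [pG' GG'] G'P] := attach_simplex A_fill jC_in pG faceC njC.
  exists G' => //; split=> // l l' u w uw /G'P [/insG-/(_ _ _ uw) Gw|[a ua]].
    by apply/G'P; left.
  have [Gu|nGu] := pselect (pdom G u).
    by apply/G'P; left; apply: insG uw Gu.
  apply/G'P; right.
  (* Closure under insertion is restored. A new simplex [act a C] must hit the vertex [j.+1] of [C],
     since otherwise it comes from a face already present. Hence its first vertex above [k] goes to
     [j.+1]; sending the inserted vertex to [j] gives an operator into [C] again. *)
  have CjC : C.1 jC = k by rewrite C1 eqxx.
  have kC x : (k < C.1 x) = (j < x).
    rewrite C1; case: eqP => [->|xj]; first by rewrite !ltnn.
    have [jx|jx] := ltnP j x.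
      by apply: leq_trans kj (dmono v.1 _); rewrite sdegE /unbump; lia.
    by apply/negbTE; rewrite -leqNgt; apply: jmin; rewrite sdegE /unbump; lia.
  case: uw => _ [j' [t [[kj' j'min] tE w2 w1]]]; subst u.
  have aj'_gt : j < a j' by rewrite -kC.
  have a_le (i : 'I_l.+1) : i < j' -> a i <= j.
    by move=> /j'min; rewrite leqNgt kC -leqNgt.
  have lt_j1 : j.+1 < m.+2 by have := ltn_ord j; lia.
  have [x ax] : exists x, a x = Ordinal lt_j1.
    apply: contrapT => nx; have [x E|b aE] := @dmap_skip _ _ a (Ordinal lt_j1).
      by apply: nx; exists x.
    apply: nGu; rewrite aE actM; have [|y' Gy'] := @faceC (Ordinal lt_j1).
      by move/(f_equal val) => /=; lia.
    by exists (act b y'); apply: pG.2.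
  have aj' : a j' = j.+1 :> nat.
    apply/eqP; rewrite eqn_leq aj'_gt andbT -[j.+1]/(val (Ordinal lt_j1)) -ax.
    apply: dmono; rewrite leqNgt; apply/negP => /a_le.
    by rewrite ax /= ltnn.
  have insM (i i' : 'I_l'.+1) : i <= i' ->
      (if i == j' :> nat then jC else a (t i)) <= (if i' == j' :> nat then jC else a (t i')).
    move=> ii'; case: eqP => ij; case: eqP => i'j //=.
    - apply: leq_trans (ltnW aj'_gt) (dmono a _); rewrite tE /unbump; lia.
    - by apply: a_le; rewrite tE /unbump; lia.
    - by apply: dmono; rewrite !tE /unbump; lia.
  exists (DMap insM); rewrite [LHS]surjective_pairing; congr (_, _).
    by apply: dmapP => i; rewrite w1 /=; case: ifP.
  rewrite w2 /= C2 -!actM; congr (act _ _); apply: dmapP => i; apply: val_inj.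
  rewrite /=; case: eqP => [ij|//]; rewrite (_ : t i = j').
    by rewrite aj' /unbump /=; lia.
  by apply: val_inj; rewrite /= tE /unbump; lia.
exists (@HSimplex X A n.+1 (fun m s x => F m (s, x))
    (fun l m a s x y e => @snat V A F _ _ a (s, x) (dcomp s a, y)
       (f_equal (pair (dcomp s a)) e))).
  move=> i ik; apply: hsimplexP => m s x /=.
  by apply: FG0; left; exists i => //; exists s.
apply: hsimplexP => m s x /=; apply: FG0; right.
by case: x => x Kx; exists Kx.
Qed.

Lemma has_inner_fillersP (R : sset) :
  has_inner_fillers R -> inner_fibration (bang R).
Proof.
move=> R_fill n k k_in y z y_compat _; have [u uE] := R_fill n k k_in y y_compat.
by exists u => //; apply: dmapP => i; rewrite !ord1.
Qed.

(** The subset [K] is empty here, so the base imposes no condition. *)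
Lemma ihom_fillers (X A : sset) :
  has_inner_fillers A -> has_inner_fillers (ihom X A).
Proof.
move=> A_fill n k k_in y y_compat.
have c0 m l (a : dmap m l) (x : X l) : False -> False by [].
have z_nat l m (a : dmap l m) (s : dmap m n.+1) (x : subsset c0 m) y' :
  act a x = y' -> act a (False_rect (A m) (svalP x)) = False_rect (A l) (svalP y').
  by case: x => x [].
have [|u uE _] := @inner_fibration_restrict A X _ c0 A_fill n k k_in y (HSimplex z_nat) y_compat.
  by move=> i ik; apply: hsimplexP => m s [x []].
by exists u.
Qed.

Lemma dcomp_dconst l m n (v : 'I_n.+1) (a : dmap l m) : dcomp (dconst m v) a = dconst l v.
Proof. exact: dmapP. Qed.

Definition vertex (X : sset) m (x : X m) : X 0 := act (dconst 0 ord0) x.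

(** [K] consists of the constant simplices at vertices, so the values at different vertices are
    prescribed independently. This serves for the two ends of an arrow, and later to replace a cell
    homotopic to the identity at each vertex by one that is the identity there. *)
Lemma ihom_vertex_fillers (X A : sset) : has_inner_fillers A ->
  forall n (k : 'I_n.+2), 0 < k < n.+1 ->
  forall (y : 'I_n.+2 -> ihom X A n) (z : X 0 -> A n.+1), compat k y ->
  (forall i v, i <> k -> eval_at A v n (y i) = d_ i (z v)) ->
  exists2 u : ihom X A n.+1, forall i, i <> k -> d_ i u = y i
    & forall v, eval_at A v n.+1 u = z v.
Proof.
move=> A_fill n k k_in y z y_compat yz.
pose K m (x : X m) : Prop := exists v : X 0, x = act (dconst m ord0) v.
have cK l m (a : dmap l m) x : K m x -> K l (act a x).
  by move=> [v ->]; exists v; rewrite -actM dcomp_dconst.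
have vertexK m v : vertex (act (dconst m ord0) v : X m) = v.
  by rewrite /vertex -actM -[RHS]act1; congr (act _ _); apply: dmapP => i; rewrite [RHS]ord1.
have z_nat l m (a : dmap l m) (s : dmap m n.+1) (x : subsset cK m) y' :
  act a x = y' -> act a (act s (z (vertex (sval x)))) = act (dcomp s a) (z (vertex (sval y'))).
  move=> <- /=; case: x => x [v /= ->]; rewrite -actM; congr (act _ (z _)).
  by rewrite /vertex -!actM !dcomp_dconst.
have [|u uE uz] := @inner_fibration_restrict A X _ cK A_fill n k k_in y (HSimplex z_nat) y_compat.
  move=> i ik; apply: hsimplexP => m s [x Kx] /=.
  case: Kx => v ->.
  rewrite vertexK actM -/(d_ i (z v)) -yz //= (hnat (y i) (did n) (erefl : _ = act s _)).
  by rewrite -actM dcomp_dconst.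
exists u => // v.
have Kv : K n.+1 (act (dconst n.+1 ord0) v) by exists v.
have := f_equal (fun h : ihom (subsset cK) A n.+1 => h n.+1 (did n.+1) (exist _ _ Kv)) uz.
by rewrite /= vertexK act1.
Qed.

(** For [i < j], an operator common to both faces misses both vertices and factors through the face
    of codimension two, where the simplicial identity applies. *)
Lemma compat_faces (R : sset) n (k : 'I_n.+3) (y : 'I_n.+3 -> R n.+1) :
  (forall (i j : 'I_n.+3) (i' j' : 'I_n.+2), i <> k -> j <> k ->
    i' = i :> nat -> j'.+1 = j -> i' <= j' -> d_ i' (y j) = d_ j' (y i)) ->
  compat k y.
Proof.
move=> yP; have lt_compat (i j : 'I_n.+3) : i < j -> i <> k -> j <> k ->
    forall m (a b : dmap m n.+1), dcomp (dface i) a = dcomp (dface j) b ->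
    act a (y i) = act b (y j).
  move=> ij ik jk m a b ab; have abE x : bump i (a x) = bump j (b x).
    by rewrite -!dfaceE; exact: (f_equal (fun t : dmap m n.+2 => val (t x)) ab).
  have lt_i' : i < n.+2 by have := ltn_ord j; lia.
  have lt_j' : j.-1 < n.+2 by have := ltn_ord j; lia.
  have [x bE|c bE] := @dmap_skip _ _ b (Ordinal lt_i').
    by have := abE x; rewrite bE /= /bump; lia.
  have aE : a = dcomp (dface (Ordinal lt_j')) c.
    apply: dmapP => x; apply: val_inj; have := abE x.
    by rewrite bE /= /bump; lia.
  rewrite aE bE !actM -!/(d_ _ _); congr (act c _); apply/esym/yP => //=; lia.
move=> i j ik jk m a b ab; case: (ltngtP i j) => [ij|ji|/val_inj ij].
- exact: lt_compat.
- by apply/esym/lt_compat.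
subst j; congr (act _ _); apply: dmapP => x.
exact: lift_inj (f_equal (fun t : dmap m n.+2 => t x) ab).
Qed.

(** * Inner horns of dimensions two and three *)

Local Notation o13 := (@Ordinal 3 1 isT).
Local Notation o14 := (@Ordinal 4 1 isT).
Local Notation o24 := (@Ordinal 4 2 isT).

Lemma d_eq (X : sset) n (x : X n.+1) (i j : 'I_n.+2) : i = j :> nat -> d_ i x = d_ j x.
Proof. by move=> /val_inj ->. Qed.

Lemma fill21 (R : sset) (R_fill : has_inner_fillers R) (f g : R 1) :
  d_ ord0 f = d_ ord_max g -> exists2 t : R 2, d_ ord_max t = f & d_ ord0 t = g.
Proof.
move=> fg; pose y (i : 'I_3) := if i == 0 :> nat then g else f.
have y_compat : compat o13 y.
  apply: compat_faces => -[[|[|[|i]]] i3] // -[[|[|[|j]]] j3] // i' j' ik jk /= iE [jE] // ij;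
    try by [case: ik; apply: val_inj | case: jk; apply: val_inj | lia].
  by rewrite (@d_eq _ _ _ i' ord0) // (@d_eq _ _ _ j' ord_max).
have [t tE] := R_fill _ o13 isT _ y_compat.
by exists t; apply: tE.
Qed.

Lemma fill31 (R B : sset) (p : smap R B) (y0 y2 y3 : R 2) (z : B 3) :
  inner_fibration p ->
  d_ ord0 y2 = d_ o13 y0 -> d_ ord0 y3 = d_ ord_max y0 -> d_ ord_max y3 = d_ ord_max y2 ->
  p _ y0 = d_ ord0 z -> p _ y2 = d_ o24 z -> p _ y3 = d_ ord_max z ->
  exists u : R 3, [/\ d_ ord0 u = y0, d_ o24 u = y2, d_ ord_max u = y3 & p _ u = z].
Proof.
move=> p_fib y02 y03 y23 z0 z2 z3.
pose y (i : 'I_4) := if i == 0 :> nat then y0 else if i == 2 :> nat then y2 else y3.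
have y_compat : compat o14 y.
  apply: compat_faces => -[[|[|[|[|i]]]] i3] // -[[|[|[|[|j]]]] j3] // i' j' ik jk /= iE [jE] // ij;
    try by [case: ik; apply: val_inj | case: jk; apply: val_inj | lia].
  - by rewrite (@d_eq _ _ _ i' ord0) // (@d_eq _ _ _ j' o13).
  - by rewrite (@d_eq _ _ _ i' ord0) // (@d_eq _ _ _ j' ord_max).
  - by rewrite (@d_eq _ _ _ i' ord_max) // (@d_eq _ _ _ j' ord_max).
have [|u uE uz] := p_fib _ o14 isT y z y_compat.
  move=> -[[|[|[|[|i]]]] i3] // ik; rewrite /y /= ?z0 ?z2 ?z3; try exact: d_eq.
  by case: ik; apply: val_inj.
by exists u; split=> //; rewrite uE.
Qed.

Lemma fill32 (R B : sset) (p : smap R B) (y0 y1 y3 : R 2) (z : B 3) :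
  inner_fibration p ->
  d_ ord0 y1 = d_ ord0 y0 -> d_ ord0 y3 = d_ ord_max y0 -> d_ o13 y3 = d_ ord_max y1 ->
  p _ y0 = d_ ord0 z -> p _ y1 = d_ o14 z -> p _ y3 = d_ ord_max z ->
  exists u : R 3, [/\ d_ ord0 u = y0, d_ o14 u = y1, d_ ord_max u = y3 & p _ u = z].
Proof.
move=> p_fib y01 y03 y13 z0 z1 z3.
pose y (i : 'I_4) := if i == 0 :> nat then y0 else if i == 1 :> nat then y1 else y3.
have y_compat : compat o24 y.
  apply: compat_faces => -[[|[|[|[|i]]]] i3] // -[[|[|[|[|j]]]] j3] // i' j' ik jk /= iE [jE] // ij;
    try by [case: ik; apply: val_inj | case: jk; apply: val_inj | lia].
  - by rewrite (@d_eq _ _ _ i' ord0) // (@d_eq _ _ _ j' ord0).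
  - by rewrite (@d_eq _ _ _ i' ord0) // (@d_eq _ _ _ j' ord_max).
  - by rewrite (@d_eq _ _ _ i' o13) // (@d_eq _ _ _ j' ord_max).
have [|u uE uz] := p_fib _ o24 isT y z y_compat.
  move=> -[[|[|[|[|i]]]] i3] // ik; rewrite /y /= ?z0 ?z1 ?z3; try exact: d_eq.
  by case: ik; apply: val_inj.
by exists u; split=> //; rewrite uE.
Qed.

Lemma horn31 (R : sset) (y0 y2 y3 : R 2) : has_inner_fillers R ->
  d_ ord0 y2 = d_ o13 y0 -> d_ ord0 y3 = d_ ord_max y0 -> d_ ord_max y3 = d_ ord_max y2 ->
  exists u : R 3, [/\ d_ ord0 u = y0, d_ o24 u = y2 & d_ ord_max u = y3].
Proof.
move=> /has_inner_fillersP R_fib y02 y03 y23.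
have [|||u [u0 u2 u3 _]] := fill31 R_fib y02 y03 y23 (z := (dconst 3 ord0 : simplex 0 3));
  by [apply: dmapP => i; rewrite !ord1 | exists u].
Qed.

Lemma horn32 (R : sset) (y0 y1 y3 : R 2) : has_inner_fillers R ->
  d_ ord0 y1 = d_ ord0 y0 -> d_ ord0 y3 = d_ ord_max y0 -> d_ o13 y3 = d_ ord_max y1 ->
  exists u : R 3, [/\ d_ ord0 u = y0, d_ o14 u = y1 & d_ ord_max u = y3].
Proof.
move=> /has_inner_fillersP R_fib y01 y03 y13.
have [|||u [u0 u1 u3 _]] := fill32 R_fib y01 y03 y13 (z := (dconst 3 ord0 : simplex 0 3));
  by [apply: dmapP => i; rewrite !ord1 | exists u].
Qed.

(** * Homotopy categories of quasi-categories *)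

Lemma act_eq (X : sset) m n (a b : dmap m n) (x : X n) : a = b -> act a x = act b x.
Proof. by move->. Qed.

Lemma act_id (X : sset) n (a : dmap n n) (x : X n) : a = did n -> act a x = x.
Proof. by move->; apply: act1. Qed.

Ltac dmap_cases := apply: dmapP;
  let v := fresh "v" in let lt_v := fresh "lt_v" in
  case=> v lt_v; apply: val_inj; move: v lt_v; do 6?[case=> //].

Ltac simplicial := rewrite /d_ /degen -?actM;
  first [apply: act_eq; dmap_cases | apply: act_id; dmap_cases
        | apply/esym/act_id; dmap_cases].

Definition src (X : sset) (e : X 1) : X 0 := d_ ord_max e.
Definition tgt (X : sset) (e : X 1) : X 0 := d_ ord0 e.

Definition s0 (X : sset) (e : X 1) : X 2 := act (sdeg (ord0 : 'I_2)) e.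
Definition s1 (X : sset) (e : X 1) : X 2 := act (sdeg (ord_max : 'I_2)) e.

Lemma src_degen (X : sset) (x : X 0) : src (degen x) = x.
Proof. by rewrite /src; simplicial. Qed.
Lemma tgt_degen (X : sset) (x : X 0) : tgt (degen x) = x.
Proof. by rewrite /tgt; simplicial. Qed.

Lemma s0E (X : sset) (f : X 1) :
  [/\ d_ ord_max (s0 f) = degen (src f), d_ ord0 (s0 f) = f & d_ o13 (s0 f) = f].
Proof. by rewrite /s0 /src; split; simplicial. Qed.
Lemma s1E (X : sset) (f : X 1) :
  [/\ d_ ord_max (s1 f) = f, d_ ord0 (s1 f) = degen (tgt f) & d_ o13 (s1 f) = f].
Proof. by rewrite /s1 /tgt; split; simplicial. Qed.

(** Composition as a relation: [h] is a composite of [f] and [g]. No filler is chosen, and endpoints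
    stay out of the types. *)
Definition tri (X : sset) (f g h : X 1) : Prop :=
  exists t : X 2, [/\ d_ ord_max t = f, d_ ord0 t = g & d_ o13 t = h].

Lemma tri_ends (X : sset) (f g h : X 1) : tri f g h ->
  [/\ tgt f = src g, src h = src f & tgt h = tgt g].
Proof.
by case=> t [<- <- <-]; rewrite /tgt /src; split; simplicial.
Qed.

Lemma tri_degen_l (X : sset) (f : X 1) : tri (degen (src f)) f f.
Proof. by exists (s0 f); apply: s0E. Qed.
Lemma tri_degen_r (X : sset) (f : X 1) : tri f (degen (tgt f)) f.
Proof. by exists (s1 f); apply: s1E. Qed.

Lemma tri_map (X Y : sset) (F : smap X Y) (f g h : X 1) :
  tri f g h -> tri (F 1 f) (F 1 g) (F 1 h).
Proof. by case=> t [<- <- <-]; exists (F 2 t); split; apply: snat. Qed.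

Lemma tri_ex (X : sset) (X_fill : has_inner_fillers X) (f g : X 1) :
  tgt f = src g -> exists h, tri f g h.
Proof. by move=> /(fill21 X_fill) [t tf tg]; exists (d_ o13 t), t. Qed.

(** The three triangles are the faces 3, 0 and 1 of an inner horn; face 2 of its filler is the
    triangle sought. With the companion producing face 1, it gives uniqueness of composites and
    their invariance under homotopy. *)
Lemma tri_assocl (X : sset) (X_fill : has_inner_fillers X) (f g h a b c : X 1) :
  tri f g a -> tri g h b -> tri a h c -> tri f b c.
Proof.
case=> y3 [f3 g3 a3] [y0 [g0 h0 b0]] [y1 [a1 h1 c1]].
have [|||u [u0 u1 u3]] := horn32 (y0 := y0) (y1 := y1) (y3 := y3) X_fill;
  rewrite ?f3 ?g3 ?a3 ?g0 ?h0 ?b0 ?a1 ?h1 ?c1 //.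
exists (d_ o24 u); split.
- by rewrite -f3 -u3; simplicial.
- by rewrite -b0 -u0; simplicial.
- by rewrite -c1 -u1; simplicial.
Qed.

Lemma tri_assocr (X : sset) (X_fill : has_inner_fillers X) (f g h a b c : X 1) :
  tri f g a -> tri g h b -> tri f b c -> tri a h c.
Proof.
case=> y3 [f3 g3 a3] [y0 [g0 h0 b0]] [y2 [f2 b2 c2]].
have [|||u [u0 u2 u3]] := horn31 (y0 := y0) (y2 := y2) (y3 := y3) X_fill;
  rewrite ?f3 ?g3 ?a3 ?g0 ?h0 ?b0 ?f2 ?b2 ?c2 //.
exists (d_ o14 u); split.
- by rewrite -a3 -u3; simplicial.
- by rewrite -h0 -u0; simplicial.
- by rewrite -c2 -u2; simplicial.
Qed.

Definition homotopic (X : sset) (f g : X 1) : Prop := tri f (degen (tgt f)) g.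

Lemma homotopic_refl (X : sset) (f : X 1) : homotopic f f.
Proof. exact: tri_degen_r. Qed.

Lemma homotopic_ends (X : sset) (f g : X 1) :
  homotopic f g -> src g = src f /\ tgt g = tgt f.
Proof. by case/tri_ends => _ -> ->; rewrite tgt_degen. Qed.

Lemma tri_uniq (X : sset) (X_fill : has_inner_fillers X) (f g a b : X 1) :
  tri f g a -> tri f g b -> homotopic a b.
Proof.
move=> fga fgb; have [_ _ ag] := tri_ends fga.
rewrite /homotopic ag; exact: tri_assocr fga (tri_degen_r g) fgb.
Qed.

Lemma homotopic_sym (X : sset) (X_fill : has_inner_fillers X) (f g : X 1) :
  homotopic f g -> homotopic g f.
Proof. by move=> fg; apply: (tri_uniq X_fill fg); apply: tri_degen_r. Qed.

Lemma tri_homotopic_l (X : sset) (X_fill : has_inner_fillers X) (f f' g a : X 1) :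
  tri f g a -> homotopic f f' -> tri f' g a.
Proof.
move=> fga ff'; have [fg _ _] := tri_ends fga.
apply: (tri_assocr X_fill ff' _ fga); rewrite fg; exact: tri_degen_l.
Qed.

Lemma tri_homotopic (X : sset) (X_fill : has_inner_fillers X) (f g a a' : X 1) :
  tri f g a -> homotopic a a' -> tri f g a'.
Proof.
move=> fga aa'; have [_ _ ag] := tri_ends fga.
by apply: (tri_assocl X_fill fga (tri_degen_r g)); rewrite -ag.
Qed.

Lemma tri_homotopic_r (X : sset) (X_fill : has_inner_fillers X) (f g g' a : X 1) :
  tri f g a -> homotopic g g' -> tri f g' a.
Proof.
move=> fga gg'; have [_ _ ag] := tri_ends fga.
by apply: (tri_assocl X_fill fga gg'); rewrite -ag; apply: tri_degen_r.
Qed.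

Lemma homotopic_trans (X : sset) (X_fill : has_inner_fillers X) (f g h : X 1) :
  homotopic f g -> homotopic g h -> homotopic f h.
Proof. by move=> fg; apply: tri_homotopic. Qed.

(** Evaluation of a path at an edge, again as a relation. Its invariance under [peq] shows that, in
    the presence of inner fillers, morphisms of [hcat] are homotopy classes of edges. *)
Fixpoint pcomp (X : sset) (x y : X 0) (p : path x y) (e : X 1) : Prop :=
  match p with
  | pnil x => homotopic (degen x) e
  | pcons _ _ _ f p' => exists2 g, pcomp p' g & tri f g e
  end.

Lemma pcomp_ends (X : sset) (x y : X 0) (p : path x y) (e : X 1) :
  pcomp p e -> src e = x /\ tgt e = y.
Proof.
elim: p e => {x y} [x|x y z f p IH] e /=.
  by move=> /homotopic_ends [-> ->]; rewrite src_degen tgt_degen.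
case=> g /IH [_ gz] /tri_ends [_ -> ->].
by split=> //; apply: edge_src.
Qed.

Lemma pcomp_ex (X : sset) (X_fill : has_inner_fillers X) (x y : X 0) (p : path x y) :
  exists e, pcomp p e.
Proof.
elim: p => {x y} [x|x y z f p [g pg]] /=.
  by exists (degen x); apply: homotopic_refl.
have [|h fgh] := @tri_ex _ X_fill f g; last by exists h, g.
by rewrite (pcomp_ends pg).1; apply: edge_tgt.
Qed.

Lemma pcomp_uniq (X : sset) (X_fill : has_inner_fillers X) (x y : X 0)
    (p : path x y) (e e' : X 1) : pcomp p e -> pcomp p e' -> homotopic e e'.
Proof.
elim: p e e' => {x y} [x|x y z f p IH] e e' /=; first exact: tri_uniq.
move=> [g pg fge] [g' pg' fge']; apply: tri_uniq fge _ => //.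
by apply: tri_homotopic_r fge' _ => //; apply: IH.
Qed.

Lemma pcomp_homotopic (X : sset) (X_fill : has_inner_fillers X) (x y : X 0)
    (p : path x y) (e e' : X 1) : pcomp p e -> homotopic e e' -> pcomp p e'.
Proof.
case: p => {x y} [x|x y z f p] /=; first exact: tri_homotopic.
by move=> [g pg fge] ee'; exists g => //; apply: tri_homotopic fge ee'.
Qed.

Lemma pcomp_cat (X : sset) (X_fill : has_inner_fillers X) (x y z : X 0)
    (p : path x y) (q : path y z) (e f g : X 1) :
  pcomp p f -> pcomp q g -> tri f g e -> pcomp (pcat p q) e.
Proof.
elim: p q e f g => {x y} [x|x w y a p IH] q e f g /=.
  move=> xf qg fge; apply: (pcomp_homotopic X_fill qg).
  have [gx _] := pcomp_ends qg.
  have := tri_homotopic_l X_fill fge (homotopic_sym X_fill xf).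
  by apply: tri_uniq => //; rewrite -gx; apply: tri_degen_l.
move=> [b pb abf] qg fge; have [_ _ fb] := tri_ends abf.
have [c bgc] : exists c, tri b g c.
  by apply: tri_ex => //; rewrite -fb; case: (tri_ends fge).
by exists c; [apply: IH pb qg bgc | apply: tri_assocl abf bgc fge].
Qed.

Lemma pcomp_path1 (X : sset) (X_fill : has_inner_fillers X) (x y : X 0)
    (f : edge x y) (e : X 1) : pcomp (path1 f) e <-> homotopic f e.
Proof.
rewrite /homotopic (edge_tgt f : tgt f = y); split=> [[g yg fge]|fe] /=.
  by apply: tri_homotopic_r fge _ => //; apply: homotopic_sym.
by exists (degen y) => //; apply: homotopic_refl.
Qed.

Lemma peq_pcomp (X : sset) (X_fill : has_inner_fillers X) (x y : X 0)
    (p q : path x y) : peq p q -> forall e, pcomp p e <-> pcomp q e.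
Proof.
elim=> {x y p q}.
- by [].
- by move=> x y p q _ pq e; rewrite pq.
- by move=> x y p q r _ pq _ qr e; rewrite pq.
- move=> x y z p p' q q' _ pp' _ qq' e.
  have [[f pf] [g qg]] := (pcomp_ex X_fill p, pcomp_ex X_fill q).
  have [h fgh] : exists h, tri f g h.
    by apply: tri_ex => //; rewrite (pcomp_ends pf).2 (pcomp_ends qg).1.
  have pqh := pcomp_cat X_fill pf qg fgh.
  have pqh' : pcomp (pcat p' q') h.
    by apply: (pcomp_cat X_fill) fgh; [apply/pp' | apply/qq'].
  split=> He.
    by apply: pcomp_homotopic pqh' _ => //; apply: pcomp_uniq He.
  by apply: pcomp_homotopic pqh _ => //; apply: pcomp_uniq He.
- by move=> x e ee e'; rewrite pcomp_path1 //= ee.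
- move=> x y z f g h t tf tg th e; rewrite pcomp_path1 //.
  have fgh : tri f g h by exists t.
  split=> [[g' /= [c zc gcg'] fg'e]|he].
    apply: tri_uniq fgh _ => //; apply: tri_homotopic_r fg'e _ => //.
    apply: tri_uniq gcg' _ => //; apply: tri_homotopic_r zc => //.
    by rewrite -(edge_tgt g); apply: tri_degen_r.
  exists g; last exact: tri_homotopic fgh he.
  by apply/pcomp_path1 => //; apply: homotopic_refl.
Qed.

Definition ec (X : sset) (x y : X 0) (e : edge x y) : @hom (hcat X) x y :=
  pclass (path1 e).

Lemma pcomp_peq (X : sset) (x y : X 0) (p : path x y) (e : edge x y) :
  pcomp p e -> peq p (path1 e).
Proof.
elim: p e => {x y} [x|x y z f p IH] e /=.
  case=> t [t2 t0 t1]; have xx : edge x x by exists (degen x); [apply: src_degen|apply: tgt_degen].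
  pose d := Edge (src_degen x) (tgt_degen x); rewrite tgt_degen in t0.
  apply: peq_sym; apply: peq_trans (peq_sym (@peq_triangle _ _ _ _ d d e t t2 t0 t1)) _.
  exact: (peq_cat (peq_degen (erefl : edge_val d = _)) (peq_degen (erefl : edge_val d = _))).
case=> g pg [t [t2 t0 t1]]; have [gs gt] := pcomp_ends pg.
have := IH (Edge gs gt) pg => pg'.
apply: peq_trans (peq_cat (peq_refl (path1 f)) pg') _.
exact: (@peq_triangle _ _ _ _ f (Edge gs gt) e t).
Qed.

Lemma ec_ex (X : sset) (X_fill : has_inner_fillers X) (x y : X 0)
  (phi : @hom (hcat X) x y) : exists e : edge x y, phi = ec e.
Proof.
have [e pe] := pcomp_ex X_fill (prepr (phi : hhom x y)); have [es et] := pcomp_ends pe.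
exists (Edge es et); rewrite -[phi in LHS](preprK (phi : hhom x y)).
by apply/pclassP/pcomp_peq.
Qed.

Lemma ecP (X : sset) (X_fill : has_inner_fillers X) (x y : X 0) (e e' : edge x y) :
  ec e = ec e' <-> homotopic e e'.
Proof.
have eqP : ec e = ec e' <-> peq (path1 e) (path1 e') by exact: pclassP.
split=> [E|]; [have /(peq_pcomp X_fill) ee' := iffLR eqP E|].
  by apply/pcomp_path1 => //; apply/ee'/pcomp_path1 => //; apply: homotopic_refl.
by move=> ee'; apply/eqP/pcomp_peq/pcomp_path1.
Qed.

Lemma ec_tri (X : sset) (X_fill : has_inner_fillers X) (x y z : X 0)
    (f : edge x y) (g : edge y z) (h : edge x z) :
  cmp (ec g) (ec f) = ec h <-> tri f g h.
Proof.
rewrite [cmp _ _](hcmpE (path1 g) (path1 f)); have eqP : pclass (pcat (path1 f) (path1 g)) = ec h <->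
  peq (pcat (path1 f) (path1 g)) (path1 h) by exact: pclassP.
split=> [E|[t [t2 t0 t1]]]; [have /(peq_pcomp X_fill) fgh := iffLR eqP E|].
  have [|k fgk] := @tri_ex _ X_fill f g; first by rewrite [tgt _]edge_tgt [src _]edge_src.
  apply: (tri_homotopic X_fill fgk); apply: homotopic_sym => //.
  apply/pcomp_path1 => //; apply/fgh.
  apply: (pcomp_cat X_fill) fgk; apply/pcomp_path1 => //; exact: homotopic_refl.
by apply: (iffRL eqP); apply: peq_triangle t2 t0 t1.
Qed.

(** * Simplices of the arrow object and of diagrams on wedges *)

Definition chainT n (i : 'I_n.+1) : dmap n.+1 1.
Proof.
refine (@DMap n.+1 1 (fun r => if i < r then ord_max else ord0) _).
by move=> r r' rr'; case: ltnP => // ir; rewrite (leq_trans ir rr').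
Defined.

(* The shuffle [(r,0) < ... < (i,0) < (i,1) < ... < (n,1)] of the prism
   [Delta^n * Delta^1] evaluated at [u]. *)
Definition shuffle (Q : sset) n (u : ihom (simplex 1) Q n) (i : 'I_n.+1) : Q n.+1 :=
  u n.+1 (sdeg i) (chainT i).

Lemma dadd_ord m n (s : dmap m n) (t : dmap m 1) r : s r + t r < n.+2.
Proof. by have := ltn_ord (s r); have := ltn_ord (t r); lia. Qed.

(** Position on a shuffle: [(r, 0)] stands at place [r] and [(r, 1)] at place [r + 1], on every
    shuffle through it. One operator thus serves all shuffles containing a given simplex. *)
Definition dadd m n (s : dmap m n) (t : dmap m 1) : dmap m n.+1.
Proof.
refine (@DMap m n.+1 (fun r => Ordinal (dadd_ord s t r)) _).
by move=> r r' rr' /=; apply: leq_add; apply: dmono.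
Defined.

Definition on_shuffle m n (s : dmap m n) (t : dmap m 1) (i : 'I_n.+1) : Prop :=
  forall r, if t r == 0 :> nat then s r <= i else i <= s r.

Lemma on_shuffle_ex m n (s : dmap m n) (t : dmap m 1) : exists i, on_shuffle s t i.
Proof.
(* The shuffle turns at the largest [s r] with [t r = 0], or at [0] if there is none. *)
have lt_max : \max_(r | t r == 0 :> nat) s r < n.+1.
  by rewrite ltnS; apply/bigmax_leqP => r _; rewrite -ltnS.
exists (Ordinal lt_max) => r /=; case: ifP => tr; first exact: leq_bigmax_cond.
apply/bigmax_leqP => r' tr'; apply: dmono; rewrite leqNgt; apply/negP => /ltnW/(dmono t).
by rewrite (eqP tr') leqn0 tr.
Qed.

Lemma on_shuffleE m n (s : dmap m n) (t : dmap m 1) (i : 'I_n.+1) :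
  on_shuffle s t i -> dcomp (sdeg i) (dadd s t) = s /\ dcomp (chainT i) (dadd s t) = t.
Proof.
move=> it; split; apply: dmapP => r; apply: val_inj; have := it r; have := ltn_ord (t r).
  by rewrite /= /unbump; case: eqP; lia.
by rewrite /=; case: eqP => t0 lt_t i_le; case: ifP => /= lt_i; lia.
Qed.

Lemma shuffleE (Q : sset) n (u : ihom (simplex 1) Q n) m (s : dmap m n) (t : dmap m 1) i :
  on_shuffle s t i -> u m s t = act (dadd s t) (shuffle u i).
Proof.
move=> /on_shuffleE [sE tE]; rewrite /shuffle.
by rewrite (hnat u (sdeg i) (tE : act _ (chainT i : simplex 1 _) = t)) sE.
Qed.

Lemma shuffleP (Q : sset) n (u v : ihom (simplex 1) Q n) :
  (forall i, shuffle u i = shuffle v i) -> u = v.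
Proof.
move=> uv; apply: hsimplexP => m s t; have [i it] := on_shuffle_ex s t.
by rewrite !(shuffleE _ it) uv.
Qed.

(** A simplex lying on two shuffles lies on all those between them, so agreement on the faces shared
    by consecutive shuffles makes the values well defined. *)
Lemma shuffle_ex (Q : sset) n (y : 'I_n.+1 -> Q n.+1) :
  (forall (i j : 'I_n.+1) (i' : 'I_n.+2), j = i.+1 :> nat -> i' = j :> nat ->
    d_ i' (y j) = d_ i' (y i)) ->
  exists u : ihom (simplex 1) Q n, forall i, shuffle u i = y i.
Proof.
move=> yd.
have indep c m (s : dmap m n) (t : dmap m 1) (i j : 'I_n.+1) : j = i + c :> nat ->
    on_shuffle s t i -> on_shuffle s t j -> act (dadd s t) (y i) = act (dadd s t) (y j).
  elim: c j => [|c IH] j jE it jt; first by congr (act _ (y _)); apply: val_inj; rewrite /= jE addn0.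
  have lt_j' : i + c < n.+1 by have := ltn_ord j; lia.
  rewrite (IH (Ordinal lt_j')) //.
    have [r|b ->] := @dmap_skip _ _ (dadd s t) (widen_ord (leqnSn _) j).
      move/(f_equal val); have := it r; have := jt r; have := ltn_ord (t r).
      by rewrite /=; case: eqP; lia.
    by rewrite !actM -!/(d_ _ _); congr (act b _); apply/esym/yd => //=; lia.
  by move=> r; have := it r; have := jt r; rewrite /=; case: ifP; lia.
have indep' m (s : dmap m n) (t : dmap m 1) (i j : 'I_n.+1) :
    on_shuffle s t i -> on_shuffle s t j -> act (dadd s t) (y i) = act (dadd s t) (y j).
  move=> it jt; case: (leqP i j) => ij.
    by apply: (@indep (j - i)) => //; lia.
  by apply/esym/(@indep (i - j)) => //; lia.
pose h m (s : dmap m n) (t : dmap m 1) : Q m :=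
  act (dadd s t) (y (sval (cid (on_shuffle_ex s t)))).
have hE m (s : dmap m n) (t : dmap m 1) i : on_shuffle s t i ->
    h m s t = act (dadd s t) (y i).
  by apply: indep'; apply: (svalP (cid _)).
have h_nat l m (a : dmap l m) (s : dmap m n) (x : simplex 1 m) z :
    act a x = z -> act a (h m s x) = h l (dcomp s a) z.
  move=> <-; have [i it] := on_shuffle_ex s x.
  rewrite (hE _ _ _ _ it) (@hE _ _ _ i) => [|r]; last exact: (it (a r)).
  by rewrite -actM; apply: act_eq; apply: dmapP => r; apply: val_inj.
exists (HSimplex h_nat : ihom (simplex 1) Q n) => i; rewrite /shuffle /= (@hE _ _ _ i).
  apply: act_id; apply: dmapP => r; apply: val_inj; rewrite /= /unbump.
  by case: ltnP => /=; lia.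
by move=> r; rewrite /= /unbump; case: ltnP => /=; lia.
Qed.

Ltac shuffle_simp := rewrite /shuffle /d_ /=;
  match goal with |- _ = act ?a ?t => idtac | |- act ?a ?t = _ => apply/esym end;
  match goal with |- _ = act ?a (hfun ?u ?s ?t) => rewrite (hnat u s (erefl (act a (t : sob (simplex 1) _)))) end;
  f_equal; dmap_cases.

Lemma shuffle_src (Q : sset) (u : ihom (simplex 1) Q 1) :
  shuffle (src u) ord0 = d_ ord_max (shuffle u ord0).
Proof. by rewrite /src; shuffle_simp. Qed.

Lemma shuffle_tgt (Q : sset) (u : ihom (simplex 1) Q 1) :
  shuffle (tgt u) ord0 = d_ ord0 (shuffle u ord_max).
Proof. by rewrite /tgt; shuffle_simp. Qed.

Lemma shuffle_diag (Q : sset) (u : ihom (simplex 1) Q 1) :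
  d_ o13 (shuffle u ord0) = d_ o13 (shuffle u ord_max).
Proof.
rewrite /shuffle /d_ (hnat u _ (erefl (act (dface o13) (chainT ord0 : simplex 1 2)))).
by rewrite (hnat u _ (erefl (act (dface o13) (chainT ord_max : simplex 1 2)))) /=;
  f_equal; dmap_cases.
Qed.

Lemma shuffle2E (Q : sset) (u : ihom (simplex 1) Q 2) :
  [/\ shuffle (d_ ord_max u) ord0 = d_ ord_max (shuffle u ord0),
      shuffle (d_ ord_max u) ord_max = d_ ord_max (shuffle u o13) &
  [/\ shuffle (d_ ord0 u) ord0 = d_ ord0 (shuffle u o13),
      shuffle (d_ ord0 u) ord_max = d_ ord0 (shuffle u ord_max),
      shuffle (d_ o13 u) ord0 = d_ o24 (shuffle u ord0) &
      shuffle (d_ o13 u) ord_max = d_ o14 (shuffle u ord_max)]].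
Proof. by split; [| |split]; shuffle_simp. Qed.

Definition vx (b : 'I_2) : simplex 1 0 := dconst 0 b.

Lemma eval_vx (Q : sset) n (u : ihom (simplex 1) Q n) b :
  eval_at Q (vx b) n u = u n (did n) (dconst n b).
Proof. by []. Qed.

Lemma eval0_shuffle (Q : sset) n (u : ihom (simplex 1) Q n) :
  eval_at Q (vx ord0) n u = d_ ord_max (shuffle u ord_max).
Proof.
rewrite eval_vx /shuffle /d_ (hnat u _ (erefl (act (dface ord_max) (chainT ord_max : simplex 1 n.+1)))).
f_equal; apply: dmapP => r; apply: val_inj; have := ltn_ord r; rewrite /= /bump /unbump.
  by lia.
by case: ifP => //; lia.
Qed.

Lemma eval1_shuffle (Q : sset) n (u : ihom (simplex 1) Q n) :
  eval_at Q (vx ord_max) n u = d_ ord0 (shuffle u ord0).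
Proof.
rewrite eval_vx /shuffle /d_ (hnat u _ (erefl (act (dface ord0) (chainT ord0 : simplex 1 n.+1)))).
by f_equal; apply: dmapP => r; apply: val_inj; rewrite /= /bump /unbump //=; lia.
Qed.

(** An edge of the arrow object is a square cut by its diagonal. The triangle [ord0] follows the
    source arrow and then the edge at the end [1]; the triangle [ord_max] follows the edge at the
    end [0] and then the target arrow. *)
Lemma square_ex (Q : sset) (y0 y1 : Q 2) : d_ o13 y0 = d_ o13 y1 ->
  exists K : ihom (simplex 1) Q 1, shuffle K ord0 = y0 /\ shuffle K ord_max = y1.
Proof.
move=> y01; have [|K KE] := @shuffle_ex Q 1 (fun i => if i == 0 :> nat then y0 else y1).
  move=> [[|[|i]] i2] // [[|[|j]] j2] // i' // _ iE.
  by rewrite /= !(@d_eq _ _ _ i' o13) // y01.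
by exists K; rewrite !KE.
Qed.

Lemma square_eq (Q : sset) (K L : ihom (simplex 1) Q 1) :
  shuffle K ord0 = shuffle L ord0 -> shuffle K ord_max = shuffle L ord_max -> K = L.
Proof.
move=> KL0 KL1; apply: shuffleP => -[[|[|i]] i2] //.
  by rewrite (_ : Ordinal i2 = ord0) //; apply: val_inj.
by rewrite (_ : Ordinal i2 = ord_max) //; apply: val_inj.
Qed.

Lemma prism_ex (Q : sset) (y0 y1 y2 : Q 3) :
  d_ o14 y0 = d_ o14 y1 -> d_ o24 y1 = d_ o24 y2 ->
  exists u : ihom (simplex 1) Q 2,
    [/\ shuffle u ord0 = y0, shuffle u o13 = y1 & shuffle u ord_max = y2].
Proof.
move=> y01 y12; have [|K KE] := @shuffle_ex Q 2 (fun i =>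
    if i == 0 :> nat then y0 else if i == 1 :> nat then y1 else y2).
  move=> [[|[|[|i]]] i2] // [[|[|[|j]]] j2] // i' // _ iE.
    by rewrite /= !(@d_eq _ _ _ i' o14) // y01.
  by rewrite /= !(@d_eq _ _ _ i' o24) // y12.
by exists K; rewrite !KE.
Qed.

Definition yoneda (X : sset) n (x : X n) : smap (simplex n) X :=
  @SMap (simplex n) X (fun m s => act s x)
    (fun l m a s t e => etrans (esym (actM s a x)) (f_equal (fun r : dmap l n => act r x) e)).

Lemma yoneda_id (X : sset) n (x : X n) : yoneda x n (did n) = x.
Proof. exact: act1. Qed.

Lemma yonedaP (X : sset) n (f g : smap (simplex n) X) : f n (did n) = g n (did n) -> f = g.
Proof.
move=> fg; apply: smapP => m s.
rewrite -(snat f (erefl : act s (did n : simplex n n) = s)) fg; exact: snat.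
Qed.

Lemma wedge_ex v (Q : sset) n (u1 u2 : ihom (simplex 1) Q n) :
  eval_at Q (vx v) n u1 = eval_at Q (vx v) n u2 ->
  exists2 w : ihom (wedge v) Q n, prec Q (leg1 v) n w = u1 & prec Q (leg2 v) n w = u2.
Proof.
move=> u12; have [|w [[w1 w2] _]] := @wedge_pullback v _ _ (yoneda u1) (yoneda u2).
  by apply: yonedaP; exact: u12.
exists (w n (did n)).
  by have := f_equal (fun f : smap (simplex n) (ihom (simplex 1) Q) => f n (did n)) w1; rewrite yoneda_id.
by have := f_equal (fun f : smap (simplex n) (ihom (simplex 1) Q) => f n (did n)) w2; rewrite yoneda_id.
Qed.

Lemma wedge_eq v (Q : sset) n (w w' : ihom (wedge v) Q n) :
  prec Q (leg1 v) n w = prec Q (leg1 v) n w' -> prec Q (leg2 v) n w = prec Q (leg2 v) n w' ->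
  w = w'.
Proof.
move=> w1 w2; apply: hsimplexP => m s [[p1 p2] [/= p2v|/= p1v]].
  have := f_equal (fun u : ihom (simplex 1) Q n => u m s p1) w1.
  rewrite /= (_ : exist _ (p1, dconst m v) _ = exist _ (p1, p2) (or_introl p2v)) //.
  by apply: eq_exist; congr (_, _); apply: dmapP => i; rewrite p2v.
have := f_equal (fun u : ihom (simplex 1) Q n => u m s p2) w2.
rewrite /= (_ : exist _ (dconst m v, p2) _ = exist _ (p1, p2) (or_intror p1v)) //.
by apply: eq_exist; congr (_, _); apply: dmapP => i; rewrite p1v.
Qed.

Lemma eval_prec (X Y A : sset) (g : smap X Y) (v : X 0) n (u : ihom Y A n) :
  eval_at A (g 0 v) n u = eval_at A v n (prec A g n u).
Proof. by rewrite /= (snat g (erefl (act (dconst n ord0) v))). Qed.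

Definition ends (Q : sset) : smap (ihom (simplex 1) Q) (sprod Q Q).
Proof.
refine (@SMap (ihom (simplex 1) Q) (sprod Q Q)
  (fun n u => (eval_at Q (vx ord0) n u, eval_at Q (vx ord_max) n u)) _).
move=> m n a u _ <-; congr (_, _);
  exact: (snat (eval_at Q _) (erefl (act a u))).
Defined.

(** The vertices of [simplex 1] are its two ends, so prescribing [ends] is prescribing values at
    vertices. *)
Lemma ends_fibration (Q : sset) : has_inner_fillers Q -> inner_fibration (ends Q).
Proof.
move=> Q_fill n k k_in y z y_compat yz.
have [|u uE uz] := @ihom_vertex_fillers (simplex 1) Q Q_fill n k k_in y
  (fun v => if v ord0 == 0 :> nat then z.1 else z.2) y_compat.
  move=> i v ik.
  have z1 : eval_at Q (vx ord0) n (y i) = d_ i z.1 := f_equal fst (yz i ik).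
  have z2 : eval_at Q (vx ord_max) n (y i) = d_ i z.2 := f_equal snd (yz i ik).
  have -> : v = vx (v ord0) by apply: dmapP => r; rewrite [r]ord1.
  case: (v ord0) => -[|[|b]] b2 //; [rewrite -z1 | rewrite -z2];
    by congr (eval_at Q (vx _) n _); apply: val_inj.
exists u => //; rewrite [RHS]surjective_pairing; congr (_, _); exact: uz.
Qed.

Lemma ihom_curryE (X Y A : sset) n (u : ihom X (ihom Y A) n) m (s : dmap m n) (x : X m)
    l (t : dmap l m) (y : Y l) :
  u m s x l t y = u l (dcomp s t) (act t x) l (did l) y.
Proof. by rewrite -(hnat u s (erefl (act t x))). Qed.

Lemma ihom_act2 (X Y A : sset) n (u : ihom X (ihom Y A) n) l m (a : dmap l m)
    (s : dmap m n) (x : X m) (y : Y m) :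
  act a (u m s x m (did m) y) = u l (dcomp s a) (act a x) l (did l) (act a y).
Proof. by rewrite (hnat (u m s x) (did m) (erefl (act a y))) ihom_curryE. Qed.

Definition swap_val (X Y A : sset) n (u : ihom X (ihom Y A) n) m (s : dmap m n)
    (y : Y m) : ihom X A m :=
  @HSimplex X A m (fun l t x => u l (dcomp s t) x l (did l) (act t y))
    (fun l' l a t x x' e => etrans (ihom_act2 u a (dcomp s t) x (act t y))
      (f_equal2 (fun x y => u l' (dcomp (dcomp s t) a) x l' (did l') y)
        e (esym (actM t a y)))).

Lemma swap_nat (X Y A : sset) n (u : ihom X (ihom Y A) n) l m (a : dmap l m)
    (s : dmap m n) (y : Y m) y' :
  act a y = y' -> act a (swap_val u s y) = swap_val u (dcomp s a) y'.
Proof. by move=> <-; apply: hsimplexP => k t x /=; rewrite actM. Qed.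

(** Through this symmetry a cell between [Y]-families of diagrams becomes an edge of diagrams in
    [ihom Y A], and the constructions on diagrams need no parameter. *)
Definition swap (X Y A : sset) : smap (ihom X (ihom Y A)) (ihom Y (ihom X A)).
Proof.
refine (@SMap (ihom X (ihom Y A)) (ihom Y (ihom X A))
  (fun n u => @HSimplex Y (ihom X A) n (fun m s y => swap_val u s y)
    (@swap_nat X Y A n u)) _).
by move=> m n a u _ <-; apply: hsimplexP => l s y; apply: hsimplexP.
Defined.

Lemma swapK (X Y A : sset) n (u : ihom X (ihom Y A) n) : swap Y X A n (swap X Y A n u) = u.
Proof.
apply: hsimplexP => m s x; apply: hsimplexP => l t y /=.
by rewrite act1 [RHS]ihom_curryE.
Qed.

Lemma swap_prec_r (X Y Y' A : sset) (g : smap Y' Y) n (u : ihom X (ihom Y A) n) :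
  prec (ihom X A) g n (swap X Y A n u) = swap X Y' A n (postc X (prec A g) n u).
Proof.
apply: hsimplexP => m s y; apply: hsimplexP => l t x /=.
by rewrite (snat g (erefl (act t y))).
Qed.

Lemma swap_eval (X Y A : sset) (v : X 0) n (u : ihom X (ihom Y A) n) :
  postc Y (eval_at A v) n (swap X Y A n u) = eval_at (ihom Y A) v n u.
Proof.
apply: hsimplexP => m s y /=; rewrite act1 [RHS]ihom_curryE -actM.
by congr (u m _ (act _ v) m (did m) y); apply: dmapP.
Qed.

Lemma swap_const (X Y A : sset) n (w : ihom Y A n) :
  swap X Y A n (const_diag X (ihom Y A) n w) = postc Y (const_diag X A) n w.
Proof.
apply: hsimplexP => m s y; apply: hsimplexP => l t x /=.
by rewrite -(hnat w s (erefl (act t y))).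
Qed.

Lemma swap_src (X Y A : sset) (u : ihom X (ihom Y A) 1) :
  src (swap X Y A 1 u) = swap X Y A 0 (src u).
Proof. exact: snat. Qed.
Lemma swap_tgt (X Y A : sset) (u : ihom X (ihom Y A) 1) :
  tgt (swap X Y A 1 u) = swap X Y A 0 (tgt u).
Proof. exact: snat. Qed.

(** * Exchanging cones under spans and cones over cospans *)

Lemma s0_map (X Y : sset) (F : smap X Y) f : F 2 (s0 f) = s0 (F 1 f).
Proof. by apply/esym/snat. Qed.
Lemma s1_map (X Y : sset) (F : smap X Y) f : F 2 (s1 f) = s1 (F 1 f).
Proof. by apply/esym/snat. Qed.
Lemma d_map (X Y : sset) (F : smap X Y) n (i : 'I_n.+2) x : F n (d_ i x) = d_ i (F n.+1 x).
Proof. by apply/esym/snat. Qed.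

(* [K] is a leg of a cone under a span, a square whose row [s = 1] is constant,
   and [L] a leg of a cone over a cospan, whose row [s = 0] is constant. They
   are related when they share the triangle ([K] above, [L] below the diagonal)
   and a 3-simplex [(a, a, b, b)] exchanges the other two triangles
   [(f, 1, d)] and [(1, f, d)]. *)
Definition leg_exchange (R : sset) (K L : ihom (simplex 1) R 1) : Prop :=
  exists th f, [/\ shuffle K ord0 = shuffle L ord_max, shuffle K ord_max = d_ o14 th,
    shuffle L ord0 = d_ o24 th, d_ ord_max th = s0 f & d_ ord0 th = s1 f].

Lemma square_src (R : sset) (K : ihom (simplex 1) R 1) x :
  src K = const_diag (simplex 1) R 0 x -> d_ ord_max (shuffle K ord0) = degen x.
Proof. by move=> Kx; rewrite -shuffle_src Kx /shuffle /= /degen; f_equal; dmap_cases. Qed.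

Lemma square_tgt (R : sset) (K : ihom (simplex 1) R 1) x :
  tgt K = const_diag (simplex 1) R 0 x -> d_ ord0 (shuffle K ord_max) = degen x.
Proof. by move=> Kx; rewrite -shuffle_tgt Kx /shuffle /= /degen; f_equal; dmap_cases. Qed.

Lemma const_shuffle (R : sset) (w : ihom (simplex 1) R 0) x :
  shuffle w ord0 = degen x -> w = const_diag (simplex 1) R 0 x.
Proof.
move=> wx; apply: shuffleP => i; rewrite [i]ord1 wx /shuffle /= /degen.
by f_equal; dmap_cases.
Qed.

(** The edge [f] and the constant rows are edges of the degenerate faces 3 and 0 of [th]. The last
    equation comes from the shared triangle: the outer vertex is kept. *)
Lemma leg_exchange_facts (R : sset) (K L : ihom (simplex 1) R 1) : leg_exchange K L ->
  [/\ eval_at R (vx ord_max) 1 L = eval_at R (vx ord0) 1 K,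
      src L = const_diag (simplex 1) R 0 (src (eval_at R (vx ord0) 1 K)),
      tgt K = const_diag (simplex 1) R 0 (tgt (eval_at R (vx ord0) 1 K)) &
      eval_at R (vx ord0) 0 (tgt L) = eval_at R (vx ord_max) 0 (src K)].
Proof.
case=> th [f [K0 K1 L0 th3 th0]].
have [f2 f0 f1] := s0E f; have [g2 g0 g1] := s1E f.
have Kf : eval_at R (vx ord0) 1 K = f.
  by rewrite eval0_shuffle K1 -f1 -th3; simplicial.
rewrite Kf; split.
- by rewrite eval1_shuffle L0 -g1 -th0; simplicial.
- apply: const_shuffle; rewrite shuffle_src L0 -f2 -th3; simplicial.
- apply: const_shuffle; rewrite shuffle_tgt K1 -g0 -th0; simplicial.
rewrite /tgt d_map eval0_shuffle -K0 /src d_map eval1_shuffle; simplicial.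
Qed.

Lemma leg_exchange_map (R B : sset) (p : smap R B) (K L : ihom (simplex 1) R 1) :
  leg_exchange K L -> leg_exchange (postc (simplex 1) p 1 K) (postc (simplex 1) p 1 L).
Proof.
case=> th [f [K0 K1 L0 th3 th0]]; exists (p 3 th), (p 1 f).
split; rewrite -?s0_map -?s1_map -?d_map /shuffle /=; congr (p _ _) => //.
Qed.

Lemma leg_exchange_edge (R : sset) (K L : ihom (simplex 1) R 1) th f :
  shuffle K ord_max = d_ o14 th -> shuffle L ord0 = d_ o24 th ->
  d_ ord_max th = s0 f -> d_ ord0 th = s1 f ->
  eval_at R (vx ord0) 1 K = f /\ eval_at R (vx ord_max) 1 L = f.
Proof.
move=> K1 L0 th3 th0; have [f2 f0 f1] := s0E f; have [g2 g0 g1] := s1E f; split.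
  by rewrite eval0_shuffle K1 -f1 -th3; simplicial.
by rewrite eval1_shuffle L0 -g1 -th0; simplicial.
Qed.

(** The 3-simplex fills, relatively to [p], the horn with faces 0, 1 and 3: face 1 is a triangle of
    [K], and face 2 becomes one of [L]. In the opposite direction the faces 1 and 2 change roles. *)
Lemma leg_exchange_right (R B : sset) (p : smap R B) (K : ihom (simplex 1) R 1) b
    (L0 : ihom (simplex 1) B 1) :
  inner_fibration p -> tgt K = const_diag (simplex 1) R 0 b ->
  leg_exchange (postc (simplex 1) p 1 K) L0 ->
  exists2 L, leg_exchange K L & postc (simplex 1) p 1 L = L0.
Proof.
move=> p_fib Kb [th0 [f0 [K00 K01 L00 th03 th00]]].
pose f := eval_at R (vx ord0) 1 K.
have [f2 f0' f1] := s0E f; have [g2 g0 g1] := s1E f.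
have pf : p 1 f = f0.
  have [<- _] := leg_exchange_edge K01 L00 th03 th00.
  by rewrite /f !eval0_shuffle d_map.
have fK : f = d_ ord_max (shuffle K ord_max) by rewrite /f eval0_shuffle.
have K1 := square_tgt Kb.
have fb : tgt f = b.
  have -> : tgt f = src (d_ ord0 (shuffle K ord_max)).
    by rewrite fK /src /tgt; simplicial.
  by rewrite K1 src_degen.
have [||||||th [thd0 thd1 thd3 pth]] :=
  @fill32 R B p (s1 f) (shuffle K ord_max) (s0 f) th0 p_fib.
- by rewrite K1 g0 fb.
- by rewrite f0' g2.
- by rewrite f1.
- by rewrite s1_map pf.
- exact: K01.
- by rewrite s0_map pf.
have [|L [Ly0 Ly1]] := @square_ex R (d_ o24 th) (shuffle K ord0).
  by rewrite shuffle_diag -thd1; simplicial.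
exists L; first by exists th, f.
apply: square_eq; first by rewrite L00 -pth -d_map -Ly0.
by rewrite -K00 /shuffle /= -!/(shuffle _ _) Ly1.
Qed.

Lemma leg_exchange_left (R B : sset) (p : smap R B) (L : ihom (simplex 1) R 1) a
    (K0 : ihom (simplex 1) B 1) :
  inner_fibration p -> src L = const_diag (simplex 1) R 0 a ->
  leg_exchange K0 (postc (simplex 1) p 1 L) ->
  exists2 K, leg_exchange K L & postc (simplex 1) p 1 K = K0.
Proof.
move=> p_fib La [th0 [f0 [K00 K01 L00 th03 th00]]].
pose f := eval_at R (vx ord_max) 1 L.
have [f2 f0' f1] := s0E f; have [g2 g0 g1] := s1E f.
have pf : p 1 f = f0.
  have [_ <-] := leg_exchange_edge K01 L00 th03 th00.
  by rewrite /f !eval1_shuffle d_map.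
have fL : f = d_ ord0 (shuffle L ord0) by rewrite /f eval1_shuffle.
have L1 := square_src La.
have fa : src f = a.
  have -> : src f = tgt (d_ ord_max (shuffle L ord0)).
    by rewrite fL /src /tgt; simplicial.
  by rewrite L1 tgt_degen.
have [||||||th [thd0 thd2 thd3 pth]] :=
  @fill31 R B p (s1 f) (shuffle L ord0) (s0 f) th0 p_fib.
- by rewrite g1.
- by rewrite f0' g2.
- by rewrite f2 fa L1.
- by rewrite s1_map pf.
- exact: L00.
- by rewrite s0_map pf.
have [|K [Ky0 Ky1]] := @square_ex R (shuffle L ord_max) (d_ o14 th).
  by rewrite -shuffle_diag -thd2; simplicial.
exists K; first by exists th, f.
apply: square_eq; last by rewrite K01 -pth -d_map -Ky1.
by rewrite K00 /shuffle /= -!/(shuffle _ _) Ky0.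
Qed.

Definition exchange (R : sset) (e : ihom span_shape R 1) (e' : ihom cospan_shape R 1) : Prop :=
  leg_exchange (prec R (leg1 ord0) 1 e) (prec R (leg1 ord_max) 1 e') /\
  leg_exchange (prec R (leg2 ord0) 1 e) (prec R (leg2 ord_max) 1 e').

Lemma wedge_apex v : leg1 v 0 (vx v) = leg2 v 0 (vx v).
Proof. exact: eq_exist. Qed.

(** The legs are exchanged separately; the results agree at the apex, where each keeps the edge
    common to the two given squares. *)
Lemma exchange_right (R B : sset) (p : smap R B) (e : ihom span_shape R 1) b
    (e0 : ihom cospan_shape B 1) :
  inner_fibration p -> tgt e = const_diag span_shape R 0 b ->
  exchange (postc span_shape p 1 e) e0 ->
  exists2 e', exchange e e' & postc cospan_shape p 1 e' = e0.
Proof.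
move=> p_fib eb [x1 x2].
have cE (g : smap (simplex 1) span_shape) :
    tgt (prec R g 1 e) = const_diag (simplex 1) R 0 b by rewrite [tgt _](snat (prec R g) eb).
have [L1 KL1 L10] := leg_exchange_right p_fib (cE (leg1 ord0)) x1.
have [L2 KL2 L20] := leg_exchange_right p_fib (cE (leg2 ord0)) x2.
have [L1e _ _ _] := leg_exchange_facts KL1; have [L2e _ _ _] := leg_exchange_facts KL2.
have [|e' e'1 e'2] := @wedge_ex ord_max R 1 L1 L2.
  by rewrite L1e L2e -!eval_prec wedge_apex.
exists e'; first by split; rewrite ?e'1 ?e'2.
by apply: wedge_eq; [rewrite -L10 -e'1 | rewrite -L20 -e'2].
Qed.

Lemma exchange_left (R B : sset) (p : smap R B) (e' : ihom cospan_shape R 1) a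
    (e0 : ihom span_shape B 1) :
  inner_fibration p -> src e' = const_diag cospan_shape R 0 a ->
  exchange e0 (postc cospan_shape p 1 e') ->
  exists2 e, exchange e e' & postc span_shape p 1 e = e0.
Proof.
move=> p_fib ea [x1 x2].
have cE (g : smap (simplex 1) cospan_shape) :
    src (prec R g 1 e') = const_diag (simplex 1) R 0 a by rewrite [src _](snat (prec R g) ea).
have [K1 KL1 K10] := leg_exchange_left p_fib (cE (leg1 ord_max)) x1.
have [K2 KL2 K20] := leg_exchange_left p_fib (cE (leg2 ord_max)) x2.
have [L1e _ _ _] := leg_exchange_facts KL1; have [L2e _ _ _] := leg_exchange_facts KL2.
have [|e e1 e2] := @wedge_ex ord0 R 1 K1 K2.
  by rewrite -L1e -L2e -!eval_prec wedge_apex.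
exists e; first by split; rewrite ?e1 ?e2.
by apply: wedge_eq; [rewrite -K10 -e1 | rewrite -K20 -e2].
Qed.

Definition edge_ob (Q : sset) (e : Q 1) : ihom (simplex 1) Q 0 :=
  @HSimplex (simplex 1) Q 0 (fun m _ t => act t e)
    (fun l m a s t t' E => etrans (esym (actM t a e)) (f_equal (fun r : dmap l 1 => act r e) E)).

Lemma edge_obK (Q : sset) (e : Q 1) : shuffle (edge_ob e) ord0 = e.
Proof. by apply: act_id; dmap_cases. Qed.

Lemma edge_obP (Q : sset) (u : ihom (simplex 1) Q 0) : u = edge_ob (shuffle u ord0).
Proof. by apply: shuffleP => i; rewrite [i]ord1 edge_obK. Qed.

Lemma edge_ob_map (Q R : sset) (F : smap Q R) e :
  postc (simplex 1) F 0 (edge_ob e) = edge_ob (F 1 e).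
Proof. by apply: hsimplexP => m s t /=; apply/esym/snat. Qed.

Lemma swapE (X Y A : sset) n (u : ihom X (ihom Y A) n) (w : ihom Y (ihom X A) n) :
  swap Y X A n w = u -> w = swap X Y A n u.
Proof. by move<-; rewrite swapK. Qed.

Lemma swap_edge_const (X Q : sset) (e : Q 1) :
  swap (simplex 1) X Q 0 (edge_ob (const_diag X Q 1 e)) =
  const_diag X (ihom (simplex 1) Q) 0 (edge_ob e).
Proof. by apply/esym/swapE; rewrite swap_const edge_ob_map. Qed.

Lemma eval_swap_edge (X Q : sset) (v : X 0) (e : ihom X Q 1) :
  eval_at (ihom (simplex 1) Q) v 0 (swap (simplex 1) X Q 0 (edge_ob e)) =
  edge_ob (eval_at Q v 1 e).
Proof. by rewrite -swap_eval swapK edge_ob_map. Qed.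

Definition hpair (X Q R : sset) n (u : ihom X Q n) (v : ihom X R n) : ihom X (sprod Q R) n :=
  @HSimplex X (sprod Q R) n (fun m s x => (u m s x, v m s x))
    (fun l m a s x y E => f_equal2 pair (hnat u s E) (hnat v s E)).

Lemma hpair_inj (X Q R : sset) n (u u' : ihom X Q n) (v v' : ihom X R n) :
  hpair u v = hpair u' v' -> u = u' /\ v = v'.
Proof.
move=> E; split; apply: hsimplexP => m s x.
  exact: (f_equal (fun h : ihom X (sprod Q R) n => (h m s x).1) E).
exact: (f_equal (fun h : ihom X (sprod Q R) n => (h m s x).2) E).
Qed.

Lemma leg_exchange_pair (Q R : sset) (K L : ihom (simplex 1) Q 1) (K' L' : ihom (simplex 1) R 1) :
  leg_exchange K L -> leg_exchange K' L' -> leg_exchange (hpair K K') (hpair L L').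
Proof.
case=> th [f [K0 K1 L0 th3 th0]] [th' [f' [K'0 K'1 L'0 th'3 th'0]]].
exists ((th, th') : sprod Q R 3), ((f, f') : sprod Q R 1).
by split; rewrite /shuffle /=; congr (_, _).
Qed.

Lemma exchange_pair (Q R : sset) e e' f f' : @exchange Q e e' -> @exchange R f f' ->
  exchange (hpair e f) (hpair e' f').
Proof.
move=> [x1 x2] [y1 y2]; split; first exact: (leg_exchange_pair x1 y1).
exact: (leg_exchange_pair x2 y2).
Qed.

Definition apex v : wedge v 0 := leg1 v 0 (vx v).

Lemma exchange_facts (R : sset) (e : ihom span_shape R 1) (e' : ihom cospan_shape R 1) :
  exchange e e' -> let f := eval_at R (apex ord0) 1 e in
  [/\ eval_at R (apex ord_max) 1 e' = f,
      src e' = const_diag cospan_shape R 0 (src f),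
      tgt e = const_diag span_shape R 0 (tgt f),
      eval_at R (leg1 ord_max 0 (vx ord0)) 0 (tgt e') =
        eval_at R (leg1 ord0 0 (vx ord_max)) 0 (src e) &
      eval_at R (leg2 ord_max 0 (vx ord0)) 0 (tgt e') =
        eval_at R (leg2 ord0 0 (vx ord_max)) 0 (src e)].
Proof.
move=> [/leg_exchange_facts [a1 b1 c1 d1] /leg_exchange_facts [a2 b2 c2 d2]] f.
have f1 : eval_at R (vx ord0) 1 (prec R (leg1 ord0) 1 e) = f by rewrite -eval_prec.
have f2 : eval_at R (vx ord0) 1 (prec R (leg2 ord0) 1 e) = f.
  by rewrite -eval_prec -wedge_apex.
rewrite f1 f2 in a1 b1 c1 a2 b2 c2; split.
- by rewrite eval_prec.
- by apply: wedge_eq; rewrite -1?[LHS](snat (prec R _) erefl).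
- by apply: wedge_eq; rewrite -1?[LHS](snat (prec R _) erefl).
- by rewrite !eval_prec [prec R _ 0 (tgt e')]d_map [prec R _ 0 (src e)]d_map.
- by rewrite !eval_prec [prec R _ 0 (tgt e')]d_map [prec R _ 0 (src e)]d_map.
Qed.

Lemma ends_pair (X Q : sset) n (u : ihom X (ihom (simplex 1) Q) n) :
  postc X (ends Q) n u =
  hpair (postc X (eval_at Q (vx ord0)) n u) (postc X (eval_at Q (vx ord_max)) n u).
Proof. exact: hsimplexP. Qed.

Local Notation evS A := (eval_at A (apex ord0)).
Local Notation evP A := (eval_at A (apex ord_max)).

Lemma eval_swap (X Y Q : sset) (v : X 0) n (u : ihom Y (ihom X Q) n) :
  eval_at (ihom Y Q) v n (swap Y X Q n u) = postc Y (eval_at Q v) n u.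
Proof. by rewrite -swap_eval swapK. Qed.

(** The square of cells [K] is reread as a cone [E] under a span in the arrow object of [ihom Y A].
    Its images at the two ends are [f] and [e], whose exchanges are given; exchanging [E] along the
    inner fibration [ends] respects them. *)
Lemma exchange_square_right (Y A : sset) (A_fill : has_inner_fillers A)
    (e f : ihom Y (ihom span_shape A) 1) (e' f' : ihom Y (ihom cospan_shape A) 1)
    (K : ihom (simplex 1) (ihom Y (ihom span_shape A)) 1) (b : ihom Y A 1) :
  exchange (swap Y span_shape A 1 e) (swap Y cospan_shape A 1 e') ->
  exchange (swap Y span_shape A 1 f) (swap Y cospan_shape A 1 f') ->
  eval_at _ (vx ord0) 1 K = f -> eval_at _ (vx ord_max) 1 K = e ->
  tgt K = edge_ob (postc Y (const_diag span_shape A) 1 b) ->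
  exists K' : ihom (simplex 1) (ihom Y (ihom cospan_shape A)) 1,
  [/\ eval_at _ (vx ord0) 1 K' = f', eval_at _ (vx ord_max) 1 K' = e',
      src K' = edge_ob (postc Y (const_diag cospan_shape A) 1
        (postc Y (evS A) 1 (shuffle (src K) ord0))) &
      postc Y (evP A) 1 (shuffle (tgt K') ord0) = b].
Proof.
move=> xe xf K0 K1 Kb; set Q := ihom Y A.
have Q_fill : has_inner_fillers Q by apply: ihom_fillers.
pose K1' := postc (simplex 1) (swap Y span_shape A) 1 K.
pose E := swap (simplex 1) span_shape Q 1 K1'.
have Eb : tgt E = const_diag span_shape (ihom (simplex 1) Q) 0 (edge_ob b).
  rewrite swap_tgt /K1' /tgt -d_map [d_ _ K]Kb edge_ob_map -swap_const swapK.
  exact: swap_edge_const.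
have Eev b' : postc span_shape (eval_at Q (vx b')) 1 E =
    swap Y span_shape A 1 (eval_at _ (vx b') 1 K) by rewrite swap_eval.
have [|E' xE E'fe] := @exchange_right _ _ (ends Q) E (edge_ob b)
    (hpair (swap Y cospan_shape A 1 f') (swap Y cospan_shape A 1 e'))
    (ends_fibration Q_fill) Eb.
  by rewrite ends_pair !Eev K0 K1; apply: exchange_pair.
pose K' := postc (simplex 1) (swap cospan_shape Y A) 1 (swap cospan_shape (simplex 1) Q 1 E').
have K'ev b' : eval_at _ (vx b') 1 K' =
    swap cospan_shape Y A 1 (postc cospan_shape (eval_at Q (vx b')) 1 E').
  by rewrite -[postc cospan_shape _ 1 E']eval_swap.
move: E'fe; rewrite ends_pair => /hpair_inj [E'f E'e].
have [E'1 E'src _ _ _] := exchange_facts xE.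
have swapE' : swap (simplex 1) cospan_shape Q 1 (postc (simplex 1) (swap Y cospan_shape A) 1 K') = E'.
  rewrite -[RHS]swapK; congr (swap _ _ _ _ _).
  by apply: hsimplexP => m s t; apply: swapK.
exists K'; split.
- by rewrite K'ev E'f swapK.
- by rewrite K'ev E'e swapK.
- rewrite /K' /src -!d_map -/(src _) E'src -/(src _).
  have -> : src (eval_at (ihom (simplex 1) Q) (apex ord0) 1 E) =
      edge_ob (postc Y (evS A) 1 (shuffle (src K) ord0)).
    rewrite /src -d_map -/(src E) /E swap_src /K1' /src -d_map -/(src K) {1}(edge_obP (src K)).
    by rewrite edge_ob_map eval_swap_edge eval_swap.
  by rewrite -swap_edge_const swapK edge_ob_map swap_const.
have : eval_at (ihom (simplex 1) Q) (apex ord_max) 0 (tgt E') = edge_ob b.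
  by rewrite [LHS]d_map E'1 -[d_ _ _]d_map -/(tgt E) Eb; exact: (act1 (edge_ob b)).
rewrite -swapE' swap_tgt /tgt -d_map -/(tgt K') {1}(edge_obP (tgt K')) edge_ob_map.
rewrite eval_swap_edge eval_swap => /(f_equal (fun u => shuffle u ord0)).
by rewrite !edge_obK.
Qed.

Lemma exchange_square_left (Y A : sset) (A_fill : has_inner_fillers A)
    (e f : ihom Y (ihom span_shape A) 1) (e' f' : ihom Y (ihom cospan_shape A) 1)
    (K' : ihom (simplex 1) (ihom Y (ihom cospan_shape A)) 1) (a : ihom Y A 1) :
  exchange (swap Y span_shape A 1 e) (swap Y cospan_shape A 1 e') ->
  exchange (swap Y span_shape A 1 f) (swap Y cospan_shape A 1 f') ->
  eval_at _ (vx ord0) 1 K' = f' -> eval_at _ (vx ord_max) 1 K' = e' ->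
  src K' = edge_ob (postc Y (const_diag cospan_shape A) 1 a) ->
  exists K : ihom (simplex 1) (ihom Y (ihom span_shape A)) 1,
  [/\ eval_at _ (vx ord0) 1 K = f, eval_at _ (vx ord_max) 1 K = e,
      tgt K = edge_ob (postc Y (const_diag span_shape A) 1
        (postc Y (evP A) 1 (shuffle (tgt K') ord0))) &
      postc Y (evS A) 1 (shuffle (src K) ord0) = a].
Proof.
move=> xe xf K0 K1 Ka; set Q := ihom Y A.
have Q_fill : has_inner_fillers Q by apply: ihom_fillers.
pose K1' := postc (simplex 1) (swap Y cospan_shape A) 1 K'.
pose E' := swap (simplex 1) cospan_shape Q 1 K1'.
have Ea : src E' = const_diag cospan_shape (ihom (simplex 1) Q) 0 (edge_ob a).
  rewrite swap_src /K1' /src -d_map [d_ _ K']Ka edge_ob_map -swap_const swapK.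
  exact: swap_edge_const.
have Eev b' : postc cospan_shape (eval_at Q (vx b')) 1 E' =
    swap Y cospan_shape A 1 (eval_at _ (vx b') 1 K') by rewrite swap_eval.
have [|E xE Efe] := @exchange_left _ _ (ends Q) E' (edge_ob a)
    (hpair (swap Y span_shape A 1 f) (swap Y span_shape A 1 e))
    (ends_fibration Q_fill) Ea.
  by rewrite ends_pair !Eev K0 K1; apply: exchange_pair.
pose K := postc (simplex 1) (swap span_shape Y A) 1 (swap span_shape (simplex 1) Q 1 E).
have Kev b' : eval_at _ (vx b') 1 K =
    swap span_shape Y A 1 (postc span_shape (eval_at Q (vx b')) 1 E).
  by rewrite -[postc span_shape _ 1 E]eval_swap.
move: Efe; rewrite ends_pair => /hpair_inj [Ef Ee].
have [E1 _ Etgt _ _] := exchange_facts xE.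
have swapE' : swap (simplex 1) span_shape Q 1 (postc (simplex 1) (swap Y span_shape A) 1 K) = E.
  rewrite -[RHS]swapK; congr (swap _ _ _ _ _).
  by apply: hsimplexP => m s t; apply: swapK.
exists K; split.
- by rewrite Kev Ef swapK.
- by rewrite Kev Ee swapK.
- rewrite /K /tgt -!d_map -/(tgt _) Etgt -E1 -/(tgt _).
  have -> : tgt (eval_at (ihom (simplex 1) Q) (apex ord_max) 1 E') =
      edge_ob (postc Y (evP A) 1 (shuffle (tgt K') ord0)).
    rewrite /tgt -d_map -/(tgt E') /E' swap_tgt /K1' /tgt -d_map -/(tgt K') {1}(edge_obP (tgt K')).
    by rewrite edge_ob_map eval_swap_edge eval_swap.
  by rewrite -swap_edge_const swapK edge_ob_map swap_const.
have : eval_at (ihom (simplex 1) Q) (apex ord0) 0 (src E) = edge_ob a.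
  by rewrite [LHS]d_map -E1 -[d_ _ _]d_map -/(src E') Ea; exact: (act1 (edge_ob a)).
rewrite -swapE' swap_src /src -d_map -/(src K) {1}(edge_obP (src K)) edge_ob_map.
rewrite eval_swap_edge eval_swap => /(f_equal (fun u => shuffle u ord0)).
by rewrite !edge_obK.
Qed.

(** * Exchange at the level of 2-cells *)

Lemma vert_inj A B (f g : smap A B) : vert f = vert g -> f = g.
Proof. exact: (bij_inj (vert_bij A B)). Qed.

Lemma vert_ex A B (u : ihom A B 0) : exists f : smap A B, u = vert f.
Proof. by have [g _ gK] := vert_bij A B; exists (g u); rewrite gK. Qed.

Lemma fmap_ec X Y (F : smap X Y) (x y : X 0) (e : edge x y) :
  fmap (hmap F) (ec e) = ec (edge_map F e).
Proof. exact: hmapE. Qed.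

Lemma ec_irr (X : sset) (x y : X 0) (e e' : edge x y) :
  edge_val e = edge_val e' -> ec e = ec e'.
Proof. by move=> ee'; apply/arr_inj/arr_edge. Qed.

Lemma arr_ec_ex (X : sset) (x y x' y' : X 0) (e : edge x y)
    (phi : @hom (hcat X) x' y') : arr (ec e) = arr phi ->
  exists2 e' : edge x' y', edge_val e' = edge_val e & phi = ec e'.
Proof.
move=> E; have [ex ey] : x = x' /\ y = y' by case: (projT1_eq E).
by subst x' y'; exists e => //; apply/esym/arr_inj.
Qed.

(** Packed arrows are compared because [scomp F g] and [g'] are in general equal only
    propositionally, as when [g] comes out of an exchange. *)
Definition lies_over Y B C (F : smap B C) (g h : smap Y B) (g' h' : smap Y C)
    (phi : cell g h) (psi : cell g' h') : Prop :=
  arr (postw F phi) = arr psi.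

Local Notation cS A := (const_diag span_shape A).
Local Notation cP A := (const_diag cospan_shape A).
Local Notation evS1 A := (eval_at A (leg1 ord0 0 (vx ord_max))).
Local Notation evS2 A := (eval_at A (leg2 ord0 0 (vx ord_max))).
Local Notation evP1 A := (eval_at A (leg1 ord_max 0 (vx ord0))).
Local Notation evP2 A := (eval_at A (leg2 ord_max 0 (vx ord0))).

(* A cone [chi] under a span with vertex [b] and a cone [om] over a cospan with
   vertex [a] present the same square. *)
Definition same_square Y A (a : smap Y A) (w : smap Y (ihom span_shape A))
    (W : smap Y (ihom cospan_shape A)) (b : smap Y A)
    (chi : cell w (scomp (cS A) b)) (om : cell (scomp (cP A) a) W) : Prop :=
  exists (e : edge (vert w) (vert (scomp (cS A) b)))
         (e' : edge (vert (scomp (cP A) a)) (vert W)),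
  [/\ chi = ec e, om = ec e' &
      exchange (swap Y span_shape A 1 e) (swap Y cospan_shape A 1 e')].

Lemma eval_const (X A : sset) (v : X 0) n (a : A n) :
  eval_at A v n (const_diag X A n a) = a.
Proof. exact: act1. Qed.

Lemma swap_vert_const (X Y A : sset) (b : smap Y A) :
  swap Y X A 0 (vert (scomp (const_diag X A) b)) = const_diag X (ihom Y A) 0 (vert b).
Proof. by rewrite -[RHS]swapK swap_const. Qed.

Lemma eval_swap_vert (X Y A : sset) (v : X 0) (w : smap Y (ihom X A)) :
  eval_at (ihom Y A) v 0 (swap Y X A 0 (vert w)) = vert (scomp (eval_at A v) w).
Proof. exact: eval_swap. Qed.

Lemma same_square_facts Y A a w W b chi om : @same_square Y A a w W b chi om ->
  [/\ scomp (evS A) w = a, scomp (evP A) W = b,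
      scomp (evP1 A) W = scomp (evS1 A) w & scomp (evP2 A) W = scomp (evS2 A) w].
Proof.
case=> e [e' [_ _ /exchange_facts [f1 srcE tgtE end1 end2]]].
have es : src e = vert w := edge_src e.
have et : tgt e = vert (scomp (cS A) b) := edge_tgt e.
have e's : src e' = vert (scomp (cP A) a) := edge_src e'.
have e't : tgt e' = vert W := edge_tgt e'.
rewrite swap_tgt swap_src e't es !eval_swap_vert in end1 end2.
have fs : src (eval_at (ihom Y A) (apex ord0) 1 (swap Y span_shape A 1 e)) = vert (scomp (evS A) w).
  by rewrite /src -d_map -/(src _) swap_src es eval_swap_vert.
have ft : tgt (eval_at (ihom Y A) (apex ord0) 1 (swap Y span_shape A 1 e)) = vert (scomp (evP A) W).
  by rewrite -f1 /tgt -d_map -/(tgt _) swap_tgt e't eval_swap_vert.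
rewrite fs swap_src e's swap_vert_const in srcE.
rewrite ft swap_tgt et swap_vert_const in tgtE.
split; try exact: vert_inj; apply: vert_inj.
  by rewrite -[LHS](eval_const (apex ord_max)) -srcE eval_const.
by rewrite -[LHS](eval_const (apex ord0)) -tgtE eval_const.
Qed.

Lemma leg_exchange_point (K L : ihom (simplex 1) (simplex 0) 1) : leg_exchange K L.
Proof.
exists (dconst 3 ord0), (dconst 1 ord0).
by split; apply: dmapP => i; rewrite [LHS]ord1 [RHS]ord1.
Qed.

Lemma point_eq n (x y : simplex 0 n) : x = y.
Proof. by apply: dmapP => i; rewrite [LHS]ord1 [RHS]ord1. Qed.

(** An absolute exchange is an exchange along the map to the point. The cospan [W] is whatever the
    filler produces. *)
Lemma same_square_right Y A (A_fill : has_inner_fillers A) (a b : smap Y A)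
    (w : smap Y (ihom span_shape A)) (chi : cell w (scomp (cS A) b)) :
  scomp (evS A) w = a -> exists W om, @same_square Y A a w W b chi om.
Proof.
move=> wa; have [e ->] := ec_ex (ihom_fillers (ihom_fillers A_fill)) chi.
have Q_fill : has_inner_fillers (ihom Y A) by apply: ihom_fillers.
have [||E' xE _] := @exchange_right _ _ (bang (ihom Y A)) (swap Y span_shape A 1 e) (vert b)
    (const_diag cospan_shape (simplex 0) 1 (dconst 1 ord0)) (has_inner_fillersP Q_fill).
- by rewrite swap_tgt [tgt _](edge_tgt e) swap_vert_const.
- by split; apply: leg_exchange_point.
have [_ E's _ _ _] := exchange_facts xE.
have [W WE] := vert_ex (tgt (swap cospan_shape Y A 1 E')).
have e's : d_ ord_max (swap cospan_shape Y A 1 E') = vert (scomp (cP A) a).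
  rewrite -/(src _) swap_src E's /src -d_map -/(src _) swap_src [src e](edge_src e).
  by rewrite eval_swap_vert wa swap_const.
exists W, (ec (Edge e's WE)), e, (Edge e's WE); split=> //.
by rewrite swapK.
Qed.

Lemma same_square_left Y A (A_fill : has_inner_fillers A) (a b : smap Y A)
    (W : smap Y (ihom cospan_shape A)) (om : cell (scomp (cP A) a) W) :
  scomp (evP A) W = b -> exists w chi, @same_square Y A a w W b chi om.
Proof.
move=> Wb; have [e' ->] := ec_ex (ihom_fillers (ihom_fillers A_fill)) om.
have Q_fill : has_inner_fillers (ihom Y A) by apply: ihom_fillers.
have [||E xE _] := @exchange_left _ _ (bang (ihom Y A)) (swap Y cospan_shape A 1 e') (vert a)
    (const_diag span_shape (simplex 0) 1 (dconst 1 ord0)) (has_inner_fillersP Q_fill).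
- by rewrite swap_src [src _](edge_src e') swap_vert_const.
- by split; apply: leg_exchange_point.
have [E1 _ Et _ _] := exchange_facts xE.
have [w wE] := vert_ex (src (swap span_shape Y A 1 E)).
have et : d_ ord0 (swap span_shape Y A 1 E) = vert (scomp (cS A) b).
  rewrite -/(tgt _) swap_tgt Et -E1 /tgt -d_map -/(tgt _) swap_tgt [tgt e'](edge_tgt e').
  by rewrite eval_swap_vert Wb swap_const.
exists w, (ec (Edge wE et)), (Edge wE et), e'; split=> //.
by rewrite swapK.
Qed.

(** An equation between composites is a square whose diagonal is a composite [h] common to both
    sides. The exchanged square, cut along its own diagonal, is the second equation, and its target
    side is [E]. *)
Lemma same_square_natural_right Y A (A_fill : has_inner_fillers A)
    (a b a' b' : smap Y A) w W w' W' chi om chi' om' :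
  @same_square Y A a w W b chi om -> @same_square Y A a' w' W' b' chi' om' ->
  forall (s : cell w' w) (al : cell a' a) (u : cell b' b), lies_over (evS A) s al ->
  vcomp chi s = vcomp (postw (cS A) u) chi' ->
  exists2 E : cell W' W, lies_over (evP A) E u &
    vcomp om (postw (cP A) al) = vcomp E om'.
Proof.
move=> [e [e' [-> -> xe]]] [f [f' [-> -> xf]]] s al u.
have YA_fill := @ihom_fillers Y A A_fill.
have X_fill X : has_inner_fillers (ihom Y (ihom X A)) by do 2!apply: ihom_fillers.
have [s' ->] := ec_ex (X_fill _) s; have [u' ->] := ec_ex YA_fill u.
rewrite /lies_over /postw /vcomp !fmap_ec => /arr_ec_ex [al' al'E ->].
rewrite ?fmap_ec => sq.
have [|h seh] := @tri_ex _ (X_fill _) s' e; first by rewrite [tgt _]edge_tgt [src _]edge_src.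
have [_ hs ht] := tri_ends seh.
have hs' : d_ ord_max h = vert w' by rewrite -/(src h) hs [src _]edge_src.
have ht' : d_ ord0 h = vert (scomp (cS A) b) by rewrite -/(tgt h) ht [tgt _]edge_tgt.
have fuh : tri f (postc Y (cS A) 1 u') h.
  apply/(ec_tri (X_fill _) f (edge_map (postc Y (cS A)) u') (Edge hs' ht')).
  by rewrite -sq; apply/ec_tri.
case: seh => y0 [y02 y00 y01]; case: fuh => y1 [y12 y10 y11].
have [|K [K0 K1]] := @square_ex _ y0 y1; first by rewrite y01.
have [|||K' [K'f' K'e' K's K't]] := @exchange_square_right Y A A_fill e f e' f' K u' xe xf.
- by rewrite eval0_shuffle K1.
- by rewrite eval1_shuffle K0.
- by rewrite (edge_obP (tgt K)) shuffle_tgt K1 y10.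
rewrite shuffle_src K0 y02 in K's.
pose ep := shuffle (tgt K') ord0.
have alK : d_ ord_max (shuffle K' ord0) = postc Y (cP A) 1 al'.
  by rewrite -shuffle_src K's edge_obK al'E.
have t0 : tri (postc Y (cP A) 1 al') e' (d_ o13 (shuffle K' ord0)).
  by exists (shuffle K' ord0); split=> //; rewrite -eval1_shuffle.
have t1 : tri f' ep (d_ o13 (shuffle K' ord0)).
  exists (shuffle K' ord_max); split; first by rewrite -eval0_shuffle.
    by rewrite -shuffle_tgt.
  by rewrite shuffle_diag.
have [f'ep gs gt] := tri_ends t1; have [_ gs' gt'] := tri_ends t0.
have eps : d_ ord_max ep = vert W' by rewrite -/(src ep) -f'ep [tgt _]edge_tgt.
have ept : d_ ord0 ep = vert W by rewrite -/(tgt ep) -gt gt' [tgt _]edge_tgt.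
have gs1 : d_ ord_max (d_ o13 (shuffle K' ord0)) = vert (scomp (cP A) a').
  by rewrite -/(src _) gs [src _]edge_src.
have gt1 : d_ ord0 (d_ o13 (shuffle K' ord0)) = vert W.
  by rewrite -/(tgt _) gt' [tgt _]edge_tgt.
exists (ec (Edge eps ept)); first by rewrite fmap_ec; apply: arr_edge.
transitivity (ec (Edge gs1 gt1)); first by apply/ec_tri.
by apply/esym/(ec_tri (X_fill _)).
Qed.

Lemma same_square_natural_left Y A (A_fill : has_inner_fillers A)
    (a b a' b' : smap Y A) w W w' W' chi om chi' om' :
  @same_square Y A a w W b chi om -> @same_square Y A a' w' W' b' chi' om' ->
  forall (E : cell W' W) (al : cell a' a) (u : cell b' b), lies_over (evP A) E u ->
  vcomp om (postw (cP A) al) = vcomp E om' ->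
  exists2 s : cell w' w, lies_over (evS A) s al &
    vcomp chi s = vcomp (postw (cS A) u) chi'.
Proof.
move=> [e [e' [-> -> xe]]] [f [f' [-> -> xf]]] E al u.
have YA_fill := @ihom_fillers Y A A_fill.
have X_fill X : has_inner_fillers (ihom Y (ihom X A)) by do 2!apply: ihom_fillers.
have [E' ->] := ec_ex (X_fill _) E; have [al' ->] := ec_ex YA_fill al.
rewrite /lies_over /postw /vcomp !fmap_ec => /arr_ec_ex [u' u'E ->].
rewrite ?fmap_ec => sq.
have [|h feh] := @tri_ex _ (X_fill _) f' E'; first by rewrite [tgt _]edge_tgt [src _]edge_src.
have [_ hs ht] := tri_ends feh.
have hs' : d_ ord_max h = vert (scomp (cP A) a') by rewrite -/(src h) hs [src _]edge_src.
have ht' : d_ ord0 h = vert W by rewrite -/(tgt h) ht [tgt _]edge_tgt.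
have aeh : tri (postc Y (cP A) 1 al') e' h.
  apply/(ec_tri (X_fill _) (edge_map (postc Y (cP A)) al') e' (Edge hs' ht')).
  by rewrite sq; apply/ec_tri.
case: aeh => y0 [y02 y00 y01]; case: feh => y1 [y12 y10 y11].
have [|K' [K'0 K'1]] := @square_ex _ y0 y1; first by rewrite y01.
have [|||K [Kf Ke Kt Ks]] := @exchange_square_left Y A A_fill e f e' f' K' al' xe xf.
- by rewrite eval0_shuffle K'1.
- by rewrite eval1_shuffle K'0.
- by rewrite (edge_obP (src K')) shuffle_src K'0 y02.
rewrite shuffle_tgt K'1 y10 in Kt.
pose sg := shuffle (src K) ord0.
have uK : d_ ord0 (shuffle K ord_max) = postc Y (cS A) 1 u'.
  by rewrite -shuffle_tgt Kt edge_obK u'E.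
have t0 : tri sg e (d_ o13 (shuffle K ord0)).
  exists (shuffle K ord0); split=> //; first by rewrite -shuffle_src.
  by rewrite -eval1_shuffle.
have t1 : tri f (postc Y (cS A) 1 u') (d_ o13 (shuffle K ord0)).
  exists (shuffle K ord_max); split=> //; first by rewrite -eval0_shuffle.
  by rewrite shuffle_diag.
have [sge gs gt] := tri_ends t0; have [_ gs' gt'] := tri_ends t1.
have sgs : d_ ord_max sg = vert w' by rewrite -/(src sg) -gs gs' [src _]edge_src.
have sgt : d_ ord0 sg = vert w by rewrite -/(tgt sg) sge [src _]edge_src.
have gs1 : d_ ord_max (d_ o13 (shuffle K ord0)) = vert w'.
  by rewrite -/(src _) gs' [src _]edge_src.
have gt1 : d_ ord0 (d_ o13 (shuffle K ord0)) = vert (scomp (cS A) b).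
  by rewrite -/(tgt _) gt [tgt _]edge_tgt.
exists (ec (Edge sgs sgt)); first by rewrite fmap_ec; apply: arr_edge.
transitivity (ec (Edge gs1 gt1)); first by apply/ec_tri.
by apply/esym/(ec_tri (X_fill _)).
Qed.

(** * The 2-category of simplicial sets *)

Lemma vcomp1 Y A (f g : smap Y A) (a : cell f g) : vcomp (idcell g) a = a.
Proof. exact: cmp1m. Qed.
Lemma vcompr1 Y A (f g : smap Y A) (a : cell f g) : vcomp a (idcell f) = a.
Proof. exact: cmpm1. Qed.
Lemma vcompA Y A (f g h k : smap Y A) (c : cell h k) (b : cell g h) (a : cell f g) :
  vcomp c (vcomp b a) = vcomp (vcomp c b) a.
Proof. exact: cmpA. Qed.

Lemma postw1 Y A B (F : smap A B) (f : smap Y A) : postw F (idcell f) = idcell (scomp F f).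
Proof. exact: (fmap1 (hmap (postc Y F)) (vert f)). Qed.
Lemma postwM Y A B (F : smap A B) (f g h : smap Y A) (b : cell g h) (a : cell f g) :
  postw F (vcomp b a) = vcomp (postw F b) (postw F a).
Proof. exact: (fmapM (hmap (postc Y F)) b a). Qed.
Lemma prew1 Y A B (F : smap A B) (f : smap B Y) : prew (idcell f) F = idcell (scomp f F).
Proof. exact: (fmap1 (hmap (prec Y F)) (vert f)). Qed.
Lemma prewM Y A B (F : smap A B) (f g h : smap B Y) (b : cell g h) (a : cell f g) :
  prew (vcomp b a) F = vcomp (prew b F) (prew a F).
Proof. exact: (fmapM (hmap (prec Y F)) b a). Qed.

Lemma cell_ex Y A (A_fill : has_inner_fillers A) (f g : smap Y A) (a : cell f g) :
  exists e : edge (vert f) (vert g), a = ec e.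
Proof. exact: (ec_ex (ihom_fillers A_fill)). Qed.

Lemma postw_ec Y A B (F : smap A B) (f g : smap Y A) (e : edge (vert f) (vert g)) :
  postw F (ec e : cell f g) = ec (edge_map (postc Y F) e).
Proof. exact: (fmap_ec (postc Y F) e). Qed.

Lemma prew_ec Y A B (F : smap A B) (f g : smap B Y) (e : edge (vert f) (vert g)) :
  prew (ec e : cell f g) F = ec (edge_map (prec Y F) e).
Proof. exact: (fmap_ec (prec Y F) e). Qed.

Lemma postw_id Y A (A_fill : has_inner_fillers A) (f g : smap Y A) (a : cell f g) :
  postw (sid A) a = a.
Proof. by have [e ->] := cell_ex A_fill a; rewrite postw_ec; apply: ec_irr. Qed.

Lemma postw_scomp Y A B C (A_fill : has_inner_fillers A) (F : smap B C) (G : smap A B)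
    (f g : smap Y A) (a : cell f g) :
  postw (scomp F G) a = postw F (postw G a).
Proof. by have [e ->] := cell_ex A_fill a; rewrite !postw_ec; apply: ec_irr. Qed.

Lemma prew_scomp X Y Z A (A_fill : has_inner_fillers A) (F : smap Y Z) (G : smap X Y)
    (f g : smap Z A) (a : cell f g) :
  prew a (scomp F G) = prew (prew a F) G.
Proof. by have [e ->] := cell_ex A_fill a; rewrite !prew_ec; apply: ec_irr. Qed.

Lemma prew_postw X Y A B (A_fill : has_inner_fillers A) (F : smap A B) (G : smap X Y)
    (f g : smap Y A) (a : cell f g) :
  prew (postw F a) G = postw F (prew a G).
Proof.
by have [e ->] := cell_ex A_fill a; rewrite postw_ec !prew_ec postw_ec; apply: ec_irr.
Qed.

(** The horizontal composite, taken diagonally. Both ways of composing the whiskered edges have it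
    as a composite, whence the interchange law. *)
Definition hcomp A B C n (b : ihom B C n) (a : ihom A B n) : ihom A C n :=
  @HSimplex A C n (fun m s x => b m s (a m s x))
    (fun l m t s x x' E => hnat b s (hnat a s E)).

Lemma src_ihom (A B : sset) (b : ihom A B 1) (h : smap A B) m (s : dmap m 1) (x : A m) :
  src b = vert h -> (forall i, s i = ord0) -> b m s x = h m x.
Proof.
move=> bh s0; have := f_equal (fun u : ihom A B 0 => u m (dconst m ord0) x) bh.
rewrite /src /d_ /= => <-; congr (b m _ x); apply: dmapP => i.
by rewrite s0; apply: val_inj.
Qed.

Lemma tgt_ihom (A B : sset) (b : ihom A B 1) (h : smap A B) m (s : dmap m 1) (x : A m) :
  tgt b = vert h -> (forall i, s i = ord_max) -> b m s x = h m x.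
Proof.
move=> bh s0; have := f_equal (fun u : ihom A B 0 => u m (dconst m ord0) x) bh.
rewrite /tgt /d_ /= => <-; congr (b m _ x); apply: dmapP => i.
by rewrite s0; apply: val_inj.
Qed.

Ltac edge_cases s := let i := fresh "i" in
  first [apply: dmapP => i | move=> i]; apply: val_inj => /=; case: (s i) => -[|[|?]].

Lemma tri_hcomp_r A B C (a : ihom A B 1) (b : ihom B C 1) (h : smap B C) (g : smap A B) :
  src b = vert h -> tgt a = vert g ->
  tri (postc A h 1 a) (prec C g 1 b) (hcomp b a).
Proof.
move=> bh ag; exists (hcomp (act (sdeg (ord0 : 'I_2)) b) (act (sdeg (ord_max : 'I_2)) a)).
split; apply: hsimplexP => m s x /=.
- rewrite (src_ihom _ bh); last by edge_cases s.
  by congr (h m (a m _ x)); edge_cases s.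
- rewrite (tgt_ihom _ ag); last by edge_cases s.
  by congr (b m _ _); edge_cases s.
- by congr (b m _ (a m _ x)); edge_cases s.
Qed.

Lemma tri_hcomp_l A B C (a : ihom A B 1) (b : ihom B C 1) (k : smap B C) (f : smap A B) :
  tgt b = vert k -> src a = vert f ->
  tri (prec C f 1 b) (postc A k 1 a) (hcomp b a).
Proof.
move=> bk af; exists (hcomp (act (sdeg (ord_max : 'I_2)) b) (act (sdeg (ord0 : 'I_2)) a)).
split; apply: hsimplexP => m s x /=.
- rewrite (src_ihom _ af); last by edge_cases s.
  by congr (b m _ _); edge_cases s.
- rewrite (tgt_ihom _ bk); last by edge_cases s.
  by congr (k m (a m _ x)); edge_cases s.
- by congr (b m _ (a m _ x)); edge_cases s.
Qed.

Lemma interchange A B C (B_fill : has_inner_fillers B) (C_fill : has_inner_fillers C)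
    (f g : smap A B) (h k : smap B C) (al : cell f g) (be : cell h k) :
  vcomp (prew be g) (postw h al) = vcomp (postw k al) (prew be f).
Proof.
have [a ->] := cell_ex B_fill al; have [b ->] := cell_ex C_fill be.
rewrite !postw_ec !prew_ec /vcomp.
have AC_fill := @ihom_fillers A C C_fill.
have t1 := tri_hcomp_r (edge_src b) (edge_tgt a : tgt a = _).
have t2 := tri_hcomp_l (edge_tgt b) (edge_src a : src a = _).
have [_ es et] := tri_ends t1.
have hs : d_ ord_max (hcomp b a) = vert (scomp h f).
  by rewrite -/(src (hcomp b a)) es /src -d_map (edge_src a).
have ht : d_ ord0 (hcomp b a) = vert (scomp k g).
  by rewrite -/(tgt (hcomp b a)) et /tgt -d_map (edge_tgt b).
transitivity (ec (Edge hs ht)); last apply/esym.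
  exact/(ec_tri AC_fill).
exact/(ec_tri AC_fill).
Qed.

Lemma point_fillers : has_inner_fillers (simplex 0).
Proof.
move=> n k _ y _; exists (dconst n.+1 ord0) => i _; exact: point_eq.
Qed.

Lemma cell_point Y (f g : smap Y (simplex 0)) (a b : cell f g) : a = b.
Proof.
have [e ->] := cell_ex point_fillers a; have [e' ->] := cell_ex point_fillers b.
by apply: ec_irr; apply: hsimplexP => m s x; apply: point_eq.
Qed.

(** By naturality of the counit and a triangle identity, a cell out of the constant functor at [z]
    is determined by its image in the point, where parallel cells agree. *)
Lemma initial_cell A (A_fill : has_inner_fillers A) (z : smap (simplex 0) A) :
  initial_object z -> forall Y (x : smap Y A),
  (exists phi : cell (scomp z (bang Y)) x, True) /\
  forall phi psi : cell (scomp z (bang Y)) x, phi = psi.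
Proof.
move=> [eta [eps [tri1 _]]] Y x; split; first by exists (prew eps x).
have epsz : vcomp (prew eps (scomp z (bang Y)))
    (prew (postw z eta) (bang Y)) = idcell (scomp z (bang Y)).
  rewrite (prew_scomp A_fill z (bang Y) eps).
  apply: etrans (esym (prewM (bang Y) (prew eps z) (postw z eta))) _.
  by rewrite tri1; apply: prew1.
have natE (phi : cell (scomp z (bang Y)) x) : phi =
    vcomp (vcomp (prew eps x) (postw (scomp z (bang A)) phi)) (prew (postw z eta) (bang Y)).
  rewrite (interchange A_fill A_fill phi eps) -vcompA epsz.
  by rewrite (postw_id A_fill phi); apply: esym (vcompr1 phi).
move=> phi psi; rewrite (natE phi) (natE psi) !(postw_scomp A_fill).
by rewrite (cell_point (postw (bang A) phi) (postw (bang A) psi)).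
Qed.

Lemma terminal_cell A (A_fill : has_inner_fillers A) (z : smap (simplex 0) A) :
  terminal_object z -> forall Y (x : smap Y A),
  (exists phi : cell x (scomp z (bang Y)), True) /\
  forall phi psi : cell x (scomp z (bang Y)), phi = psi.
Proof.
move=> [eta [eps [_ tri2]]] Y x; split; first by exists (prew eta x).
have etaz : vcomp (prew (postw z eps) (bang Y))
    (prew eta (scomp z (bang Y))) = idcell (scomp z (bang Y)).
  rewrite (prew_scomp A_fill z (bang Y) eta).
  apply: etrans (esym (prewM (bang Y) (postw z eps) (prew eta z))) _.
  by rewrite tri2; apply: prew1.
have natE (phi : cell x (scomp z (bang Y))) : phi =
    vcomp (prew (postw z eps) (bang Y)) (vcomp (postw (scomp z (bang A)) phi) (prew eta x)).
  rewrite -(interchange A_fill A_fill phi eta) vcompA etaz.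
  by rewrite (postw_id A_fill phi); apply: esym (vcomp1 phi).
move=> phi psi; rewrite (natE phi) (natE psi) !(postw_scomp A_fill).
by rewrite (cell_point (postw (bang A) phi) (postw (bang A) psi)).
Qed.

(** * Cells between pointed wedges *)

Lemma shuffle_degen (Q : sset) (w : ihom (simplex 1) Q 0) :
  shuffle (degen w) ord0 = s1 (shuffle w ord0) /\
  shuffle (degen w) ord_max = s0 (shuffle w ord0).
Proof.
rewrite (edge_obP w) edge_obK; split; rewrite /shuffle /degen /= /s0 /s1;
  by apply: act_eq; dmap_cases.
Qed.

Lemma eval0_edge (Q : sset) (F : ihom (simplex 1) Q 0) :
  eval_at Q (vx ord0) 0 F = src (shuffle F ord0).
Proof. by rewrite eval0_shuffle (_ : ord_max = ord0 :> 'I_1) //; apply: val_inj. Qed.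

(* An endomorphism of the edge [f] in [Q^(Delta^1)] over identities is
   homotopic, over identities, to one whose triangle below the diagonal is
   degenerate; the other triangle is then a loop in the mapping space, and is
   inverted by filling a horn. *)
Lemma edge_endo_inverse (Q : sset) (Q_fill : has_inner_fillers Q)
    (F : ihom (simplex 1) Q 0) (K : ihom (simplex 1) Q 1) :
  src K = F -> tgt K = F ->
  (forall b, eval_at Q (vx b) 1 K = degen (eval_at Q (vx b) 0 F)) ->
  exists M N : ihom (simplex 1) Q 2,
  [/\ d_ ord_max M = K, d_ ord0 M = degen F, d_ ord_max N = d_ o13 M,
      d_ o13 N = degen F &
      forall b, eval_at Q (vx b) 2 M = act (dconst 2 ord0) (eval_at Q (vx b) 0 F) /\
                eval_at Q (vx b) 2 N = act (dconst 2 ord0) (eval_at Q (vx b) 0 F)].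
Proof.
move=> Ks Kt Kb; pose f := shuffle F ord0.
have F0 : eval_at Q (vx ord0) 0 F = src f by rewrite eval0_edge.
have F1 : eval_at Q (vx ord_max) 0 F = tgt f by rewrite eval1_shuffle.
have u2 : d_ ord_max (shuffle K ord0) = f by rewrite -shuffle_src Ks.
have u0 : d_ ord0 (shuffle K ord0) = degen (tgt f) by rewrite -eval1_shuffle Kb F1.
have l2 : d_ ord_max (shuffle K ord_max) = degen (src f) by rewrite -eval0_shuffle Kb F0.
have l0 : d_ ord0 (shuffle K ord_max) = f by rewrite -shuffle_tgt Kt.
have ul := shuffle_diag K.
have [f2 f0 f1] := s0E f; have [g2 g0 g1] := s1E f.
(* The last shuffle of both prisms [M] and [N]: a degeneracy of [f] with the source repeated three
   times. *)
pose X : Q 3 := act (chainT (ord_max : 'I_3)) f.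
have [X3 X2 [X1 X0]] : [/\ d_ ord_max X = act (dconst 2 ord0) (src f), d_ o24 X = s0 f
   & d_ o14 X = s0 f /\ d_ ord0 X = s0 f].
  by split; [| |split]; rewrite /X /s0 /src; simplicial.
pose T : Q 2 := act (dconst 2 ord0) (tgt f).
have [T2 T1 T0] : [/\ d_ ord_max T = degen (tgt f), d_ o13 T = degen (tgt f)
    & d_ ord0 T = degen (tgt f)].
  by split; rewrite /T /tgt; simplicial.
(* [Z], [Y] and [X] will be the shuffles of [M]. [Y] makes the triangle [ord_max] of [K] degenerate,
   at the price of replacing the triangle [ord0] by [x]. *)
have [|||Y [Y0 Y2 Y3]] := @horn31 Q (s1 f) (s0 f) (shuffle K ord_max) Q_fill;
  rewrite ?f0 ?g1 ?l0 ?g2 ?l2 ?f2 //.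
have q0 : d_ ord0 (d_ o14 Y) = degen (tgt f) by rewrite -g0 -Y0; simplicial.
have q1 : d_ o13 (d_ o14 Y) = f by rewrite -f1 -Y2; simplicial.
have q2 : d_ ord_max (d_ o14 Y) = d_ o13 (shuffle K ord0) by rewrite ul -Y3; simplicial.
have [|||Z [Z0 Z1 Z3]] := @horn32 Q T (d_ o14 Y) (shuffle K ord0) Q_fill;
  rewrite ?q0 ?q2 ?u0 ?T0 ?T2 //.
have [||M [M0 M1 M2]] := @prism_ex Q Z Y X; first by [].
  by rewrite Y2.
have [Md30 Md3m [Md00 Md0m Md10 Md1m]] := shuffle2E M.
rewrite M0 in Md30 Md10; rewrite M1 in Md3m Md00; rewrite M2 in Md0m Md1m.
pose x := d_ o24 Z.
have x0 : d_ ord0 x = degen (tgt f) by rewrite -T1 -Z0 /x; simplicial.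
have x1 : d_ o13 x = f by rewrite -q1 -Z1 /x; simplicial.
have x2 : d_ ord_max x = f by rewrite -u2 -Z3 /x; simplicial.
(* Read as cells from [f] to itself, face 3 is [x] and face 2 is the identity, so the face 1 that is
   found composes with [x] to the identity. *)
have [|||Z' [Z'0 Z'2 Z'3]] := @horn31 Q T (s1 f) x Q_fill;
  rewrite ?T1 ?T2 ?x0 ?x2 ?g0 ?g2 //.
pose x' := d_ o14 Z'.
have x'2 : d_ ord_max x' = f by rewrite -x1 -Z'3 /x'; simplicial.
have x'1 : d_ o13 x' = f by rewrite -g1 -Z'2 /x'; simplicial.
pose Y' : Q 3 := act (sdeg (ord0 : 'I_3)) x'.
have [Y'0 Y'1 [Y'2 Y'3]] : [/\ d_ ord0 Y' = x', d_ o14 Y' = x'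
    & d_ o24 Y' = s0 f /\ d_ ord_max Y' = s0 f].
  split; [| |split].
  - by rewrite /Y'; simplicial.
  - by rewrite /Y'; simplicial.
  - by rewrite -x'1 /Y' /s0; simplicial.
  - by rewrite -x'2 /Y' /s0; simplicial.
have [||N [N0 N1 N2]] := @prism_ex Q Z' Y' X; rewrite ?Y'1 ?Y'2 ?X2 //.
have [Nd30 Nd3m [Nd00 Nd0m Nd10 Nd1m]] := shuffle2E N.
rewrite N0 in Nd30 Nd10; rewrite N1 in Nd3m Nd00; rewrite N2 in Nd0m Nd1m.
have [D0 D1] := shuffle_degen F.
exists M, N; split.
- by apply: square_eq; rewrite ?Md30 ?Md3m.
- by apply: square_eq; rewrite ?Md00 ?Md0m ?D0 ?D1.
- by apply: square_eq; rewrite ?Nd30 ?Nd3m ?Md10 ?Md1m ?X1.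
- by apply: square_eq; rewrite ?Nd10 ?Nd1m ?D0 ?D1.
move=> b; have [->|->] : b = ord0 \/ b = ord_max.
  by case: b => -[|[|b]] b2 //; [left|right]; apply: val_inj.
  by rewrite eval0_edge !eval0_shuffle M2 N2 X3.
by rewrite !eval1_shuffle M0 N0 Z0 Z'0.
Qed.

Lemma wedge_vertex v (x : wedge v 0) :
  exists b, x = leg1 v 0 (vx b) \/ x = leg2 v 0 (vx b).
Proof.
case: x => -[p1 p2] [/= p2v|/= p1v].
  exists (p1 ord0); left; apply: eq_exist; congr (_, _); apply: dmapP => i;
    by rewrite ?p2v [i]ord1.
exists (p2 ord0); right; apply: eq_exist; congr (_, _); apply: dmapP => i;
  by rewrite ?p1v [i]ord1.
Qed.

(** [k] is first replaced by a homotopic [k1] that is strictly the identity at the vertices. The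
    legs are then treated separately; the simplices obtained are constant at the apex, hence
    glue. *)
Lemma wedge_endo_inverse v (Q : sset) (Q_fill : has_inner_fillers Q)
    (w : ihom (wedge v) Q 0) (k : ihom (wedge v) Q 1) :
  src k = w -> tgt k = w ->
  (forall x, homotopic (eval_at Q x 1 k) (degen (eval_at Q x 0 w))) ->
  exists e, tri k e (degen w).
Proof.
move=> ks kt khom.
have X_fill : has_inner_fillers (ihom (wedge v) Q) by apply: ihom_fillers.
have evt x : tgt (eval_at Q x 1 k) = eval_at Q x 0 w by rewrite /tgt -d_map [d_ _ k]kt.
have /choice [z zE] : forall x, exists t : Q 2, [/\ d_ ord_max t = eval_at Q x 1 k,
    d_ ord0 t = degen (eval_at Q x 0 w) & d_ o13 t = degen (eval_at Q x 0 w)].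
  by move=> x; have := khom x; rewrite /homotopic evt.
pose y (i : 'I_3) : ihom (wedge v) Q 1 := if i == 0 :> nat then degen w else k.
have y_compat : compat o13 y.
  apply: compat_faces => -[[|[|[|i]]] i3] // -[[|[|[|j]]] j3] // i' j' ik jk /= iE [jE] // ij;
    try by [case: ik; apply: val_inj | case: jk; apply: val_inj | lia].
  have -> : i' = ord0 by apply: val_inj.
  have -> : j' = ord_max by apply: val_inj.
  exact: etrans kt (esym (src_degen w)).
have degen_ev x : degen (eval_at Q x 0 w) = eval_at Q x 1 (degen w).
  exact: (snat (eval_at Q x) (erefl (degen w))).
have [|t tE tz] := ihom_vertex_fillers Q_fill (isT : 0 < o13 < 2) y_compat (z := z).
  move=> -[[|[|[|i]]] i3] // x ik; have [z2 z0 z1] := zE x.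
  - by rewrite (@d_eq _ _ _ _ ord0) // z0 degen_ev.
  - by case: ik; apply: val_inj.
  - by rewrite (@d_eq _ _ _ _ ord_max) // z2.
have t2 : d_ ord_max t = k by rewrite tE.
have t0 : d_ ord0 t = degen w by rewrite tE.
pose k1 := d_ o13 t.
have k1s : src k1 = w by rewrite -ks /k1 -t2 /src; simplicial.
have k1t : tgt k1 = w.
  by rewrite -[RHS](tgt_degen w) /k1 -t0 /tgt; simplicial.
have k1ev x : eval_at Q x 1 k1 = degen (eval_at Q x 0 w).
  by rewrite /k1 d_map tz; case: (zE x).
have kk1 : homotopic k k1 by exists t; split=> //; rewrite kt.
have leg (g : smap (simplex 1) (wedge v)) : exists M N : ihom (simplex 1) Q 2,
  [/\ d_ ord_max M = prec Q g 1 k1, d_ ord0 M = degen (prec Q g 0 w),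
      d_ ord_max N = d_ o13 M, d_ o13 N = degen (prec Q g 0 w) &
      forall b, eval_at Q (vx b) 2 M = act (dconst 2 ord0) (eval_at Q (g 0 (vx b)) 0 w) /\
                eval_at Q (vx b) 2 N = act (dconst 2 ord0) (eval_at Q (g 0 (vx b)) 0 w)].
  have [|||M [N [M2 M0 N2 N1 MN]]] := @edge_endo_inverse Q Q_fill (prec Q g 0 w) (prec Q g 1 k1).
  - by rewrite /src -d_map [d_ _ k1]k1s.
  - by rewrite /tgt -d_map [d_ _ k1]k1t.
  - by move=> b; rewrite -!eval_prec k1ev.
  by exists M, N; split=> // b; rewrite eval_prec; apply: MN.
have [M1 [N1 [M12 M10 N12 N11 MN1]]] := leg (leg1 v).
have [M2 [N2 [M22 M20 N22 N21 MN2]]] := leg (leg2 v).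
have [|M ME1 ME2] := @wedge_ex v Q 2 M1 M2.
  by rewrite (MN1 v).1 (MN2 v).1 wedge_apex.
have [|N NE1 NE2] := @wedge_ex v Q 2 N1 N2.
  by rewrite (MN1 v).2 (MN2 v).2 wedge_apex.
have degen_prec (g : smap (simplex 1) (wedge v)) : prec Q g 1 (degen w) = degen (prec Q g 0 w).
  exact/esym/(snat (prec Q g) (erefl (degen w))).
have k1M : tri k1 (degen w) (d_ o13 M).
  exists M; split=> //; apply: wedge_eq; rewrite d_map ?ME1 ?ME2 ?degen_prec //.
have MN : tri (d_ o13 M) (d_ ord0 N) (degen w).
  exists N; split=> //; apply: wedge_eq; rewrite ?degen_prec !d_map ?ME1 ?ME2 ?NE1 ?NE2 //.
exists (d_ ord0 N); apply: (tri_homotopic_l X_fill MN).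
apply: homotopic_sym => //; apply: (homotopic_trans X_fill kk1).
by rewrite /homotopic k1t.
Qed.

Lemma ec_degen (X : sset) (x : X 0) :
  ec (Edge (src_degen x) (tgt_degen x)) = idm (x : hcat X).
Proof. by apply/pclassP/peq_degen. Qed.

(** A one-sided inverse [k'] suffices: the composite [k' k k] equals [k] on one side and [k' k], the
    identity, on the other. *)
Lemma cell_idem_id v Y A (A_fill : has_inner_fillers A) (w : smap Y (ihom (wedge v) A))
    (k : cell w w) :
  (forall x, postw (eval_at A x) k = idcell (scomp (eval_at A x) w)) ->
  vcomp k k = k -> k = idcell w.
Proof.
have X_fill : has_inner_fillers (ihom (wedge v) A) by apply: ihom_fillers.
have Q_fill : has_inner_fillers (ihom Y A) by apply: ihom_fillers.
have [e eE] := cell_ex X_fill k => kx kk.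
have [|||e' ee'] := @wedge_endo_inverse v _ Q_fill (swap Y _ A 0 (vert w)) (swap Y _ A 1 e).
- by rewrite swap_src [src e](edge_src e).
- by rewrite swap_tgt [tgt e](edge_tgt e).
- move=> x; rewrite eval_swap eval_swap_vert.
  have := kx x; rewrite eE postw_ec => kx'.
  apply: (iffLR (ecP Q_fill (edge_map (postc Y (eval_at A x)) e)
    (Edge (src_degen (vert (scomp (eval_at A x) w))) (tgt_degen _)))).
  by rewrite ec_degen.
have {ee'} := tri_map (swap (wedge v) Y A) ee'; rewrite swapK.
rewrite -[swap _ _ _ _ (degen _)](snat (swap (wedge v) Y A) erefl) swapK -/(degen (vert w)).
set c := swap _ _ _ _ e' => ec_w; have [ct _ cs] := tri_ends ec_w.
have c_src : d_ ord_max c = vert w by rewrite -/(src c) -ct [tgt e](edge_tgt e).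
have c_tgt : d_ ord0 c = vert w by rewrite -/(tgt c) -cs tgt_degen.
pose k' : cell w w := ec (Edge c_src c_tgt).
have k'k : vcomp k' k = idcell w.
  rewrite eE; transitivity (ec (Edge (src_degen (vert w)) (tgt_degen (vert w)))).
    exact/(ec_tri (ihom_fillers X_fill)).
  exact: ec_degen.
by rewrite -[LHS]vcomp1 -k'k -vcompA kk.
Qed.

Definition initial_vertex (Q : sset) (o : Q 0) : Prop :=
  (forall x, exists e : edge o x, True) /\ forall x (e e' : edge o x), homotopic e e'.

Definition terminal_vertex (Q : sset) (o : Q 0) : Prop :=
  (forall x, exists e : edge x o, True) /\ forall x (e e' : edge x o), homotopic e e'.

(** One diagonal is a composite of [g] and [u], the other a composite of an edge out of [o] with
    [h]. Both start at [o] and end at the same vertex, so they are homotopic, and one of them serves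
    both triangles. *)
Lemma initial_square (Q : sset) (Q_fill : has_inner_fillers Q) (o : Q 0) (g h u : Q 1) :
  initial_vertex o -> src g = o -> tgt g = src u -> tgt u = tgt h ->
  exists K : ihom (simplex 1) Q 1, [/\ src K = edge_ob g, tgt K = edge_ob h
    & eval_at Q (vx ord_max) 1 K = u].
Proof.
move=> [o_ex o_uniq] go gu uh; have [c guc] := tri_ex Q_fill gu.
have [l _] := o_ex (src h).
have [|c' lhc'] := @tri_ex _ Q_fill l h; first by rewrite [tgt _](edge_tgt l).
have [_ cs ct] := tri_ends guc; have [_ c's c't] := tri_ends lhc'.
rewrite [src l](edge_src l) in c's; rewrite go in cs; rewrite uh in ct.
have lhc : tri l h c.
  apply: (tri_homotopic Q_fill lhc'); exact: (o_uniq _ (Edge c's c't) (Edge cs ct)).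
case: guc => y0 [y02 y00 y01]; case: lhc => y1 [y12 y10 y11].
have [|K [K0 K1]] := @square_ex Q y0 y1; first by rewrite y01.
exists K; split; last by rewrite eval1_shuffle K0.
  by rewrite (edge_obP (src K)) shuffle_src K0 y02.
by rewrite (edge_obP (tgt K)) shuffle_tgt K1 y10.
Qed.

Lemma terminal_square (Q : sset) (Q_fill : has_inner_fillers Q) (o : Q 0) (g h u : Q 1) :
  terminal_vertex o -> tgt h = o -> src u = src g -> tgt u = src h ->
  exists K : ihom (simplex 1) Q 1, [/\ src K = edge_ob g, tgt K = edge_ob h
    & eval_at Q (vx ord0) 1 K = u].
Proof.
move=> [o_ex o_uniq] ho ug uh; have [c uhc] := tri_ex Q_fill uh.
have [l _] := o_ex (tgt g).
have [|c' glc'] := @tri_ex _ Q_fill g l; first by rewrite [src _](edge_src l).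
have [_ cs ct] := tri_ends uhc; have [_ c's c't] := tri_ends glc'.
rewrite [tgt l](edge_tgt l) in c't; rewrite ho in ct; rewrite ug in cs.
have glc : tri g l c.
  apply: (tri_homotopic Q_fill glc'); exact: (o_uniq _ (Edge c's c't) (Edge cs ct)).
case: glc => y0 [y02 y00 y01]; case: uhc => y1 [y12 y10 y11].
have [|K [K0 K1]] := @square_ex Q y0 y1; first by rewrite y01.
exists K; split; last by rewrite eval0_shuffle K1.
  by rewrite (edge_obP (src K)) shuffle_src K0 y02.
by rewrite (edge_obP (tgt K)) shuffle_tgt K1 y10.
Qed.

Lemma initial_vertex_const A (A_fill : has_inner_fillers A) (z : smap (simplex 0) A) Y :
  initial_object z -> initial_vertex (vert (scomp z (bang Y))).
Proof.
move=> z_init; split=> x.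
  have [f ->] := vert_ex x; have [[phi _] _] := initial_cell A_fill z_init f.
  by have [e _] := cell_ex A_fill phi; exists e.
have [f ->] := vert_ex x => e e'; apply/(ecP (ihom_fillers A_fill)).
exact: (initial_cell A_fill z_init f).2.
Qed.

Lemma terminal_vertex_const A (A_fill : has_inner_fillers A) (z : smap (simplex 0) A) Y :
  terminal_object z -> terminal_vertex (vert (scomp z (bang Y))).
Proof.
move=> z_term; split=> x.
  have [f ->] := vert_ex x; have [[phi _] _] := terminal_cell A_fill z_term f.
  by have [e _] := cell_ex A_fill phi; exists e.
have [f ->] := vert_ex x => e e'; apply/(ecP (ihom_fillers A_fill)).
exact: (terminal_cell A_fill z_term f).2.
Qed.

Definition leg_edge v Y A (g : smap (simplex 1) (wedge v)) (W : smap Y (ihom (wedge v) A)) :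
  ihom Y A 1 := shuffle (prec (ihom Y A) g 0 (swap Y (wedge v) A 0 (vert W))) ord0.

Lemma leg_edge_ob v Y A (g : smap (simplex 1) (wedge v)) (W : smap Y (ihom (wedge v) A)) :
  edge_ob (leg_edge g W) = prec (ihom Y A) g 0 (swap Y (wedge v) A 0 (vert W)).
Proof. by rewrite [RHS]edge_obP. Qed.

Lemma leg_edge_src v Y A (g : smap (simplex 1) (wedge v)) (W : smap Y (ihom (wedge v) A)) :
  src (leg_edge g W) = vert (scomp (eval_at A (g 0 (vx ord0))) W).
Proof. by rewrite -eval0_edge -eval_prec eval_swap_vert. Qed.

Lemma leg_edge_tgt v Y A (g : smap (simplex 1) (wedge v)) (W : smap Y (ihom (wedge v) A)) :
  tgt (leg_edge g W) = vert (scomp (eval_at A (g 0 (vx ord_max))) W).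
Proof. by rewrite /tgt -eval1_shuffle -eval_prec eval_swap_vert. Qed.

(** The squares over the two legs both restrict to [e] at the apex, so they glue to an edge of
    diagrams. *)
Lemma wedge_cell_ex v Y A (A_fill : has_inner_fillers A) (W V : smap Y (ihom (wedge v) A))
    (b' b : smap Y A) (u : cell b' b) :
  scomp (eval_at A (apex v)) W = b' -> scomp (eval_at A (apex v)) V = b ->
  (forall e : edge (vert b') (vert b), forall g : smap (simplex 1) (wedge v),
    g = leg1 v \/ g = leg2 v ->
    exists K : ihom (simplex 1) (ihom Y A) 1,
    [/\ src K = edge_ob (leg_edge g W), tgt K = edge_ob (leg_edge g V)
      & eval_at (ihom Y A) (vx v) 1 K = e]) ->
  exists E : cell W V, lies_over (eval_at A (apex v)) E u.
Proof.
move=> Wb Vb; have [e ->] := cell_ex A_fill u => legs.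
have [K1 [K1s K1t K1e]] := legs e _ (or_introl erefl).
have [K2 [K2s K2t K2e]] := legs e _ (or_intror erefl).
have [|k kE1 kE2] := @wedge_ex v _ 1 K1 K2; first by rewrite K1e K2e.
have ks : d_ ord_max (swap (wedge v) Y A 1 k) = vert W.
  rewrite -/(src _) swap_src -[RHS]swapK; congr (swap _ _ _ _ _); apply: wedge_eq.
    by rewrite -leg_edge_ob -K1s /src d_map kE1.
  by rewrite -leg_edge_ob -K2s /src d_map kE2.
have kt : d_ ord0 (swap (wedge v) Y A 1 k) = vert V.
  rewrite -/(tgt _) swap_tgt -[RHS]swapK; congr (swap _ _ _ _ _); apply: wedge_eq.
    by rewrite -leg_edge_ob -K1t /tgt d_map kE1.
  by rewrite -leg_edge_ob -K2t /tgt d_map kE2.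
exists (ec (Edge ks kt)); rewrite /lies_over postw_ec; apply: arr_edge.
transitivity (eval_at (ihom Y A) (apex v) 1 k); first exact: swap_eval.
by rewrite /apex eval_prec kE1.
Qed.

Lemma cospan_cell_ex Y A (A_fill : has_inner_fillers A) z (z_init : @initial_object A z)
    (W V : smap Y (ihom cospan_shape A)) (b' b : smap Y A) (u : cell b' b) :
  scomp (evP1 A) W = scomp z (bang Y) -> scomp (evP2 A) W = scomp z (bang Y) ->
  scomp (evP A) W = b' -> scomp (evP A) V = b -> exists E : cell W V, lies_over (evP A) E u.
Proof.
move=> W1 W2 Wb Vb; apply: wedge_cell_ex => // e g gE.
have gv : g 0 (vx ord_max) = apex ord_max by case: gE => -> //; apply/esym/wedge_apex.
apply: (initial_square (ihom_fillers A_fill) (initial_vertex_const A_fill Y z_init)).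
- by rewrite leg_edge_src; case: gE => ->; congr vert.
- by rewrite leg_edge_tgt gv Wb [src e](edge_src e).
- by rewrite leg_edge_tgt gv Vb [tgt e](edge_tgt e).
Qed.

Lemma span_cell_ex Y A (A_fill : has_inner_fillers A) z (z_term : @terminal_object A z)
    (w v : smap Y (ihom span_shape A)) (a' a : smap Y A) (al : cell a' a) :
  scomp (evS1 A) v = scomp z (bang Y) -> scomp (evS2 A) v = scomp z (bang Y) ->
  scomp (evS A) w = a' -> scomp (evS A) v = a -> exists s : cell w v, lies_over (evS A) s al.
Proof.
move=> v1 v2 wa va; apply: wedge_cell_ex => // e g gE.
have gv : g 0 (vx ord0) = apex ord0 by case: gE => -> //; apply/esym/wedge_apex.
apply: (terminal_square (ihom_fillers A_fill) (terminal_vertex_const A_fill Y z_term)).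
- by rewrite leg_edge_tgt; case: gE => ->; congr vert.
- by rewrite leg_edge_src gv wa [src e](edge_src e).
- by rewrite leg_edge_src gv va [tgt e](edge_tgt e).
Qed.

Lemma lies_over_comp Y B C (F : smap B C) (f g h : smap Y B) (f' g' h' : smap Y C)
    (b : cell g h) (a : cell f g) (b' : cell g' h') (a' : cell f' g') :
  lies_over F b b' -> lies_over F a a' -> lies_over F (vcomp b a) (vcomp b' a').
Proof. by move=> Fb Fa; rewrite /lies_over postwM; apply: arr_cmp. Qed.

Lemma lies_over_prew X Y B C (B_fill : has_inner_fillers B) (F : smap B C)
    (f g : smap Y B) (f' g' : smap Y C) (a : cell f g) (a' : cell f' g') (G : smap X Y) :
  lies_over F a a' -> lies_over F (prew a G) (prew a' G).
Proof.
move=> Fa; rewrite /lies_over -(prew_postw B_fill F G a); exact: (arr_fmap (hmap (prec C G)) Fa).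
Qed.

Lemma lies_over_id Y B C (F : smap B C) (f : smap Y B) (g : smap Y C) :
  scomp F f = g -> lies_over F (idcell f) (idcell g).
Proof. by move=> <-; rewrite /lies_over postw1. Qed.

Lemma lies_over_inj Y B C (F : smap B C) (f g : smap Y B) (f' g' : smap Y C)
    (a b : cell f g) (c : cell f' g') : lies_over F a c -> lies_over F b c ->
  postw F a = postw F b.
Proof. by rewrite /lies_over => Fa Fb; apply: arr_inj; rewrite Fa Fb. Qed.

Lemma wedge_vertex_cases v (P : wedge v 0 -> Prop) (b : 'I_2) : b <> v ->
  P (apex v) -> P (leg1 v 0 (vx b)) -> P (leg2 v 0 (vx b)) -> forall x, P x.
Proof.
move=> bv Pa P1 P2 x; have bE c : c = b \/ c = v.
  by move: bv; case: b {P1 P2} => -[|[|?]] ?; case: v x P Pa => -[|[|?]] ? _ _ _ //;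
    case: c => -[|[|?]] ? // nE; (try by [left; apply: val_inj | right; apply: val_inj]);
    case: nE; apply: val_inj.
by have [c [->|->]] := wedge_vertex x; have [->|->] := bE c => //; rewrite -wedge_apex.
Qed.

(* [kap] is the counit of [rbar -| evP]. Naturality makes [k] idempotent, and [k]
   is invertible because it is the identity at all vertices; so [prew kap W] is
   split epi, and [phi] is determined by its composite with it. *)
Lemma cospan_cell_inj Y A (A_fill : has_inner_fillers A) z (z_init : @initial_object A z)
    (rbar : smap A (ihom cospan_shape A)) (W V : smap Y (ihom cospan_shape A))
    (phi psi : cell W V) :
  scomp (evP A) rbar = sid A -> scomp (evP1 A) rbar = scomp z (bang A) ->
  scomp (evP2 A) rbar = scomp z (bang A) ->
  scomp (evP1 A) W = scomp z (bang Y) -> scomp (evP2 A) W = scomp z (bang Y) ->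
  postw (evP A) phi = postw (evP A) psi -> phi = psi.
Proof.
move=> rb rb1 rb2 W1 W2 phi_psi.
have X_fill : has_inner_fillers (ihom cospan_shape A) by apply: ihom_fillers.
have rW1 X (f : smap X A) : scomp (evP1 A) (scomp rbar f) = scomp z (bang X).
  by rewrite -[LHS]/(scomp (scomp (evP1 A) rbar) f) rb1.
have rW2 X (f : smap X A) : scomp (evP2 A) (scomp rbar f) = scomp z (bang X).
  by rewrite -[LHS]/(scomp (scomp (evP2 A) rbar) f) rb2.
have rW X (f : smap X A) : scomp (evP A) (scomp rbar f) = f.
  by rewrite -[LHS]/(scomp (scomp (evP A) rbar) f) rb.
have [kap kapE] := cospan_cell_ex A_fill z_init (idcell (evP A)) (rW1 _ (evP A)) (rW2 _ _)
  (rW _ _) (erefl : scomp (evP A) (sid _) = evP A).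
have nat (V' : smap Y (ihom cospan_shape A)) (c : cell W V') :
    vcomp c (prew kap W) = vcomp (prew kap V') (postw rbar (postw (evP A) c)).
  have := interchange X_fill X_fill c kap.
  by rewrite (postw_scomp X_fill rbar (evP A) c) (postw_id X_fill c) => <-.
have [iot iotE] := cospan_cell_ex A_fill z_init (idcell (scomp (evP A) W)) W1 W2 erefl
  (rW _ (scomp (evP A) W)).
pose k : cell W W := vcomp (prew kap W) iot.
have kE : postw (evP A) k = idcell (scomp (evP A) W).
  apply: arr_inj; have := lies_over_comp (lies_over_prew X_fill W kapE) iotE.
  by rewrite /lies_over => ->; rewrite prew1 vcomp1.
have kkap : vcomp k (prew kap W) = prew kap W.
  by rewrite nat kE (postw1 rbar); apply: vcompr1.
have k1 : k = idcell W.
  apply: (cell_idem_id A_fill); last by rewrite {2}/k vcompA kkap.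
  have uniq (f : smap Y A) : f = scomp z (bang Y) -> forall a b : cell f f, a = b.
    by move=> ->; apply: (initial_cell A_fill z_init _).2.
  by apply: (@wedge_vertex_cases _ _ ord0) => //; apply: uniq.
rewrite -[phi]vcompr1 -[psi]vcompr1 -k1 /k !vcompA !nat.
by rewrite phi_psi.
Qed.

(** Dually, [kap] is the unit of the adjunction with left adjoint [evS A] and right adjoint [xbar],
    and [prew kap v] is split mono; [phi] is recovered from its composite with it. *)
Lemma span_cell_inj Y A (A_fill : has_inner_fillers A) z (z_term : @terminal_object A z)
    (xbar : smap A (ihom span_shape A)) (w v : smap Y (ihom span_shape A))
    (phi psi : cell w v) :
  scomp (evS A) xbar = sid A -> scomp (evS1 A) xbar = scomp z (bang A) ->
  scomp (evS2 A) xbar = scomp z (bang A) ->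
  scomp (evS1 A) v = scomp z (bang Y) -> scomp (evS2 A) v = scomp z (bang Y) ->
  postw (evS A) phi = postw (evS A) psi -> phi = psi.
Proof.
move=> xb xb1 xb2 v1 v2 phi_psi.
have X_fill : has_inner_fillers (ihom span_shape A) by apply: ihom_fillers.
have xv1 X (f : smap X A) : scomp (evS1 A) (scomp xbar f) = scomp z (bang X).
  by rewrite -[LHS]/(scomp (scomp (evS1 A) xbar) f) xb1.
have xv2 X (f : smap X A) : scomp (evS2 A) (scomp xbar f) = scomp z (bang X).
  by rewrite -[LHS]/(scomp (scomp (evS2 A) xbar) f) xb2.
have xv X (f : smap X A) : scomp (evS A) (scomp xbar f) = f.
  by rewrite -[LHS]/(scomp (scomp (evS A) xbar) f) xb.
have [kap kapE] := span_cell_ex A_fill z_term (idcell (evS A)) (xv1 _ (evS A)) (xv2 _ _)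
  (erefl : scomp (evS A) (sid _) = evS A) (xv _ _).
have nat (w' : smap Y (ihom span_shape A)) (c : cell w' v) :
    vcomp (prew kap v) c = vcomp (postw xbar (postw (evS A) c)) (prew kap w').
  have := interchange X_fill X_fill c kap.
  by rewrite (postw_scomp X_fill xbar (evS A) c) (postw_id X_fill c) => ->.
have [iot iotE] := span_cell_ex A_fill z_term (idcell (scomp (evS A) v)) v1 v2
  (xv _ (scomp (evS A) v)) erefl.
pose k : cell v v := vcomp iot (prew kap v).
have kE : postw (evS A) k = idcell (scomp (evS A) v).
  apply: arr_inj; have := lies_over_comp iotE (lies_over_prew X_fill v kapE).
  by rewrite /lies_over => ->; rewrite prew1 vcomp1.
have kkap : vcomp (prew kap v) k = prew kap v.
  by rewrite nat kE (postw1 xbar); apply: vcomp1.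
have k1 : k = idcell v.
  apply: (cell_idem_id A_fill); last by rewrite {1}/k -vcompA kkap.
  have uniq (f : smap Y A) : f = scomp z (bang Y) -> forall a b : cell f f, a = b.
    by move=> ->; apply: (terminal_cell A_fill z_term _).2.
  by apply: (@wedge_vertex_cases _ _ ord_max) => //; apply: uniq.
rewrite -[phi]vcomp1 -[psi]vcomp1 -k1 /k -!vcompA !nat.
by rewrite phi_psi.
Qed.

(** * Transposition and the adjunction *)

Lemma exchange_map (R B : sset) (p : smap R B) e e' : exchange e e' ->
  exchange (postc span_shape p 1 e) (postc cospan_shape p 1 e').
Proof.
move=> [x1 x2]; split; first exact: (leg_exchange_map p x1).
exact: (leg_exchange_map p x2).
Qed.

Lemma swap_prec_l (X Y Y' A : sset) (g : smap Y' Y) n (u : ihom Y (ihom X A) n) :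
  swap Y' X A n (prec (ihom X A) g n u) = postc X (prec A g) n (swap Y X A n u).
Proof. by rewrite -{1}(swapK u) swap_prec_r swapK. Qed.

Lemma same_square_prew X Y A a w W b chi om (h : smap X Y) :
  @same_square Y A a w W b chi om ->
  @same_square X A (scomp a h) (scomp w h) (scomp W h) (scomp b h) (prew chi h) (prew om h).
Proof.
case=> e [e' [-> -> xe]].
exists (edge_map (prec (ihom span_shape A) h) e), (edge_map (prec (ihom cospan_shape A) h) e').
by rewrite !prew_ec; split=> //; rewrite !swap_prec_l; apply: exchange_map.
Qed.

Lemma lies_over_section Y A B (A_fill : has_inner_fillers A) (F : smap B A) (G : smap A B)
    (f g : smap Y A) (e : cell f g) : scomp F G = sid A -> lies_over F (postw G e) e.
Proof.
move=> FG; rewrite /lies_over -(postw_scomp A_fill F G e).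
(* [scomp F G] is generalised before it is replaced by the identity, because the type of the
   whiskered cell depends on it. *)
have H_id (H : smap A A) : H = sid A -> arr (postw H e) = arr e.
  by move=> ->; rewrite (postw_id A_fill).
exact: H_id FG.
Qed.

(** Only the apex and the ends are fixed. The legs are left open, since as cells into or out of a
    zero object they are determined. *)
Definition pointed_wedge A (z : smap (simplex 0) A) v b (d : smap A (ihom (wedge v) A)) : Prop :=
  [/\ scomp (eval_at A (apex v)) d = sid A,
      scomp (eval_at A (leg1 v 0 (vx b))) d = scomp z (bang A) &
      scomp (eval_at A (leg2 v 0 (vx b))) d = scomp z (bang A)].

Lemma pointed_wedge_precomp A z v b d : @pointed_wedge A z v b d -> forall Y (f : smap Y A),
  [/\ scomp (eval_at A (apex v)) (scomp d f) = f,
      scomp (eval_at A (leg1 v 0 (vx b))) (scomp d f) = scomp z (bang Y) &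
      scomp (eval_at A (leg2 v 0 (vx b))) (scomp d f) = scomp z (bang Y)].
Proof.
move=> [d0 d1 d2] Y f; split.
- by rewrite -[LHS]/(scomp (scomp (eval_at A (apex v)) d) f) d0.
- by rewrite -[LHS]/(scomp (scomp (eval_at A (leg1 v 0 (vx b))) d) f) d1.
- by rewrite -[LHS]/(scomp (scomp (eval_at A (leg2 v 0 (vx b))) d) f) d2.
Qed.

(* [W] is a cospan with vertex [b] whose ends are [z]; it need not be
   [rbar b] on the nose, whence the comparison [p]. *)
Definition transposes A (xbar : smap A (ihom span_shape A)) (rbar : smap A (ihom cospan_shape A))
    Y (a b : smap Y A) (chi : cell (scomp xbar a) (scomp (cS A) b))
    (om : cell (scomp (cP A) a) (scomp rbar b)) : Prop :=
  exists W om0 (p : cell W (scomp rbar b)),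
  [/\ @same_square Y A a (scomp xbar a) W b chi om0, lies_over (evP A) p (idcell b)
    & om = vcomp p om0].

Lemma transposes_prew A xbar rbar (A_fill : has_inner_fillers A) X Y (a b : smap Y A) chi om
    (h : smap X Y) :
  @transposes A xbar rbar Y a b chi om ->
  @transposes A xbar rbar X (scomp a h) (scomp b h) (prew chi h) (prew om h).
Proof.
case=> W [om0 [p [sq pb ->]]]; exists (scomp W h), (prew om0 h), (prew p h); split.
- exact: (same_square_prew h sq).
- by have := lies_over_prew (ihom_fillers A_fill) h pb; rewrite prew1.
- exact: (prewM h p om0).
Qed.

Definition transpose_setting A (z : smap (simplex 0) A)
    (xbar : smap A (ihom span_shape A)) (rbar : smap A (ihom cospan_shape A)) : Prop :=
  [/\ has_inner_fillers A, zero_object z, @pointed_wedge A z ord0 ord_max xbar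
    & @pointed_wedge A z ord_max ord0 rbar].

Lemma transposes_right A z xbar rbar : @transpose_setting A z xbar rbar ->
  forall Y (a b : smap Y A) chi, exists om, @transposes A xbar rbar Y a b chi om.
Proof.
move=> [A_fill [z_term z_init] xP rP] Y a b chi.
have [x0 x1 x2] := pointed_wedge_precomp xP a.
have [r0 _ _] := pointed_wedge_precomp rP b.
have [W [om0 sq]] := same_square_right A_fill chi x0.
have [_ Wb W1 W2] := same_square_facts sq; rewrite x1 in W1; rewrite x2 in W2.
have [p pb] := cospan_cell_ex A_fill z_init (idcell b) W1 W2 Wb r0.
by exists (vcomp p om0), W, om0, p.
Qed.

(** Exchanging the equation yields a comparison [E] from [W'] to [W]. The two resulting cells from
    [W'] to [scomp rbar b] have the same value [u] at the apex, hence agree. *)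
Lemma transposes_natural A z xbar rbar : @transpose_setting A z xbar rbar ->
  forall Y (a b a' b' : smap Y A) chi om chi' om',
  @transposes A xbar rbar Y a b chi om -> @transposes A xbar rbar Y a' b' chi' om' ->
  forall (e : cell a' a) (u : cell b' b),
  vcomp chi (postw xbar e) = vcomp (postw (cS A) u) chi' ->
  vcomp om (postw (cP A) e) = vcomp (postw rbar u) om'.
Proof.
move=> [A_fill [z_term z_init] [x0 x1 x2] [r0 r1 r2]] Y a b a' b' chi om chi' om'.
move=> [W [om0 [p [sq pb ->]]]] [W' [om0' [p' [sq' p'b ->]]]] e u comm.
have [E Eu omE] := same_square_natural_right A_fill sq sq'
  (lies_over_section A_fill e x0) comm.
have [_ W'b W'1 W'2] := same_square_facts sq'.
have [_ x1' x2'] := pointed_wedge_precomp (And3 x0 x1 x2) a'.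
rewrite x1' in W'1; rewrite x2' in W'2.
rewrite -vcompA omE !vcompA; congr (vcomp _ om0').
apply: (cospan_cell_inj A_fill z_init r0 r1 r2 W'1 W'2).
have pEu := lies_over_comp pb Eu; rewrite vcomp1 in pEu.
have up'b := lies_over_comp (lies_over_section A_fill u r0) p'b; rewrite vcompr1 in up'b.
exact: (lies_over_inj pEu up'b).
Qed.

(** [W] and [W'] may differ, so [om0] and [om0'] are compared through a cell [q] over the identity.
    Exchanging backwards gives an endocell [s] of [scomp xbar a] over the identity, which must be
    the identity. *)
Lemma transposes_inj A z xbar rbar : @transpose_setting A z xbar rbar ->
  forall Y (a b : smap Y A) chi chi' om,
  @transposes A xbar rbar Y a b chi om -> @transposes A xbar rbar Y a b chi' om -> chi = chi'.
Proof.
move=> [A_fill [z_term z_init] [x0 x1 x2] [r0 r1 r2]] Y a b chi chi' om.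
move=> [W [om0 [p [sq pb ->]]]] [W' [om0' [p' [sq' p'b pp']]]].
have [_ Wb W1 W2] := same_square_facts sq; have [_ W'b W'1 W'2] := same_square_facts sq'.
have [xa x1a x2a] := pointed_wedge_precomp (And3 x0 x1 x2) a.
have [rb r1b r2b] := pointed_wedge_precomp (And3 r0 r1 r2) b.
rewrite x1a in W1 W'1; rewrite x2a in W2 W'2.
have inj V V' (f g : cell V V') := @cospan_cell_inj Y A A_fill z z_init rbar V V' f g r0 r1 r2.
have [q qb] := cospan_cell_ex A_fill z_init (idcell b) W1 W2 Wb W'b.
have [p'' p''b] := cospan_cell_ex A_fill z_init (idcell b) r1b r2b rb W'b.
have p'q : vcomp p' q = p.
  apply: inj W1 W2 _.
  have p'qb := lies_over_comp p'b qb; rewrite vcomp1 in p'qb.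
  exact: (lies_over_inj p'qb pb).
have p''p' : vcomp p'' p' = idcell W'.
  apply: inj W'1 W'2 _.
  have p''p'b := lies_over_comp p''b p'b; rewrite vcomp1 in p''p'b.
  exact: (lies_over_inj p''p'b (lies_over_id W'b)).
have qom : vcomp q om0 = om0'.
  by rewrite -[RHS]vcomp1 -p''p' -vcompA -pp' -p'q !vcompA p''p' vcomp1.
have [|s sa chi's] := same_square_natural_left A_fill sq' sq (al := idcell a) qb.
  by rewrite qom postw1 vcompr1.
have s1 : s = idcell (scomp xbar a).
  apply: (span_cell_inj A_fill z_term x0 x1 x2 x1a x2a).
  exact: (lies_over_inj sa (lies_over_id xa)).
by move: chi's; rewrite s1 vcompr1 postw1 vcomp1.
Qed.

(** Exchanging [om] gives a span [w] with legs other than those of [scomp xbar a], which the cell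
    [s] corrects. The corrected cell is transposed again, and naturality of the exchange identifies
    the result with [om]. *)
Lemma transposes_left A z xbar rbar : @transpose_setting A z xbar rbar ->
  forall Y (a b : smap Y A) om, exists chi, @transposes A xbar rbar Y a b chi om.
Proof.
move=> setting; have [A_fill [z_term z_init] xP rP] := setting => Y a b om.
have [xa x1a x2a] := pointed_wedge_precomp xP a.
have [rb r1b r2b] := pointed_wedge_precomp rP b.
have [w [chi0 sq]] := same_square_left A_fill om rb.
have [wa _ w1 w2] := same_square_facts sq; rewrite r1b in w1; rewrite r2b in w2.
have [s sa] := span_cell_ex A_fill z_term (idcell a) (esym w1) (esym w2) xa wa.
have [om' [W' [om0' [p' [sq' p'b _]]]]] := transposes_right setting (vcomp chi0 s).
exists (vcomp chi0 s), W', om0', p'; split=> //.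
have [|E Eb omE] := same_square_natural_right A_fill sq sq' (u := idcell b) sa.
  by rewrite postw1 vcomp1.
have [_ _ W'1 W'2] := same_square_facts sq'; rewrite x1a in W'1; rewrite x2a in W'2.
have {}omE : om = vcomp E om0' by move: omE; rewrite postw1 vcompr1.
rewrite omE; congr (vcomp _ om0'); case: rP => r0 r1 r2.
apply: (cospan_cell_inj A_fill z_init r0 r1 r2 W'1 W'2).
exact: (lies_over_inj Eb p'b).
Qed.

(** For the converse, naturality at identities computes the transposes of the two sides; once these
    agree, injectivity concludes. *)
Lemma transposes_natural_iff A z xbar rbar : @transpose_setting A z xbar rbar ->
  forall Y (a b a' b' : smap Y A) chi om chi' om',
  @transposes A xbar rbar Y a b chi om -> @transposes A xbar rbar Y a' b' chi' om' ->
  forall (e : cell a' a) (u : cell b' b),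
  vcomp chi (postw xbar e) = vcomp (postw (cS A) u) chi' <->
  vcomp om (postw (cP A) e) = vcomp (postw rbar u) om'.
Proof.
move=> setting Y a b a' b' chi om chi' om' t t' e u; split.
  exact: (transposes_natural setting t t').
move=> comm.
have [om1 t1] := transposes_right setting (vcomp chi (postw xbar e)).
have [om2 t2] := transposes_right setting (vcomp (postw (cS A) u) chi').
have om1E : vcomp om (postw (cP A) e) = om1.
  rewrite (transposes_natural setting t t1 (u := idcell b)).
    by rewrite postw1 vcomp1.
  by rewrite postw1 vcomp1.
have om2E : om2 = vcomp (postw rbar u) om'.
  rewrite -(transposes_natural setting t2 t' (e := idcell a') (u := u)).
    by rewrite postw1 vcompr1.
  by rewrite postw1 vcompr1.
apply: (transposes_inj setting t1); rewrite -om1E comm -om2E; exact: t2.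
Qed.

(** * Existence of the suspension and loop functors *)

Lemma represents_ends Y A (f g : smap Y A) r phi : @represents Y A f g r phi ->
  scomp (eval_at A (vx ord0)) r = f /\ scomp (eval_at A (vx ord_max)) r = g.
Proof.
move=> [e eE _]; split; apply: smapP => m y.
  have := f_equal (fun u : ihom Y A 0 => u m (dconst m ord0) y) (edge_src e).
  rewrite eE /= => <-; congr (r m y m _ _).
  by apply: dmapP => i; apply: val_inj.
have := f_equal (fun u : ihom Y A 0 => u m (dconst m ord0) y) (edge_tgt e).
rewrite eE /= => <-; congr (r m y m _ _).
by apply: dmapP => i; apply: val_inj.
Qed.

Lemma represents_ex Y A (A_fill : has_inner_fillers A) (f g : smap Y A) (phi : cell f g) :
  exists r, represents r phi.
Proof.
have [e ->] := cell_ex A_fill phi.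
have h_nat n (y : Y n) l m (a : dmap l m) (s : dmap m n) (t : simplex 1 m) t' : act a t = t' ->
    act a (edge_val e m t (act s y)) = edge_val e l t' (act (dcomp s a) y).
  by move=> <-; rewrite actM; apply: (hnat (edge_val e)).
have r_nat m n (a : dmap m n) (y : Y n) y' : act a y = y' ->
    act a (HSimplex (h_nat n y) : ihom (simplex 1) A n) = HSimplex (h_nat m y').
  by move=> <-; apply: hsimplexP => l s t /=; rewrite actM.
exists (@SMap Y (ihom (simplex 1) A) _ r_nat), e => //.
by apply: hsimplexP => m s y /=; rewrite act1.
Qed.

Lemma has_legs_ex v Y A (r : smap Y (ihom (simplex 1) A)) :
  exists w : smap Y (ihom (wedge v) A), has_legs w r r.
Proof. by have [|w [wr _]] := @wedge_pullback v Y A r r; [|exists w]. Qed.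

Lemma eval_leg v Y A (g : smap (simplex 1) (wedge v)) (w : smap Y (ihom (wedge v) A)) r b :
  scomp (prec A g) w = r -> scomp (eval_at A (g 0 (vx b))) w = scomp (eval_at A (vx b)) r.
Proof. by move=> <-; apply: smapP => n y; apply: eval_prec. Qed.

Lemma pointed_wedge_cospan A z phi r rbar :
  @represents A A (scomp z (bang A)) (sid A) r phi -> has_legs rbar r r ->
  @pointed_wedge A z ord_max ord0 rbar.
Proof.
move=> /represents_ends [r0 r1] [l1 l2].
by split; rewrite (eval_leg _ l1) || rewrite (eval_leg _ l2).
Qed.

Lemma pointed_wedge_span A z phi r xbar :
  @represents A A (sid A) (scomp z (bang A)) r phi -> has_legs xbar r r ->
  @pointed_wedge A z ord0 ord_max xbar.
Proof.
move=> /represents_ends [r0 r1] [l1 l2].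
by split; rewrite (eval_leg _ l1) || rewrite (eval_leg _ l2).
Qed.

(** A test functor [y] into [D] becomes the test functor [scomp h y] into [C]. Restricting the limit
    functor along the diagram of points thus gives the loop functor. *)
Lemma absolute_right_lifting_precomp A B C D
    (A_fill : has_inner_fillers A) (f : smap B A) (g : smap C A)
    (l : smap C B) (lam : cell (scomp f l) g) (h : smap D C) :
  absolute_right_lifting lam ->
  @absolute_right_lifting A B D f (scomp g h) (scomp l h) (prew lam h).
Proof.
move=> lamP Y Y_qcat b y chi.
have [zeta [zetaE zeta_uniq]] := lamP Y Y_qcat b (scomp h y) chi.
exists zeta; split; first by rewrite -(prew_scomp A_fill h y lam).
by move=> zeta'; rewrite -(prew_scomp A_fill h y lam); apply: zeta_uniq.
Qed.

Lemma absolute_left_lifting_precomp A B C D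
    (A_fill : has_inner_fillers A) (f : smap B A) (g : smap C A)
    (l : smap C B) (lam : cell g (scomp f l)) (h : smap D C) :
  absolute_left_lifting lam ->
  @absolute_left_lifting A B D f (scomp g h) (scomp l h) (prew lam h).
Proof.
move=> lamP Y Y_qcat b y chi.
have [zeta [zetaE zeta_uniq]] := lamP Y Y_qcat b (scomp h y) chi.
exists zeta; split; first by rewrite -(prew_scomp A_fill h y lam).
by move=> zeta'; rewrite -(prew_scomp A_fill h y lam); apply: zeta_uniq.
Qed.

Lemma suspension_ex A (z : smap (simplex 0) A) : has_inner_fillers A ->
  terminal_object z -> admits_pushouts A -> exists Sigma, is_suspension_functor z Sigma.
Proof.
move=> A_fill [xi [eps adj]] [l [lam lamP]].
have [x xE] := represents_ex A_fill xi; have [xbar xbarE] := has_legs_ex ord0 x.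
exists (scomp l xbar), xi, x, xbar, (prew lam xbar); split=> //; first by exists eps.
exact: (absolute_left_lifting_precomp (ihom_fillers A_fill) (h := xbar) lamP).
Qed.

Lemma loop_ex A (z : smap (simplex 0) A) : has_inner_fillers A ->
  initial_object z -> admits_pullbacks A -> exists Omega, is_loop_functor z Omega.
Proof.
move=> A_fill [eta [rho adj]] [l [lam lamP]].
have [r rE] := represents_ex A_fill rho; have [rbar rbarE] := has_legs_ex ord_max r.
exists (scomp l rbar), rho, r, rbar, (prew lam rbar); split=> //; first by exists eta.
exact: (absolute_right_lifting_precomp (ihom_fillers A_fill) (h := rbar) lamP).
Qed.

(** [T a b] is the graph of the bijection between cells from [scomp Sigma a] to [b] and cells from
    [a] to [scomp Omega b]. Unit and counit are the partners of identities, and each triangle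
    identity compares one of them with a whiskering of the other. *)
Lemma suspension_loop_adjunction A (z : smap (simplex 0) A) (A_qcat : quasi_category A)
    (xbar : smap A (ihom span_shape A)) (rbar : smap A (ihom cospan_shape A))
    (Sigma Omega : smap A A) (lam : cell xbar (scomp (cS A) Sigma))
    (mu : cell (scomp (cP A) Omega) rbar) :
  transpose_setting z xbar rbar -> absolute_left_lifting lam -> absolute_right_lifting mu ->
  left_adjoint Sigma Omega.
Proof.
move=> setting lamP muP; have [A_fill _ _ _] := setting.
have S_fill : has_inner_fillers (ihom span_shape A) by apply: ihom_fillers.
have P_fill : has_inner_fillers (ihom cospan_shape A) by apply: ihom_fillers.
pose toS (a b : smap A A) (f : cell (scomp Sigma a) b) : cell (scomp xbar a) (scomp (cS A) b) :=
  vcomp (postw (cS A) f) (prew lam a).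
pose toP (a b : smap A A) (g : cell a (scomp Omega b)) : cell (scomp (cP A) a) (scomp rbar b) :=
  vcomp (prew mu b) (postw (cP A) g).
pose T a b f g := transposes (toS a b f) (toP a b g).
have toS_inj a b f f' : toS a b f = toS a b f' -> f = f'.
  move=> ff'; have [h [_ h_uniq]] := lamP A A_qcat b a (toS a b f).
  by rewrite -(h_uniq f) // -(h_uniq f').
have toP_inj a b g g' : toP a b g = toP a b g' -> g = g'.
  move=> gg'; have [h [_ h_uniq]] := muP A A_qcat a b (toP a b g).
  by rewrite -(h_uniq g) // -(h_uniq g').
have T_right a b f : exists g, T a b f g.
  have [om t] := transposes_right setting (toS a b f).
  by have [g [gE _]] := muP A A_qcat a b om; exists g; rewrite /T /toP -gE.
have T_left a b g : exists f, T a b f g.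
  have [chi t] := transposes_left setting (toP a b g).
  by have [f [fE _]] := lamP A A_qcat b a chi; exists f; rewrite /T /toS -fE.
have T_nat a b a' b' f g f' g' : T a b f g -> T a' b' f' g' ->
    forall (e : cell a' a) (u : cell b' b),
    vcomp f (postw Sigma e) = vcomp u f' <-> vcomp g e = vcomp (postw Omega u) g'.
  move=> t t' e u; have comm := transposes_natural_iff setting t t' e u.
  have SE : vcomp (toS a b f) (postw xbar e) = toS a' b (vcomp f (postw Sigma e)).
    rewrite /toS -vcompA (interchange A_fill S_fill e lam) vcompA postwM.
    by rewrite (postw_scomp A_fill (cS A) Sigma e).
  have SE' : vcomp (postw (cS A) u) (toS a' b' f') = toS a' b (vcomp u f').
    by rewrite /toS postwM vcompA.
  have PE : vcomp (toP a b g) (postw (cP A) e) = toP a' b (vcomp g e).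
    by rewrite /toP postwM vcompA.
  have PE' : vcomp (postw rbar u) (toP a' b' g') = toP a' b (vcomp (postw Omega u) g').
    rewrite /toP vcompA -(interchange A_fill P_fill u mu) -vcompA postwM.
    by rewrite (postw_scomp A_fill (cP A) Omega u).
  rewrite SE SE' PE PE' in comm; split=> [fu|gu].
    by apply/toP_inj/(iffLR comm); rewrite fu.
  by apply/toS_inj/(iffRL comm); rewrite gu.
have T_prew a b f g (h : smap A A) : T a b f g -> T (scomp a h) (scomp b h) (prew f h) (prew g h).
  move=> t; have := transposes_prew A_fill h t.
  rewrite /T /toS /toP !prewM (prew_postw A_fill (cS A) h f) (prew_postw A_fill (cP A) h g).
  by rewrite (prew_scomp S_fill a h lam) (prew_scomp P_fill b h mu).
have [eta t_eta] := T_right (sid A) Sigma (idcell Sigma).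
have [eps t_eps] := T_left Omega (sid A) (idcell Omega).
exists eta, eps; split.
  have eta_eq : vcomp (prew (idcell Omega) Sigma) eta = vcomp (postw Omega (idcell Sigma)) eta.
    by rewrite prew1 postw1.
  (* Naturality along [eta]: on the side of [Omega] it is trivial, the partner of [eps] being an
     identity; on the side of [Sigma] it is the triangle identity. *)
  have H := iffRL (T_nat _ _ _ _ _ _ _ _ (T_prew _ _ _ _ Sigma t_eps) t_eta eta (idcell Sigma)) eta_eq.
  by apply: etrans H _; apply: vcomp1.
have eps_eq : vcomp eps (postw Sigma (idcell Omega)) = vcomp eps (prew (idcell Sigma) Omega).
  by rewrite prew1 postw1.
have H := iffLR (T_nat _ _ _ _ _ _ _ _ t_eps (T_prew _ _ _ _ Omega t_eta) (idcell Omega) eps) eps_eq.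
by apply: etrans (esym H) _; apply: vcomp1.
Qed.

Theorem proposition5p2p27 (A : sset) (z : smap (simplex 0) A)
    (A_qcat : quasi_category A) (z_zero : zero_object z)
    (A_pushouts : admits_pushouts A) (A_pullbacks : admits_pullbacks A) :
  (exists Sigma : smap A A, is_suspension_functor z Sigma) /\
  (exists Omega : smap A A, is_loop_functor z Omega) /\
  (forall Sigma Omega : smap A A,
     is_suspension_functor z Sigma -> is_loop_functor z Omega ->
     left_adjoint Sigma Omega).
Proof.
have A_fill := quasi_category_fillers A_qcat; have [z_term z_init] := z_zero.
split; first exact: suspension_ex.
split; first exact: loop_ex.
move=> Sigma Omega [xi [x [xbar [lam [_ xiE xbarE lamP]]]]].
move=> [rho [r [rbar [mu [_ rhoE rbarE muP]]]]].
apply: (suspension_loop_adjunction (z := z) A_qcat _ lamP muP); split=> //.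
  exact: pointed_wedge_span xiE xbarE.
exact: pointed_wedge_cospan rhoE rbarE.
Qed.
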